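(* Assume the continuum hypothesis (CH). Let $\vec s=(s_i:i\in\omega_1)$ be a sufficiently generic sequence of zoos, and let $U$ be the filter generated by $(\mathrm{ext}(s_i): i\in\omega_1)$. Then: (a) $U$ is an ultrafilter. (b) $(\mathcal F\vec s,\preccurlyeq^*_{\vec s})$ is order isomorphic to $D_2$. (c) The set $\mathcal G/{\sim_U}$, ordered by (the order induced by) $\le_U$, is order isomorphic to $D_2$. (d) Letting $\langle U\rangle$ be the clone generated by $\mathcal C_{\rm id}\cup\{h_A:A\in U\}$, the interval $[\langle U\rangle,\mathcal O]$ in the lattice of clones on $\mathbb N$ is order isomorphic to the Dedekind completion of $D_2$.
   Context: $\mathbb N=\{0,1,2,\dots\}$. TREES AND CREATURES. For a finite partial order $(T,\trianglelefteq)$, $\mathrm{ext}(T)$ is the set of maximal elements, $\mathrm{int}(T)=T\setminus\mathrm{ext}(T)$; $x\vartriangleleft y$ means $x\trianglelefteq y$, $x\ne y$; $\mathrm{succ}_T(\eta)$ is the set of direct $\vartriangleleft$-successors of $\eta$; $T^{[\eta]}=\{\nu\in T:\eta\trianglelefteq\nu\}$. $T$ is a tree if it has a least element $\mathrm{root}(T)$ and each set $\{\eta:\eta\trianglelefteq\nu\}$ is linearly ordered. A branch is a maximal linearly ordered subset. For a tree $S$ and $T\subseteq S$ with the induced order, $T\le S$ ($T$ is a subtree of $S$) iff $\mathrm{root}(S)\in T$ and $\emptyset\ne\mathrm{succ}_T(\eta)\subseteq\mathrm{succ}_S(\eta)$ for all $\eta\in T\cap\mathrm{int}(S)$. A creature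 is a finite tree $T$ with $\mathrm{ext}(T)\subseteq\mathbb N$, $\mathrm{int}(T)\cap\mathbb N=\emptyset$, such that for $\trianglelefteq$-incomparable $\eta_1,\eta_2$ either $\max\mathrm{ext}(T^{[\eta_1]})<\min\mathrm{ext}(T^{[\eta_2]})$ or $\max\mathrm{ext}(T^{[\eta_2]})<\min\mathrm{ext}(T^{[\eta_1]})$. It is improper if it consists of a single (external) node, otherwise proper; for proper $T$, $\|T\|=\min\{|\mathrm{succ}_T(\nu)|:\nu\in\mathrm{int}(T)\}$. ZOOS. A zoo is a sequence $s=(S_0,S_1,\dots)$ of pairwise disjoint proper creatures with $\max\mathrm{ext}(S_n)<\min\mathrm{ext}(S_{n+1})$, $\|S_n\|\ge4$ for all $n$, and $\|S_n\|\to\infty$. We identify $s$ with $\bigcup_nS_n$; $\mathrm{ext}(s)=\bigcup_n\mathrm{ext}(S_n)$, $\mathrm{int}(s)=\bigcup_n\mathrm{int}(S_n)$; a branch of $s$ is a branch of some $S_n$. $s=^*t$ (for $s=(S_0,\dots)$, $t=(T_0,\dots)$) iff there are $n_0,k_0$ with $(S_{n_0},S_{n_0+1},\dots)=(T_{k_0},T_{k_0+1},\dots)$. A gluing recipe is a sequence $r=(R_0,R_1,\dots)$ of (not necessarily proper) creatures with $\max\mathrm{ext}(R_k)<\min\mathrm{ext}(R_{k+1})$ for all $k$ such that, if $A=\{k:R_k\text{ proper}\}$ is infinite, $\lim_{k\in A}\|R_k\|=\infty$; $\mathrm{ext}(r)=\bigcup_n\mathrm{ext}(R_n)\subseteq\mathbb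 N$. For zoos $s=(S_0,\dots)$, $t=(T_0,\dots)$, we write $t\le s$ via $r$ if there are creatures $S'_k\le S_k$ ($k\in\mathrm{ext}(r)$) with $\bigcup_n\mathrm{int}(R_n)\cap\bigcup_{k\in\mathrm{ext}(r)}\mathrm{int}(S'_k)=\emptyset$ such that $t$ is obtained from $r$ by replacing each leaf $k$ by $S_k'$: $T_n=\mathrm{int}(R_n)\cup\bigcup_{k\in\mathrm{ext}(R_n)}S'_k$, with $T_n^{[\eta]}=(S'_k)^{[\eta]}$ for $\eta\in S'_k$, $k\in\mathrm{ext}(R_n)$, and $T_n^{[\eta]}=\mathrm{int}(R_n^{[\eta]})\cup\bigcup_{k\in\mathrm{ext}(R_n^{[\eta]})}S'_k$ for $\eta\in\mathrm{int}(R_n)$. $t\leqq s$ means that $t\le s$ via some $r$ with moreover $\bigcup_n\mathrm{int}(R_n)\cap\bigcup_n\mathrm{int}(S_n)=\emptyset$. $t\leqq^*s$ means $t'\leqq s$ for some $t'=^*t$. COLORINGS. A coloring of a zoo $s$ is, for some finite set $E$, a partial map $c$ into $E$ defined on (1) nodes of $s$ (unary node coloring), or (2) unordered pairs $\{\nu_1,\nu_2\}\in[\mathrm{succ}_s(\eta)]^2$, $\eta\in\mathrm{int}(s)$ (binary node coloring), or (3) $\mathrm{ext}(s)$ (branch coloring). For $t=(T_0,\dots)\leqq s$, $t$ is $c$-homogeneous if, respectively, (1) the restriction of $c$ to $\mathrm{succ}_{T_n}(\eta)$ is constant for all $n$ and $\eta\in\mathrm{int}(T_n)\cap s$; (2)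 the restriction of $c$ to $[\mathrm{succ}_{T_n}(\eta)]^2$ is constant for all $n$ and $\eta\in\mathrm{int}(T_n)\cap s$; (3) the restriction of $c$ to $\mathrm{ext}(t)$ is constant. $t\leqq^*s$ is almost $c$-homogeneous if some $t'=^*t$ is $c$-homogeneous. FRONTS. A *front in $s$ is a set $F\subseteq s$ which meets all except finitely many branches of $s$ in exactly one node; for such a branch $b$ let $F\cap b=\{\eta_{F,b}\}$. $F\approx^*_sG$ iff the symmetric difference of $F$ and $G$ is finite. $F\preccurlyeq^*_sG$ iff $\eta_{F,b}\trianglerighteq\eta_{G,b}$ for all but finitely many branches $b$ of $s$. $F+1\preccurlyeq^*_sG$ iff $\eta_{F,b}\vartriangleright\eta_{G,b}$ for all but finitely many $b$. $\mathrm{root}(s)=\{\mathrm{root}(S_n):n\in\mathbb N\}$. SUFFICIENTLY GENERIC. For $f:\mathbb N\to\mathbb N$, a zoo $s$ is almost $f$-strong if $f(\max\mathrm{ext}(S_n))\le\min\mathrm{ext}(S_{n+1})$ for all but finitely many $n$. A sequence $\vec s=(s_i:i\in\omega_1)$ of zoos is sufficiently generic if: (1) $i<j$ implies $s_j\leqq^*s_i$; (2) for every $i$ and every coloring $c$ of $s_i$ (of one of the three types) there is $j>i$ such that $s_j$ is almost $c$-homogeneous; (3) for all $f:\mathbb N\to\mathbb N$ there is $i$ such that $s_i$ is almost $f$-strong; (4) for all $i$ there is $j\ge i$ such that $(\mathrm{root}(s_i)\cap s_j)+1\preccurlyeq^*_{s_j}\mathrm{root}(s_j)$. A *front in $\vec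 s$ is a set $F$ which for some $i$ is a subset of $s_i$ and a *front in $s_i$ (then $F\cap s_j$ is a *front in $s_j$ for all $j\ge i$). For *fronts $F,G$ in $s_{i_1},s_{i_2}$ respectively: $F\approx^*_{\vec s}G$ iff $F\cap s_i\approx^*_{s_i}G\cap s_i$ for some $i\ge i_1,i_2$ (equivalently for all sufficiently large $i$); similarly $F\preccurlyeq^*_{\vec s}G$ iff $F\cap s_i\preccurlyeq^*_{s_i}G\cap s_i$ for some such $i$. $\mathcal F\vec s$ is the set of $\approx^*_{\vec s}$-classes of *fronts in $\vec s$, ordered by $\preccurlyeq^*_{\vec s}$. GROWTH FUNCTIONS AND CLONES. $\mathcal G$ is the set of growth functions: (not necessarily strictly) increasing $f:\mathbb N\to\mathbb N$ with $f(n)>n$ for all $n$. For infinite $A\subseteq\mathbb N$, $h_A(n)=\min\{a\in A:a>n\}$. For $f,g\in\mathcal G$: $f\le_Ag$ iff there is $k$ such that $f\le(\max(g,h_A))^{(k)}$ pointwise, where $^{(k)}$ denotes $k$-fold composition with itself; $f\le_Ug$ iff $f\le_Ag$ for some $A\in U$; $f\sim_Ug$ iff $f\le_Ug$ and $g\le_Uf$. A clone on $\mathbb N$ is a set of finitary operations on $\mathbb N$ containing all projections and closed under composition; $\mathcal O$ is the clone of all finitary operations; $\mathcal C_{\rm id}$ is the clone of all $g\in\mathcal O$ with $g(x_1,\dots,x_k)\le\max(x_1,\dots,x_k)$ for all $x_1,\dots,x_k$. $[\mathcal C,\mathcal O]$ is the set of clones containing $\mathcal C$, ordered by inclusion. THE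 ORDERS $D_1,D_2$. Assuming CH, $D_1$ is the unique linear order with the following properties: it has a smallest element but no largest element; it is of cardinality $\aleph_1$; it is $\aleph_1$-dense, i.e. between any two elements there are uncountably many elements; every countable subset is bounded, and moreover for any two countable sets $C,C'\subseteq D_1$ with $C\le C'$ (i.e. $x\le y$ for all $x\in C$, $y\in C'$) there is $c$ with $C\le\{c\}\le C'$. Assuming CH, $D_2$ is the unique linear order with the following properties: it has a smallest element but no largest element; every element has a direct successor; every element except the minimal one has a direct predecessor; and factoring $D_2$ by the relation ''$x\sim y$ iff the interval $[x,y]$ is finite'' yields $D_1$. ($D_2$ can be obtained as the lexicographic order on $(\{\min D_1\}\times\mathbb N)\cup((D_1\setminus\{\min D_1\})\times\mathbb Z)$.) The Dedekind completion of $D_2$ is the set of nonempty downward closed subsets of $D_2$, ordered by inclusion.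
   Formalization: The filter U is taken to contain all cofinite sets (otherwise (a) can fail), and D_1 must also satisfy strict filling: for countable C<C', C nonempty, some c has C<c<C' (the listed properties alone do not determine D_1); existence of D_1 and D_2 is proved. *)

(* Defs.v *)
From mathcomp Require Import all_boot all_order.
From mathcomp Require Import boolp classical_sets functions cardinality filter.

Set Implicit Arguments.
Unset Strict Implicit.
Unset Printing Implicit Defensive.

Local Open Scope classical_set_scope.
Local Open Scope card_scope.

(* The junk value of [nmin] (resp. [nmax]) on a set without minimum (resp.
   maximum) is 0; below they are used on nonempty (resp. nonempty finite)
   sets. *)
Definition nmin (A : set nat) : nat :=
  xget 0 [set m | A m /\ forall a, A a -> m <= a].
Definition nmax (A : set nat) : nat :=
  xget 0 [set m | A m /\ forall a, A a -> a <= m].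

(** Trees and creatures *)

(* Nodes are natural numbers or elements of an arbitrary type [V]; the leaves
   of a creature are of the first kind, its inner nodes of the second. *)
Notation node V := (nat + V)%type.

Record poset (V : Type) := Poset {
  nodes : set (node V);
  ple : node V -> node V -> Prop }.

Section Posets.
Variable V : Type.
Implicit Types (T S : poset V) (x y z : node V) (b : set (node V)).

(* [ple] is a subset of [nodes * nodes], so that equality of posets is equality
   of the underlying sets and of the order relations on them. *)
Definition is_finite_poset T :=
  [/\ finite_set (nodes T),
      forall x y, ple T x y -> nodes T x /\ nodes T y,
      forall x, nodes T x -> ple T x x,
      forall x y, ple T x y -> ple T y x -> x = y
    & forall x y z, ple T x y -> ple T y z -> ple T x z].

Definition plt T x y := ple T x y /\ x <> y.

Definition ext T := [set x | nodes T x /\ ~ exists y, plt T x y].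
Definition inner T := nodes T `\` ext T.
Definition succ T x :=
  [set y | plt T x y /\ ~ exists z, plt T x z /\ plt T z y].

Definition induced T (A : set (node V)) : poset V :=
  Poset (nodes T `&` A) (fun x y => [/\ ple T x y, A x & A y]).
Definition cone T x := induced T [set y | ple T x y].

Definition is_root T x := nodes T x /\ forall y, nodes T y -> ple T x y.

Definition is_tree T :=
  [/\ is_finite_poset T,
      exists x, is_root T x
    & forall x y z, ple T x z -> ple T y z -> ple T x y \/ ple T y x].

Definition is_chain T b :=
  b `<=` nodes T /\ forall x y, b x -> b y -> ple T x y \/ ple T y x.
Definition is_branch T b :=
  is_chain T b /\ forall b', is_chain T b' -> b `<=` b' -> b' = b.

Definition subtree T S :=
  [/\ nodes T `<=` nodes S,
      T = induced S (nodes T),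
      exists2 x, is_root S x & nodes T x
    & forall x, nodes T x -> inner S x ->
        succ T x !=set0 /\ succ T x `<=` succ S x].

Definition extN T : set nat := [set k | ext T (inl k)].

Definition is_creature T :=
  [/\ is_tree T,
      ext T `<=` range inl,
      inner T `&` range inl = set0
    & forall x y, nodes T x -> nodes T y -> ~ ple T x y -> ~ ple T y x ->
        nmax (extN (cone T x)) < nmin (extN (cone T y)) \/
        nmax (extN (cone T y)) < nmin (extN (cone T x))].

Definition proper_poset T := ~ exists x, nodes T = [set x].

Definition norm T : nat :=
  nmin [set k | exists2 x, inner T x & succ T x #= `I_k].

(** Zoos *)

Record is_zoo (S : nat -> poset V) : Prop := IsZoo {
  zoo_creature : forall n, is_creature (S n) /\ proper_poset (S n);
  zoo_disjoint : trivIset [set: nat] (fun n => nodes (S n));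
  zoo_increasing : forall n, nmax (extN (S n)) < nmin (extN (S n.+1));
  zoo_norm4 : forall n, 4 <= norm (S n);
  zoo_norm_cvg : forall K, exists N, forall n, N <= n -> K <= norm (S n) }.

End Posets.

Record zoo (V : Type) := Zoo {
  creature_of :> nat -> poset V;
  zooP : is_zoo creature_of }.

Section Zoos.
Variable V : Type.
Implicit Types (s t : zoo V) (F G b : set (node V)) (x y : node V).

Definition znodes s : set (node V) := \bigcup_n nodes (s n).
Definition zinner s : set (node V) := \bigcup_n inner (s n).
Definition zext s : set nat := \bigcup_n extN (s n).
Definition zle s x y := exists n, ple (s n) x y.
Definition zbranch s b := exists n, is_branch (s n) b.
Definition zroot s : set (node V) := [set x | exists n, is_root (s n) x].

(* s =^* t *)
Definition zeqs s t := exists n0 k0, forall n, s (n0 + n) = t (k0 + n).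

Record is_recipe (R : nat -> poset V) : Prop := IsRecipe {
  recipe_creature : forall k, is_creature (R k);
  recipe_increasing : forall k, nmax (extN (R k)) < nmin (extN (R k.+1));
  recipe_norm : infinite_set [set k | proper_poset (R k)] ->
    forall K, exists N, forall k, N <= k -> proper_poset (R k) -> K <= norm (R k) }.

(* t <= s via R *)
Definition zle_via t s (R : nat -> poset V) :=
  let extR := \bigcup_n extN (R n) in
  is_recipe R /\
  exists S' : nat -> poset V,
    [/\ forall k, extR k -> is_creature (S' k) /\ subtree (S' k) (s k),
        \bigcup_n inner (R n) `&` \bigcup_(k in extR) inner (S' k) = set0,
        forall n, nodes (t n) =
          inner (R n) `|` \bigcup_(k in extN (R n)) nodes (S' k),
        forall n k x, extN (R n) k -> nodes (S' k) x ->
          nodes (cone (t n) x) = nodes (cone (S' k) x)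
      & forall n x, inner (R n) x ->
          nodes (cone (t n) x) =
          inner (cone (R n) x) `|`
          \bigcup_(k in extN (cone (R n) x)) nodes (S' k)].

(* The relation t <= s with a double bar. *)
Definition zleq t s := exists2 R, zle_via t s R &
  \bigcup_n inner (R n) `&` zinner s = set0.
Definition zleqs t s := exists2 t', zeqs t' t & zleq t' s.

(** Colorings *)

(* Colorings are represented by functions defined on all nodes, all sets of
   nodes (an unordered pair being a two-element set), or all natural numbers;
   [homogeneous] only looks at the values on nodes of [s], on pairs of direct
   successors in [s] of a node, and on leaves of [s], respectively. *)
Inductive coloring (E : finType) : Type :=
  | UnaryColoring of (node V -> E)
  | BinaryColoring of (set (node V) -> E)
  | BranchColoring of (nat -> E).

Definition constant_on (T : Type) (E : Type) (c : T -> E) (A : set T) :=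
  forall x y : T, A x -> A y -> c x = c y.

Definition upairs (T : Type) (A : set T) : set (set T) :=
  [set p | exists x y : T, [/\ A x, A y, x <> y & p = [set x; y]]].

Definition homogeneous (E : finType) (c : coloring E) s t :=
  match c with
  | UnaryColoring c => forall n x, inner (t n) x -> znodes s x ->
      constant_on c (succ (t n) x)
  | BinaryColoring c => forall n x, inner (t n) x -> znodes s x ->
      constant_on c (upairs (succ (t n) x))
  | BranchColoring c => constant_on c (zext t)
  end.

Definition almost_homogeneous (E : finType) (c : coloring E) s t :=
  exists t', [/\ zeqs t' t, zleq t' s & homogeneous c s t'].

(** Fronts *)

Definition front s F :=
  F `<=` znodes s /\
  finite_set [set b | zbranch s b /\ ~ exists x, F `&` b = [set x]].

Definition front_eq F G := finite_set (F `+` G).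

Definition front_le s F G :=
  finite_set [set b | zbranch s b /\
    ~ exists x y, [/\ F `&` b = [set x], G `&` b = [set y] & zle s y x]].

(* F + 1 is below G *)
Definition front_lt s F G :=
  finite_set [set b | zbranch s b /\
    ~ exists x y,
        [/\ F `&` b = [set x], G `&` b = [set y], zle s y x & y <> x]].

Definition almost_strong (f : nat -> nat) s :=
  exists N, forall n, N <= n ->
    f (nmax (extN (s n))) <= nmin (extN (s n.+1)).

End Zoos.

(** Sufficiently generic sequences *)

(* A linear order of type omega_1. *)
Definition is_omega1 d (W : orderType d) :=
  [/\ well_founded (fun i j : W => (i < j)%O),
      ~ countable [set: W]
    & forall i : W, countable [set j : W | (j < i)%O]].

(* Every set of subsets of nat is countable or has the size of the continuum. *)
Definition CH :=
  forall X : set (set nat), countable X \/ X #= [set: set nat].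

Section Generic.
Variables (V : Type) (d : Order.disp_t) (W : orderType d).
Implicit Types (s : W -> zoo V) (F G : set (node V)).

Record sufficiently_generic s : Prop := SufficientlyGeneric {
  generic_decreasing : forall i j : W, (i < j)%O -> zleqs (s j) (s i);
  generic_homogeneous : forall (i : W) (E : finType) (c : coloring V E),
    exists2 j : W, (i < j)%O & almost_homogeneous c (s i) (s j);
  generic_strong : forall f : nat -> nat,
    exists i : W, almost_strong f (s i);
  generic_root : forall i : W, exists2 j : W, (i <= j)%O &
    front_lt (s j) (zroot (s i) `&` znodes (s j)) (zroot (s j)) }.

Definition seq_front s F := exists i, front (s i) F.

Definition seq_front_eq s F G := exists i1 i2 i : W,
  [/\ front (s i1) F /\ front (s i2) G, (i1 <= i)%O, (i2 <= i)%O
    & front_eq (F `&` znodes (s i)) (G `&` znodes (s i))].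

Definition seq_front_le s F G := exists i1 i2 i : W,
  [/\ front (s i1) F /\ front (s i2) G, (i1 <= i)%O, (i2 <= i)%O
    & front_le (s i) (F `&` znodes (s i)) (G `&` znodes (s i))].

(* As usual for filters on nat, all cofinite sets are required to belong to the
   filter.  This is not automatic: genericity only constrains the zoos up to
   finitely many creatures, so all the sets [zext (s i)] may share a leaf. *)
Definition generated_filter s : set_system nat :=
  smallest (@Filter nat) ([set A | exists i, A = zext (s i)] `|` \oo).

End Generic.

(** Quotients and isomorphisms of (pre)ordered sets *)

Definition quotient (T : Type) (A : set T) (eqv : T -> T -> Prop) :
    set (set T) :=
  [set C | exists2 x, A x & C = [set y | A y /\ eqv x y]].

Definition quotient_le (T : Type) (r : T -> T -> Prop) (C C' : set T) :=
  exists x y, [/\ C x, C' y & r x y].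

Definition order_isomorphic (T U : Type) (A : set T) (r : T -> T -> Prop)
    (B : set U) (q : U -> U -> Prop) :=
  exists2 f : T -> U, set_bij A B f &
    forall x y, A x -> A y -> (r x y <-> q (f x) (f y)).

Definition ole d (D : orderType d) (x y : D) : Prop := (x <= y)%O.

(** Growth functions *)

Definition growth : set (nat -> nat) :=
  [set f | {homo f : m n / m <= n} /\ forall n, n < f n].

Definition next_in (A : set nat) (n : nat) : nat := nmin [set a | A a /\ n < a].

Definition growth_leA (A : set nat) (f g : nat -> nat) :=
  exists k, forall n, f n <= iter k (fun m => maxn (g m) (next_in A m)) n.

Definition growth_le (U : set_system nat) (f g : nat -> nat) :=
  exists2 A, U A & growth_leA A f g.

Definition growth_eq (U : set_system nat) (f g : nat -> nat) :=
  growth_le U f g /\ growth_le U g f.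

(** Clones on nat *)

(* [Op f] with [f : ('I_k.+1 -> nat) -> nat] is an operation of arity k + 1:
   operations have positive arity. *)
Definition operation := {k : nat & ('I_k.+1 -> nat) -> nat}.
Definition Op (k : nat) (f : ('I_k.+1 -> nat) -> nat) : operation :=
  existT _ k f.

Definition is_clone (C : set operation) :=
  (forall (k : nat) (i : 'I_k.+1), C (Op (fun x : 'I_k.+1 -> nat => x i))) /\
  (forall (m k : nat) (f : ('I_m.+1 -> nat) -> nat)
     (g : 'I_m.+1 -> ('I_k.+1 -> nat) -> nat),
     C (Op f) -> (forall i, C (Op (g i))) ->
     C (Op (fun x : 'I_k.+1 -> nat => f (fun i => g i x)))).

Definition C_id : set operation :=
  [set F | exists (k : nat) (f : ('I_k.+1 -> nat) -> nat),
             F = Op f /\ forall x, f x <= \max_i x i].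

Definition filter_clone (U : set_system nat) : set operation :=
  smallest is_clone
    (C_id `|` [set F | exists2 A, U A &
                 F = Op (fun x : 'I_1 -> nat => next_in A (x ord0))]).

Definition clones_above (C : set operation) : set (set operation) :=
  [set C' | is_clone C' /\ C `<=` C'].

(** The orders D_1 and D_2 *)

(* [W] is of type omega_1.  The last clause makes D_1 unique up to isomorphism,
   as intended: the other ones hold both for orders in which some increasing
   sequence of type omega has a supremum and for orders in which none does. *)
Record is_D1 d (W : orderType d) d1 (D1 : orderType d1) : Prop := IsD1 {
  D1_min : exists m : D1, forall x : D1, (m <= x)%O;
  D1_nomax : forall x : D1, exists y : D1, (x < y)%O;
  D1_card : [set: D1] #= [set: W];
  D1_dense : forall x y : D1, (x < y)%O ->
    ~ countable [set z : D1 | (x < z)%O && (z < y)%O];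
  D1_bounded : forall C : set D1, countable C ->
    exists c : D1, forall x, C x -> (x <= c)%O;
  D1_fill : forall C C' : set D1, countable C -> countable C' ->
    (forall x y, C x -> C' y -> (x <= y)%O) ->
    exists c : D1, (forall x, C x -> (x <= c)%O) /\
                   (forall y, C' y -> (c <= y)%O);
  D1_fill_strict : forall C C' : set D1, countable C -> countable C' ->
    C !=set0 -> (forall x y, C x -> C' y -> (x < y)%O) ->
    exists c : D1, (forall x, C x -> (x < c)%O) /\
                   (forall y, C' y -> (c < y)%O) }.

Definition finitely_close d (D : orderType d) (x y : D) :=
  finite_set [set z : D | (x <= z <= y)%O || (y <= z <= x)%O].

Definition direct_succ d (D : orderType d) (x y : D) :=
  (x < y)%O /\ ~ exists z : D, (x < z < y)%O.

Record is_D2 d1 (D1 : orderType d1) d2 (D2 : orderType d2) : Prop := IsD2 {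
  D2_min : exists m : D2, forall x : D2, (m <= x)%O;
  D2_nomax : forall x : D2, exists y : D2, (x < y)%O;
  D2_succ : forall x : D2, exists y : D2, direct_succ x y;
  D2_pred : forall x : D2, ~ (forall y : D2, (x <= y)%O) ->
    exists y : D2, direct_succ y x;
  D2_quotient : order_isomorphic
    (quotient [set: D2] (@finitely_close _ D2)) (quotient_le (@ole _ D2))
    [set: D1] (@ole _ D1) }.

Definition dedekind d (D : orderType d) : set (set D) :=
  [set X | X !=set0 /\ forall x y : D, X y -> (x <= y)%O -> X x].
Arguments dedekind {d} D _.

(* Main.v *)
From HB Require Import structures.
Require Import Defs.
From mathcomp Require Import all_boot all_order.
From mathcomp Require Import boolp classical_sets functions cardinality filter.
From mathcomp Require Import zify.

(* For a leaf k of a zoo s and a front F, record the height above k of the node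
   of F on the branch of k. Passing to a smaller zoo only adds nodes below the
   old roots, so heights do not change, and F is determined modulo U by its
   height function: the order of fronts embeds into the ultrapower of N by U, in
   which direct successors, direct predecessors and finite distance are visible
   arithmetically. The functions which occur are closed under h + 1 (by unary
   homogeneity), h - 1, and insertion between two infinitely distant countable
   families (by diagonalising along the creatures of one zoo), which gives the
   properties of D_2 and of its quotient D_1; D_1 is unique by a back-and-forth
   argument of length omega_1.

   A growth function f belongs to a front F if, for leaves a < b, b <= f a when a
   and b lie above the same node of F, and f a <= b otherwise. Binary homogeneity
   and f-strongness yield a front for every f, every front has such an f, and the
   two orders correspond. A clone above C_id and all h_A is determined by its
   growth functions, which form an initial segment for <=_U. *)

Set Implicit Arguments.
Unset Strict Implicit.
Unset Printing Implicit Defensive.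

Import Order.TTheory.
Local Open Scope classical_set_scope.
Local Open Scope card_scope.

(** * Linear orders *)

Section PreorderQuotient.
Variables (T : Type) (A : set T) (r : T -> T -> Prop).
Hypothesis rxx : forall x, A x -> r x x.
Hypothesis r_trans : forall x y z, A x -> A y -> A z -> r x y -> r y z -> r x z.
Hypothesis r_total : forall x y, A x -> A y -> r x y \/ r y x.

(** Zoos are replaced by forests indexed by their leaves. Leaves are natural numbers and keep their
    names when a zoo is refined or its creatures are renumbered, so a condition on almost all
    branches becomes a condition on all leaves beyond a bound; holding in one zoo of the sequence is
    then the same as membership in [U]. Any two fronts are comparable because [U] is an ultrafilter.
    CH serves to compute cardinalities: the quotient by finite distance and [W] are uncountable and
    embed into the subsets of nat. Since [D1] and [D2] are given abstractly, one concrete pair is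
    built and transported along uniqueness. The iterates in [growth_leA] are where branching
    matters: a fixed number of steps passes only as many siblings, while the number of siblings
    tends to infinity. So one level of difference between two fronts already separates their growth
    functions, which is why growth functions yield [D2] and not its quotient [D1]. *)

Lemma preorder_quotient (x0 : T) : A x0 ->
  exists (d : Order.disp_t) (D : orderType d) (phi : T -> D),
    (forall x y, A x -> A y -> (r x y <-> (phi x <= phi y)%O)) /\
    (forall z : D, exists2 x, A x & phi x = z).
Proof.
move=> Ax0.
pose cl x := [set y | A y /\ (r x y /\ r y x)].
pose Q := {C : set T | exists2 x, A x & C = cl x}.
have Qin (C : Q) : exists x, A x /\ sval C = cl x by case: C => C [x Ax eC] /=; exists x.
have svalI (C D : Q) : sval C = sval D -> C = D.
  case: C D => [C pC] [D pD] /= e; rewrite -e in pD *.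
  by rewrite (Prop_irrelevance pC pD).
pose rp (C : Q) := projT1 (cid (Qin C)).
have rpA (C : Q) : A (rp C) by rewrite /rp; case: cid => x [].
have rpC (C : Q) : sval C = cl (rp C) by rewrite /rp; case: cid => x [].
pose le (C D : Q) := `[< r (rp C) (rp D) >].
have le_refl : reflexive le by move=> C; apply/asboolP; exact: rxx.
have le_tr : transitive le.
  by move=> C D E /asboolP h1 /asboolP h2; apply/asboolP; exact: r_trans h1 h2.
have le_anti : antisymmetric le.
  move=> C D /andP[/asboolP h1 /asboolP h2].
  have e : sval C = sval D.
    rewrite !rpC; apply/seteqP; split=> y [Ay [a b]]; split=> //; split.
    - exact: r_trans h2 a.
    - exact: r_trans b h1.
    - exact: r_trans h1 a.
    - exact: r_trans b h2.
  by apply: svalI.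
have le_tot : total le.
  by move=> C D; case: (r_total (rpA C) (rpA D)) => h; apply/orP; [left|right];
     apply/asboolP.
pose disp := Order.Disp tt tt.
pose cQ : choiceType := HB.pack Q (gen_eqMixin Q) (gen_choiceMixin Q).
pose pQ : porderType disp :=
  HB.pack (Choice.sort cQ) (Order.Le_isPOrder.Build disp (Choice.sort cQ) le_refl le_anti le_tr).
pose oQ : orderType disp := HB.pack (Order.POrder.sort pQ) (Order.POrder_isTotal.Build disp (Order.POrder.sort pQ) le_tot).
have clP x : A x -> exists2 y, A y & cl x = cl y by move=> Ax; exists x.
pose phi (x : T) : Q :=
  if pselect (A x) is left Ax then exist _ (cl x) (clP x Ax) else exist _ (cl x0) (clP x0 Ax0).
have phiE x : A x -> r x (rp (phi x)) /\ r (rp (phi x)) x.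
  move=> Ax.
  have : sval (phi x) x by rewrite /phi; case: pselect => //= _; split=> //; split; exact: rxx.
  by rewrite rpC => -[_ []].
exists disp, oQ, phi; split.
  move=> x y Ax Ay; have [h1 h2] := phiE x Ax; have [h3 h4] := phiE y Ay.
  have -> : ((phi x : oQ) <= (phi y : oQ))%O = le (phi x) (phi y) by [].
  split=> [h|/asboolP h].
    by apply/asboolP; apply: r_trans (r_trans _ _ _ h2 h) h3.
  by apply: r_trans (r_trans _ _ _ h1 h) h4.
move=> C; exists (rp C) => //.
have : sval (phi (rp C)) = sval C.
  by rewrite /phi; case: pselect => //= _; rewrite [RHS]rpC.
by move=> e; apply: svalI.
Qed.

End PreorderQuotient.

(** [quotient_le r] asks for some related pair of representatives, so in the second hypothesis the
    pair may be changed inside its classes. This slack is used for [D2] modulo finite distance,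
    where [phi x = phi y] does not give [x <= y]. *)
Lemma order_isomorphic_quotient (T : Type) (A : set T) (r eqv : T -> T -> Prop)
    d (D : orderType d) (phi : T -> D) (x0 : T) :
  (forall x y, A x -> A y -> r x y -> (phi x <= phi y)%O) ->
  (forall x y, A x -> A y -> (phi x <= phi y)%O ->
     exists x' y', [/\ A x', A y', phi x' = phi x, phi y' = phi y & r x' y']) ->
  (forall x y, A x -> A y -> (eqv x y <-> phi x = phi y)) ->
  (forall z, exists2 x, A x & phi x = z) ->
  order_isomorphic (quotient A eqv) (quotient_le r) [set: D] (@ole _ D).
Proof.
move=> rP rP' eP surj.
pose f (C : set T) :=
  if pselect (exists x, C x) is left h then phi (sval (cid h)) else phi x0.
have fE x : A x -> f [set y | A y /\ eqv x y] = phi x.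
  move=> Ax; rewrite /f; case: pselect => [h|[]].
    by case: cid => y /= [Ay /eP->].
  by exists x; split=> //; apply/eP.
exists f; first split=> //.
- move=> C D' /set_mem[x Ax ->] /set_mem[y Ay ->].
  rewrite !fE // => e; apply/seteqP.
  split=> z [Az] /eP h; split=> //; apply/eP => //.
    by rewrite -e h.
  by rewrite e h.
- move=> z _; have [x Ax <-] := surj z.
  by exists [set y | A y /\ eqv x y]; [exists x|exact: fE].
- move=> C C' [x Ax ->] [y Ay ->]; rewrite !fE //; split.
    move=> [x' [y' [[Ax' /eP ex] [Ay' /eP ey] /rP]]].
    by rewrite -ex // -ey // => /(_ Ax' Ay').
  move=> /(rP' _ _ Ax Ay)[x' [y' [Ax' Ay' ex ey rxy]]]; exists x', y'.
  by split=> //; split=> //; apply/eP; rewrite ?ex ?ey.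
Qed.

Definition order_iso d (D : orderType d) d' (D' : orderType d') (psi : D -> D') :=
  (forall x y, (psi x <= psi y)%O = (x <= y)%O) /\ (forall y, exists x, psi x = y).

(** The constructions below produce relations; antisymmetry turns one that is total on both sides
    and matches the orders into a bijection. *)
Lemma order_iso_of_rel d (D : orderType d) d' (D' : orderType d')
    (R : D -> D' -> Prop) :
  (forall x, exists y, R x y) -> (forall y, exists x, R x y) ->
  (forall x y x' y', R x y -> R x' y' -> (x <= x')%O = (y <= y')%O) ->
  exists psi : D -> D', order_iso psi /\ forall x, R x (psi x).
Proof.
move=> /choice[psi psiR] surjR monoR; exists psi; split=> //; split.
  by move=> x y; rewrite (monoR _ _ _ _ (psiR x) (psiR y)).
move=> y; have [x xy] := surjR y; exists x; apply/eqP; rewrite eq_le.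
by rewrite -(monoR _ _ _ _ (psiR x) xy) -(monoR _ _ _ _ xy (psiR x)) lexx.
Qed.

(** The step sees only the set of earlier values, not their indices, so the unfolding of [Fix] is
    justified by extensionality of sets. *)
Lemma wf_recursion (W T : Type) (R : W -> W -> Prop) (G : W -> set T -> T) :
  well_founded R -> exists F : W -> T, forall i, F i = G i (F @` [set j | R j i]).
Proof.
move=> wfR.
pose H i (rec : forall j, R j i -> T) := G i [set y | exists j (h : R j i), y = rec j h].
exists (Fix wfR (fun=> T) H) => i; rewrite Fix_eq.
  rewrite /H; congr (G i _); apply/seteqP; split=> [y [j [h ->]]|y [j h <-]].
    by exists j.
  by exists j, h.
move=> j f g fg; rewrite /H; congr (G j _); apply/seteqP.
by split=> y [k [h ->]]; exists k, h.
Qed.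

Lemma card_setT_bij T U : [set: T] #= [set: U] -> exists f : T -> U, bijective f.
Proof.
move=> /card_bijP[f [g fK gK]].
exists (fun x => set_val (f (to_setT x))); exists (fun x => set_val (g (to_setT x))) => x.
  by rewrite (_ : to_setT (set_val _) = f (to_setT x)) ?fK //; apply: val_inj.
by rewrite (_ : to_setT (set_val _) = g (to_setT x)) ?gK //; apply: val_inj.
Qed.

Lemma countable_image T U (f : T -> U) A : countable A -> countable (f @` A).
Proof. by apply: card_le_trans; exact: card_image_le. Qed.

Lemma countable_setU T (A B : set T) : countable A -> countable B -> countable (A `|` B).
Proof.
move=> cA cB; have := @bigcup_countable bool T setT (fun b => if b then A else B).
rewrite (_ : \bigcup_(_ in _) _ = A `|` B); first by apply=> // -[].
apply/seteqP; split=> [x [[] _]|x []]; [by left|by right|by exists true|by exists false].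
Qed.

Lemma countable_enum T (A : set T) (x0 : T) : A x0 -> countable A ->
  exists u : nat -> T, (forall n, A (u n)) /\ forall x, A x -> exists n, u n = x.
Proof.
move=> Ax0 /countable_injP[f finj].
have /choice[u uP] n : exists y, A y /\ forall x, A x -> f x = n -> y = x.
  case: (pselect (exists2 x, A x & f x = n)) => [[y Ay yn]|no].
    by exists y; split=> // x Ax xn; apply: finj; rewrite ?inE // yn.
  by exists x0; split=> // x Ax xn; case: no; exists x.
exists u; split=> [n|x Ax]; first by have [] := uP n.
by exists (f x); apply: (uP (f x)).2.
Qed.

(** * Uniqueness of D_1 by back and forth *)

Section D1Unique.
Variables (d : Order.disp_t) (W : orderType d).
Hypothesis W1 : is_omega1 W.

Section Extension.
Variables (d1 : Order.disp_t) (D : orderType d1) (d2 : Order.disp_t) (D' : orderType d2).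
Hypothesis DP' : is_D1 W D'.
Variables (m : D) (m' : D').
Hypothesis mP : forall x, (m <= x)%O.

Definition partial_iso (P : set (D * D')) :=
  P (m, m') /\ forall p q, P p -> P q -> (p.1 <= q.1)%O = (p.2 <= q.2)%O.

(** The elements of [P] on either side of [a] give two countable sets in [D'], and [D1_fill_strict]
    puts [b] strictly between them. The pair of minima keeps the lower set nonempty, as that clause
    demands. *)
Lemma partial_iso_extend P (a : D) : countable P -> partial_iso P ->
  exists b, partial_iso (P `|` [set (a, b)]).
Proof.
move=> cP [Pm Piso].
have [[p Pp pa]|nP] := pselect (exists2 p, P p & p.1 = a).
  exists p.2; rewrite (_ : P `|` _ = P) //.
  by apply/seteqP; split=> [q [//|->]|q]; [rewrite -pa; case: p {pa} Pp|left].
have Piso' p q : P p -> P q -> (p.1 < q.1)%O = (p.2 < q.2)%O.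
  by move=> Pp Pq; rewrite !ltNge (Piso _ _ Pq Pp).
have ma : (m < a)%O.
  by rewrite lt_neqAle mP andbT; apply/eqP => e; apply: nP; exists (m, m').
have [b [bl bu]] : exists b : D',
    (forall x, (snd @` (P `&` [set p | (p.1 < a)%O])) x -> (x < b)%O) /\
    (forall x, (snd @` (P `&` [set p | (a < p.1)%O])) x -> (b < x)%O).
  apply: (D1_fill_strict DP').
  - by apply: countable_image; apply: sub_countable cP; apply: subset_card_le => p [].
  - by apply: countable_image; apply: sub_countable cP; apply: subset_card_le => p [].
  - by exists m', (m, m').
  - move=> _ _ [p [Pp pa] <-] [q [Pq qa] <-]; rewrite -Piso' //.
    exact: lt_trans qa.
have bP q : P q -> ((q.1 <= a)%O = (q.2 <= b)%O) * ((a <= q.1)%O = (b <= q.2)%O).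
  move=> Pq; case: (ltgtP q.1 a) => [qa|qa|qa].
  - have h : (q.2 < b)%O by apply: bl; exists q.
    by rewrite (ltW h) leNgt h.
  - have h : (b < q.2)%O by apply: bu; exists q.
    by rewrite (ltW h) leNgt h.
  - by case: nP; exists q.
exists b; split; first by left.
move=> p q [Pp|->] [Pq|->] /=; first exact: Piso.
- by rewrite (bP _ Pp).
- by rewrite (bP _ Pq).
- by rewrite !lexx.
Qed.

End Extension.

Variables (d1 : Order.disp_t) (D : orderType d1) (d2 : Order.disp_t) (D' : orderType d2).
Hypotheses (DP : is_D1 W D) (DP' : is_D1 W D').

Lemma partial_iso_swap d3 (E : orderType d3) d4 (E' : orderType d4) (m : E) (m' : E') P :
  partial_iso m m' P -> partial_iso m' m [set p | P (p.2, p.1)].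
Proof. by move=> [Pm Piso]; split=> // p q Pp Pq; have /= -> := Piso _ _ Pp Pq. Qed.

Lemma D1_unique : exists psi : D -> D', order_iso psi.
Proof.
have [m mP] := D1_min DP; have [m' mP'] := D1_min DP'.
have [a' [a a'K aK]] := card_setT_bij (D1_card DP).
have [b' [b b'K bK]] := card_setT_bij (D1_card DP').
have [wfW _ cW] := W1.
pose T := ((D * D') * (D * D'))%type.
(* One step at stage [i]: [r.1] adds [a i] to the domain and [r.2] adds [b i] to the range. The
   value for a bad [P] is arbitrary. *)
have /choice[G GP] : forall iP : W * set (D * D'), exists r : T,
    countable iP.2 -> partial_iso m m' iP.2 ->
    [/\ r.1.1 = a iP.1, r.2.2 = b iP.1
       & partial_iso m m' (iP.2 `|` [set r.1] `|` [set r.2])].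
  move=> [i P] /=.
  case: (pselect (countable P /\ partial_iso m m' P)) => [[cP Piso]|no]; last first.
    by exists ((m, m'), (m, m')) => c1 c2; case: no.
  have [y Py] := partial_iso_extend DP' mP (a i) cP Piso.
  pose P1 := P `|` [set (a i, y)].
  have cP1 : countable [set p | P1 (p.2, p.1)].
    rewrite (_ : [set _ | _] = (fun p => (p.2, p.1)) @` P1).
      by apply: countable_image; apply: countable_setU => //; exact: countable1.
    apply/seteqP; split=> [[u v] /= uv|_ [[u v] uv <-] //].
    by exists (v, u).
  have [x Px] := partial_iso_extend DP mP' (b i) cP1 (partial_iso_swap Py).
  exists ((a i, y), (x, b i)) => _ _; split=> //=.
  have := partial_iso_swap Px; rewrite (_ : [set p | _] = P1 `|` [set (x, b i)]) //.
  apply/seteqP; split=> [[u v] [/= h|/= [-> ->]]|[u v] [h|[-> ->]]].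
  - by left.
  - by right.
  - by left.
  - by right.
(* The partial isomorphism of a stage is recovered from the set of earlier values, the pair of
   minima being present from the start. *)
pose base (X : set T) : set (D * D') := [set (m, m')] `|` ((fst @` X) `|` (snd @` X)).
have [F FE] := wf_recursion (fun i (X : set T) => G (i, base X)) wfW.
pose P i := base (F @` [set j : W | (j < i)%O]).
have FG i : F i = G (i, P i) by rewrite FE.
have cP i : countable (P i).
  have c : countable (F @` [set j : W | (j < i)%O]) by exact/countable_image/cW.
  by do 2?[apply: countable_setU]; do ?exact: countable_image; exact: countable1.
pose P' i := P i `|` [set (F i).1] `|` [set (F i).2].
have Plt i p : P i p -> p = (m, m') \/ exists2 j, (j < i)%O & P' j p.
  move=> [->|[[_ [j ji <-] <-]|[_ [j ji <-] <-]]]; first by left.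
    by right; exists j => //; left; right.
  by right; exists j => //; right.
have P'P i j p : (i < j)%O -> P' i p -> P j p.
  move=> ij [[[->|[[_ [k ki <-] <-]|[_ [k ki <-] <-]]]|->]|->]; first by left.
  - by right; left; exists (F k) => //; exists k => //=; exact: lt_trans ij.
  - by right; right; exists (F k) => //; exists k => //=; exact: lt_trans ij.
  - by right; left; exists (F i) => //; exists i.
  - by right; right; exists (F i) => //; exists i.
have isoP' i : partial_iso m m' (P i) -> partial_iso m m' (P' i).
  by move=> Pi; have [] := GP (i, P i) (cP i) Pi; rewrite -FG.
have isoP i : partial_iso m m' (P i).
  elim: (wfW i) => {}i _ IH; split; first by left.
  (* Two pairs of [P i] already lie together in [P' j] for the larger [j] of their stages, so
     successor and limit stages are treated alike. *)
  have main p q : P i p -> P i q -> exists R, [/\ partial_iso m m' R, R p & R q].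
    move=> /Plt[->|[j ji jp]] /Plt[->|[k ki kq]].
    - exists [set (m, m')]; split=> //; split=> // _ _ -> -> /=.
      by rewrite !lexx.
    - by exists (P' k); split=> //; [exact/isoP'/IH|left; left; left].
    - by exists (P' j); split=> //; [exact/isoP'/IH|left; left; left].
    - case: (ltgtP j k) => [jk|kj|jk].
      + by exists (P' k); split=> //; [exact/isoP'/IH|left; left; exact: P'P jp].
      + by exists (P' j); split=> //; [exact/isoP'/IH|left; left; exact: P'P kq].
      + by exists (P' k); split=> //; [exact/isoP'/IH|rewrite -jk].
  by move=> p q ip iq; have [R [[_ Riso] Rp Rq]] := main _ _ ip iq; exact: Riso.
pose R x y := exists i, P' i (x, y).
have Fa i : (F i).1.1 = a i by have [] := GP (i, P i) (cP i) (isoP i); rewrite -FG.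
have Fb i : (F i).2.2 = b i by have [] := GP (i, P i) (cP i) (isoP i); rewrite -FG.
have [psi [psiP _]] : exists psi : D -> D', order_iso psi /\ forall x, R x (psi x).
  apply: order_iso_of_rel.
  - move=> x; exists (F (a' x)).1.2, (a' x); left; right.
    by rewrite -[X in (X, _)](a'K x) -Fa /=; case: (F _).1.
  - move=> y; exists (F (b' y)).2.1, (b' y); right.
    by rewrite -[X in (_, X)](b'K y) -Fb /=; case: (F _).2.
  - move=> x y x' y' [i ixy] [j jxy].
    case: (ltgtP i j) => ij.
    + by have [_ /(_ (x, y) (x', y'))->] := isoP' j (isoP j) => //; left; left; exact: P'P ixy.
    + by have [_ /(_ (x, y) (x', y'))->] := isoP' i (isoP i) => //; left; left; exact: P'P jxy.
    + by have [_ /(_ (x, y) (x', y'))->] := isoP' i (isoP i) => //; rewrite ij.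
by exists psi.
Qed.

End D1Unique.

Lemma finite_no_injection T (A : set T) (f : nat -> T) :
  finite_set A -> (forall n, A (f n)) -> ~ injective f.
Proof.
move=> fA Af finj; apply: infinite_nat.
have e : f @` setT #= [set: nat] by apply: inj_card_eq => x y _ _; exact: finj.
rewrite -(eq_finite_set e); apply: sub_finite_set fA => _ [n _ <-]; exact: Af.
Qed.

(** * Structure and uniqueness of D_2 *)

Section D2Structure.
Variables (d1 : Order.disp_t) (D1 : orderType d1) (d2 : Order.disp_t) (D2 : orderType d2).
Hypothesis DP : is_D2 D1 D2.
Implicit Types x y z : D2.

Lemma finitely_close_refl x : finitely_close x x.
Proof.
apply: sub_finite_set (finite_set1 x) => z /=.
by rewrite orbb -eq_le => /eqP.
Qed.

Lemma finitely_close_sym x y : finitely_close x y -> finitely_close y x.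
Proof. by apply: sub_finite_set => z /=; rewrite orbC. Qed.

Lemma finitely_close_trans x y z :
  finitely_close x y -> finitely_close y z -> finitely_close x z.
Proof.
move=> fxy fyz; have : finite_set
    ([set u | (x <= u <= y)%O || (y <= u <= x)%O] `|`
     [set u | (y <= u <= z)%O || (z <= u <= y)%O]) by rewrite finite_setU; split.
apply: sub_finite_set => u /= /orP[] /andP[xu uz]; case: (leP u y) => uy;
  rewrite ?(ltW uy) ?xu ?uz ?orbT /=; by [left|right].
Qed.

Lemma D2_projection : exists pi : D2 -> D1,
  [/\ forall x y, (x <= y)%O -> (pi x <= pi y)%O, forall c, exists x, pi x = c
    & forall x y, pi x = pi y <-> finitely_close x y].
Proof.
have [f [_ finj fsurj] fmono] := D2_quotient DP.
pose cl x := [set y | [set: D2] y /\ finitely_close x y].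
have qcl x : quotient [set: D2] (@finitely_close _ D2) (cl x) by exists x.
exists (fun x => f (cl x)); split.
- move=> x y xy; apply/(fmono _ _ (qcl x) (qcl y)); exists x, y.
  by split=> //; split=> //; exact: finitely_close_refl.
- by move=> c; have [_ [x _ ->] <-] := fsurj c I; exists x.
- move=> x y; split=> [|xy].
    move=> /finj; rewrite !inE => /(_ (qcl x) (qcl y)) e.
    suff : cl x y by case.
    by rewrite e; split=> //; exact: finitely_close_refl.
  congr f; apply/seteqP; split=> z [_ h]; split=> //.
    exact: finitely_close_trans (finitely_close_sym xy) h.
  exact: finitely_close_trans h.
Qed.

Lemma D2_successor : exists S : D2 -> D2,
  [/\ forall x y, (x < y)%O = (S x <= y)%O,
      forall x y, (S x <= S y)%O = (x <= y)%O,
      forall x y, finitely_close x y -> (x <= y)%O -> exists n, y = iter n S x,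
      forall x n, finitely_close x (iter n S x)
    & forall x, ~ (forall y, (x <= y)%O) -> exists y, S y = x].
Proof.
have /choice[S SP] := D2_succ DP.
have S1 x y : (x < y)%O = (S x <= y)%O.
  have [xS nS] := SP x; apply/idP/idP => [xy|]; last exact: lt_le_trans.
  by rewrite leNgt; apply/negP => h; apply: nS; exists y; rewrite xy h.
have SS x y : (S x <= S y)%O = (x <= y)%O.
  by rewrite -S1 [RHS]leNgt [X in ~~ X]S1 -ltNge.
have Sn n x : (x <= iter n S x)%O.
  elim: n x => //= n IH x; apply: le_trans (IH x) _; apply: ltW.
  by have [] := SP (iter n S x).
have Sn1 x n k : (iter n S x < iter (n + k.+1) S x)%O.
  by rewrite addnC addSn /= S1 iterD SS Sn.
exists S; split=> //.
(* If [y] is never reached, every iterate stays below [y], and the finite interval from [x] to [y]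
   would contain infinitely many of them. *)
- move=> x y fxy xy; apply: contrapT => no.
  have lt n : (iter n S x < y)%O.
    elim: n => [|n IH] /=; rewrite lt_neqAle.
      by rewrite xy andbT; apply/eqP => e; apply: no; exists 0.
    by rewrite -S1 IH andbT; apply/eqP => e; apply: no; exists n.+1.
  apply: (finite_no_injection fxy (f := fun n => iter n S x)).
    by move=> n /=; rewrite Sn ltW.
  have inj n m : n < m -> iter n S x <> iter m S x.
    by move=> nm e; have := Sn1 x n (m - n.+1); rewrite addnS -addSn subnKC // e ltxx.
  by move=> n m e; case: (ltngtP n m) => // /inj; [move/(_ e)|move/(_ (esym e))].
- move=> x; elim=> [|n IH] /=; first exact: finitely_close_refl.
  apply: finitely_close_trans IH _; set y := iter n S x.
  apply: sub_finite_set (finite_set2 y (S y)) => z /= /orP[] /andP[h1 h2].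
    move: h1; rewrite le_eqVlt => /orP[/eqP|]; first by left.
    by rewrite S1 => h1; right; apply/eqP; rewrite eq_le h2.
  have [ySy _] := SP y; have := lt_le_trans ySy (le_trans h1 h2).
  by rewrite ltxx.
- move=> x /(D2_pred DP)[y [yx ny]]; exists y; apply/eqP; rewrite eq_le -S1 yx /=.
  have [ySy _] := SP y.
  by rewrite leNgt; apply/negP => h; apply: ny; exists (S y); rewrite ySy h.
Qed.

End D2Structure.

(* [(true, n)] stands for the integer [n] and [(false, n)] for [- n], so that 0
   has two codes. *)
Definition offset_le (u v : bool * nat) : bool :=
  match u, v with
  | (true, n), (true, m) => n <= m
  | (false, n), (false, m) => m <= n
  | (true, n), (false, m) => (n == 0) && (m == 0)
  | (false, _), (true, _) => true
  end.

(** Each class of finite distance gets an origin, and [off x u] says that [x] has the code [u]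
    relative to the origin of its class. Strictly negative offsets occur exactly outside the least
    class, whose origin is the minimum of [D2]. *)
Lemma D2_coordinates d1 (D1 : orderType d1) d2 (D2 : orderType d2) : is_D2 D1 D2 ->
  exists (pi : D2 -> D1) (off : D2 -> bool * nat -> Prop),
  [/\ forall x y, (x <= y)%O -> (pi x <= pi y)%O,
      forall x, exists u, off x u,
      forall c n, exists2 x, pi x = c & off x (true, n),
      forall c n, (exists c', (c' < c)%O) \/ n = 0 -> exists2 x, pi x = c & off x (false, n)
    & (forall x y u v, off x u -> off y v -> pi x = pi y -> (x <= y)%O = offset_le u v) /\
      (forall x n, off x (false, n) -> n = 0 \/ exists c', (c' < pi x)%O)].
Proof.
move=> DP; have [pi [pi_mono pi_surj piE]] := D2_projection DP.
have [S [S1 SS Sreach Sclose Spred]] := D2_successor DP.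
have [m mP] := D2_min DP.
have /choice[rho rhoP] c : exists x, pi x = c /\ (c = pi m -> x = m).
  have [->|cm] := pselect (c = pi m); first by exists m.
  by have [x xc] := pi_surj c; exists x; split=> // /cm.
have piS x n : pi (iter n S x) = pi x by apply/esym/piE.
have S_inj : injective S by move=> x y e; apply/eqP; rewrite eq_le -(SS x) -(SS y) e lexx.
have Sn_le n x y : (iter n S x <= iter n S y)%O = (x <= y)%O.
  by elim: n => //= n IH; rewrite SS.
have le_Sn n x : (x <= iter n S x)%O.
  by elim: n => //= n IH; apply: le_trans IH _; apply: ltW; rewrite S1.
have Sn_gt n x : (iter n.+1 S x <= x)%O = false.
  by apply/negbTE; rewrite -ltNge S1 /= SS le_Sn.
have Sn_lex n x : (iter n S x <= x)%O = (n == 0) by case: n => [|n]; rewrite ?lexx ?Sn_gt.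
have Snm n k x : (iter n S x <= iter k S x)%O = (n <= k).
  case: (leqP n k) => [/subnK <-|nk].
    by rewrite addnC iterD Sn_le le_Sn.
  by rewrite -(subnKC (ltnW nk)) iterD Sn_le Sn_lex subn_eq0 leqNgt nk.
pose off x (u : bool * nat) :=
  if u.1 then x = iter u.2 S (rho (pi x)) else iter u.2 S x = rho (pi x).
have min_pi c : (pi m <= c)%O by have [x <-] := pi_surj c; exact/pi_mono/mP.
exists pi, off; split=> //.
- move=> x; have /piE fx : pi x = pi (rho (pi x)) by rewrite (rhoP _).1.
  case: (leP x (rho (pi x))) => [h|/ltW h].
    by have [n e] := Sreach _ _ fx h; exists (false, n).
  by have [n e] := Sreach _ _ (finitely_close_sym fx) h; exists (true, n).
- by move=> c n; exists (iter n S (rho c)); rewrite /off /= piS (rhoP c).1.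
- move=> c n [[c' c'c]|->]; last by exists (rho c); rewrite /off /= ?(rhoP c).1.
  elim: n => [|n [x xc]]; first by exists (rho c); rewrite /off /= ?(rhoP c).1.
  rewrite /off /= => e; have [y yx] : exists y, S y = x.
    apply: Spred => xmin; have := min_pi c'; rewrite leNgt => /negP; apply.
    by apply: lt_le_trans c'c _; rewrite -xc; apply: pi_mono.
  have pyx : pi y = pi x by rewrite -yx -(piS y 1).
  by exists y; rewrite ?pyx // -iterS iterSr yx.
- split.
    move=> x y [[] n] [[] k]; rewrite /off /= => ex ey e.
    + by rewrite ex ey e Snm.
    + by rewrite ex e -ey -iterD Sn_lex addn_eq0.
    + have -> : (x <= y)%O; last by [].
      by rewrite ey -e -ex; apply: le_trans (le_Sn n x) (le_Sn k _).
    + rewrite -(Sn_le n x) ex e -ey; case: (leqP k n) => [/subnK <-|nk].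
        by rewrite addnC iterD Sn_le le_Sn.
      by rewrite -(subnKC (ltnW nk)) iterD Sn_le Sn_lex subn_eq0 leqNgt nk.
  move=> x n; rewrite /off /= => e.
  have := min_pi (pi x); rewrite le_eqVlt => /orP[/eqP pe|]; last by right; exists (pi m).
  left; apply/eqP; rewrite -(Sn_lex n x) e.
  by rewrite (rhoP _).2.
Qed.

(** Elements are matched when their classes correspond under [psi] and they share a code. The two
    codes of 0 do no harm, because the relation only has to be total on both sides and to match the
    orders. *)
Lemma D2_unique d1 (D1 : orderType d1) d2 (D2 : orderType d2)
    d1' (D1' : orderType d1') d2' (D2' : orderType d2') (psi : D1 -> D1') :
  is_D2 D1 D2 -> is_D2 D1' D2' -> order_iso psi ->
  exists psi : D2 -> D2', order_iso psi.
Proof.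
move=> /D2_coordinates[pi [off [mono tot pos neg [cmp negP]]]].
move=> /D2_coordinates[pi' [off' [mono' tot' pos' neg' [cmp' negP']]]] [psi_le psi_surj].
pose R x y := psi (pi x) = pi' y /\ exists u, off x u /\ off' y u.
have psi_lt x y : (psi x < psi y)%O = (x < y)%O by rewrite !ltNge psi_le.
have psi_inj x y : psi x = psi y -> x = y.
  by move=> e; apply/eqP; rewrite eq_le -!psi_le e lexx.
have [f [isof _]] : exists f : D2 -> D2', order_iso f /\ forall x, R x (f x).
  apply: order_iso_of_rel.
  - move=> x; have [[[] n] xu] := tot x.
      have [y yc yu] := pos' (psi (pi x)) n; exists y; split=> //.
      by exists (true, n).
    have [y yc yu] : exists2 y, pi' y = psi (pi x) & off' y (false, n).
      apply: neg'; have [->|[c cx]] := negP _ _ xu; first by right.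
      by left; exists (psi c); rewrite psi_lt.
    by exists y; split=> //; exists (false, n).
  - move=> y; have [c cy] := psi_surj (pi' y); have [[[] n] yu] := tot' y.
      have [x xc xu] := pos c n; exists x; split; first by rewrite xc.
      by exists (true, n).
    have [x xc xu] : exists2 x, pi x = c & off x (false, n).
      apply: neg; have [->|[c' cx]] := negP' _ _ yu; first by right.
      by have [c0 c0E] := psi_surj c'; left; exists c0; rewrite -psi_lt cy c0E.
    by exists x; split; [rewrite xc|exists (false, n)].
  - move=> x y x' y' [xy [u [xu yu]]] [xy' [v [xv yv]]].
    case: (ltgtP (pi x) (pi x')) => [lt|lt|e].
    + have -> : (x <= x')%O by rewrite leNgt; apply: contraTN lt => /ltW/mono; rewrite leNgt.
      move: lt; rewrite -psi_lt xy xy' => lt.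
      by rewrite leNgt; apply/esym; apply: contraTN lt => /ltW/mono'; rewrite leNgt.
    + have -> : (x <= x')%O = false.
        by apply/negbTE; apply: contraTN lt => /mono; rewrite leNgt.
      move: lt; rewrite -psi_lt xy xy' => lt.
      by apply/esym/negbTE; apply: contraTN lt => /mono'; rewrite leNgt.
    + by rewrite (cmp _ _ _ _ xu xv e) (cmp' _ _ _ _ yu yv) // -xy -xy' e.
by exists f.
Qed.

(** * Orders inside an ultrapower of the natural numbers *)

Lemma CH_card T (f : T -> set nat) : CH -> injective f -> ~ countable [set: T] ->
  [set: T] #= [set: set nat].
Proof.
move=> ch finj nc.
have e : f @` setT #= [set: T] by apply: inj_card_eq => x y _ _; exact: finj.
rewrite card_eq_sym in e; have [c|] := ch (f @` setT).
  by case: nc; rewrite (eq_countable e).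
exact: card_eq_trans.
Qed.

Lemma omega1_bounded d (W : orderType d) : is_omega1 W ->
  forall u : nat -> W, exists i, forall n, (u n <= i)%O.
Proof.
move=> [_ nc cW] u; apply: contrapT => no; apply: nc.
rewrite (_ : setT = \bigcup_n [set j : W | (j < u n)%O]).
  by apply: bigcup_countable => // n _; exact: cW.
apply/seteqP; split=> // i _; apply: contrapT => h; apply: no; exists i => n.
by rewrite leNgt; apply/negP => lt; apply: h; exists n.
Qed.

Section Ultrapower.
Variables (U : set_system nat) (UU : UltraFilter U).

Definition ule (h g : nat -> nat) := U [set k | h k <= g k].
Definition far (h g : nat -> nat) := forall n, ule (fun k => h k + n) g.

Lemma ultra_total h g : ule h g \/ U [set k | g k < h k].
Proof.
have [|h1] := in_ultra_setVsetC [set k | h k <= g k] UU; first by left.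
by right; apply: filterS h1 => k /= /negP; rewrite -ltnNge.
Qed.

Lemma ule_trans h g e : ule h g -> ule g e -> ule h e.
Proof. by apply: filterS2 => k /=; exact: leq_trans. Qed.

Lemma ule_all h g : (forall k, h k <= g k) -> ule h g.
Proof. by move=> hg; apply: filterS filterT => k _; exact: hg. Qed.

Lemma ule_lt h g : ule h g -> U [set k | g k < h k] -> False.
Proof.
move=> h1 h2; apply: (@filter_not_empty _ U _).
by apply: filterS2 h1 h2 => k /= a b; have := leq_ltn_trans a b; rewrite ltnn.
Qed.

(** Comparison up to a bounded error, that is, the order of the classes of finite distance; [far] is
    its strict part. *)
Definition ule1 h g := exists n, ule h (fun k => g k + n).

Lemma farP h g : far h g <-> ~ ule1 g h.
Proof.
split=> [hg [n gh]|no n].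
  apply: ule_lt (hg n.+1) _; apply: filterS gh => k /=.
  by rewrite addnS ltnS.
have [//|gh] := ultra_total (fun k => h k + n) g.
by case: no; exists n; apply: filterS gh => k /= /ltnW.
Qed.

(** The difference takes at most [n + 1] values on a set of [U], and an ultrafilter selects one of
    them. This makes intervals of bounded length finite. *)
Lemma ule_between h g n : ule h g -> ule g (fun k => h k + n) ->
  exists2 j, j <= n & U [set k | g k = h k + j].
Proof.
elim: n => [|n IH] hg gh.
  exists 0 => //; apply: filterS2 hg gh => k /= h1 h2.
  by apply/eqP; rewrite addn0 in h2 *; rewrite eqn_leq h1 h2.
have [gn|gn] := ultra_total g (fun k => h k + n).
  by have [j jn e] := IH hg gn; exists j => //; exact: leqW.
exists n.+1 => //; apply: filterS2 gn gh => k /= h1 h2.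
by apply/eqP; rewrite eqn_leq h2 addnS.
Qed.

Variable Phi : set (nat -> nat).
Hypothesis Phi0 : Phi (fun=> 0).
Hypothesis PhiS : forall h, Phi h -> Phi (fun k => (h k).+1).
Hypothesis PhiP : forall h, Phi h -> Phi (fun k => (h k).-1).
Hypothesis Phi_fill : forall h g : nat -> nat -> nat,
  (forall n, Phi (h n)) -> (forall n, Phi (g n)) -> (forall n m, far (h n) (g m)) ->
  exists2 e, Phi e & forall n, far (h n) e /\ far e (g n).
Hypothesis Phi_unbounded : forall h : nat -> nat -> nat,
  (forall n, Phi (h n)) -> exists2 e, Phi e & forall n, far (h n) e.

Variables (d : Order.disp_t) (W : orderType d).
Hypotheses (ch : CH) (W1 : is_omega1 W).

(** Strict filling, the last clause of [is_D1], yields most of the others. In particular neither the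
    whole order nor an open interval with its lower end added can be countable, since filling
    strictly above it would give an element below itself. *)
Lemma ultrapower_D1 : exists (d1 : Order.disp_t) (D1 : orderType d1) (phi : (nat -> nat) -> D1),
  [/\ forall h g, Phi h -> Phi g -> (ule1 h g <-> (phi h <= phi g)%O),
      forall z, exists2 h, Phi h & phi h = z & is_D1 W D1].
Proof.
have [d1 [D1 [phi [phiP phi_surj]]]] : exists (d : Order.disp_t) (D : orderType d) (phi : (nat -> nat) -> D),
    (forall x y, Phi x -> Phi y -> (ule1 x y <-> (phi x <= phi y)%O)) /\
    (forall z : D, exists2 x, Phi x & phi x = z).
  apply: preorder_quotient Phi0.
  - by move=> h _; exists 0; apply: ule_all => k; rewrite addn0.
  - move=> h g e _ _ _ [n hg] [m ge]; exists (m + n); apply: ule_trans hg _.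
    by apply: filterS ge => k /= gk; rewrite addnA leq_add2r.
  - move=> h g _ _; have [hg|gh] := ultra_total h g.
      by left; exists 0; apply: filterS hg => k /=; rewrite addn0.
    by right; exists 0; apply: filterS gh => k /=; rewrite addn0 => /ltnW.
have phi_lt h g : Phi h -> Phi g -> (phi h < phi g)%O <-> far h g.
  move=> Ph Pg; rewrite farP ltNge; split.
    by move=> /negP lt ?; apply: lt; exact/phiP.
  by move=> no; apply/negP => /phiP h1; apply/no/h1.
have /choice[lift liftP] z : exists h, Phi h /\ phi h = z.
  by have [h] := phi_surj z; exists h.
have enum (C : set D1) : countable C -> C !=set0 ->
    exists u : nat -> nat -> nat, (forall n, Phi (u n) /\ C (phi (u n))) /\
      forall x, C x -> exists n, phi (u n) = x.
  move=> cC [x0 Cx0]; have [u [uC uS]] := countable_enum Cx0 cC.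
  exists (fun n => lift (u n)); split=> [n|x /uS[n <-]].
    by have [? ->] := liftP (u n).
  by exists n; have [_ ->] := liftP (u n).
have fill_strict (C C' : set D1) : countable C -> countable C' ->
    C !=set0 -> (forall x y, C x -> C' y -> (x < y)%O) ->
    exists c : D1, (forall x, C x -> (x < c)%O) /\ (forall y, C' y -> (c < y)%O).
  move=> cC cC' /(enum _ cC)[u [uC uS]] CC'.
  have [C'0|] := eqVneq C' set0; last first.
    move=> /set0P/(enum _ cC')[v [vC vS]].
    have [e Pe eP] : exists2 e, Phi e & forall n, far (u n) e /\ far e (v n).
      apply: Phi_fill => [n|n|n m]; [exact: (uC n).1|exact: (vC n).1|].
      apply/phi_lt; [exact: (uC n).1|exact: (vC m).1|].
      by apply: CC'; [exact: (uC n).2|exact: (vC m).2].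
    exists (phi e); split=> [x /uS|y /vS] [n <-]; apply/phi_lt => //; try exact: (eP n).1.
    - exact: (uC n).1.
    - exact: (vC n).1.
    - exact: (eP n).2.
  have [e Pe eP] := Phi_unbounded (fun n => (uC n).1).
  exists (phi e); split=> [x /uS[n <-]|y]; last by rewrite C'0.
  by apply/phi_lt => //; exact: (uC n).1.
have phi_min z : (phi (fun=> 0%N) <= z)%O.
  have [h Ph <-] := phi_surj z; apply/phiP => //.
  by exists 0; apply: ule_all.
have setT_nc : ~ countable [set: D1].
  move=> cD; have [|//|c [cP _]] := fill_strict [set: D1] set0 cD (countable0 _).
    by exists (phi (fun=> 0%N)).
  by have := cP c I; rewrite ltxx.
have bounded C : countable C -> exists c : D1, forall x, C x -> (x < c)%O.
  move=> cC; have [c [cP _]] : exists c : D1, (forall x, (C `|` [set phi (fun=> 0%N)]) x -> (x < c)%O) /\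
      (forall y, set0 y -> (c < y)%O).
    apply: fill_strict => //; last by exists (phi (fun=> 0%N)); right.
    by apply: countable_setU => //; exact: countable1.
  by exists c => x Cx; apply: cP; left.
exists d1, D1, phi; split=> //; split.
- by exists (phi (fun=> 0%N)).
- move=> x; have [y yP] := bounded _ (countable1 x); exists y; exact: yP.
(* A class is coded by the graph of a representative, as a set of natural numbers. [W] embeds in the
   quotient by choosing strict upper bounds recursively, so by CH both have the size of the
   continuum. *)
- pose code (x : D1) : set nat := [set n | exists k, n = pickle (k, lift x k)].
  have code_inj : injective code.
    move=> x y e; have [_ <-] := liftP x; have [_ <-] := liftP y; congr phi.
    apply: funext => k; have : code x (pickle (k, lift x k)) by exists k.
    rewrite e => -[k' /(pcan_inj pickleK)[<- ->]] //.
  have DR := CH_card ch code_inj setT_nc.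
  have [wfW Wnc cW] := W1.
  have /choice[sup supP] (C : set D1) : exists c : D1, countable C -> forall x, C x -> (x < c)%O.
    have [cC|nC] := pselect (countable C); last by exists (phi (fun=> 0%N)).
    by have [c cP] := bounded C cC; exists c.
  have [F FE] := wf_recursion (fun (_ : W) => sup) wfW.
  have F_lt i j : (i < j)%O -> (F i < F j)%O.
    by move=> ij; rewrite (FE j); apply: supP; [exact/countable_image/cW|exists i].
  have F_inj : injective F.
    by move=> i j e; case: (ltgtP i j) => // /F_lt; rewrite e ltxx.
  have := CH_card ch (inj_comp code_inj F_inj) Wnc.
  by rewrite card_eq_sym => /(card_eq_trans DR).
- move=> x y xy cxy.
  have [c [/= cx cy]] : exists c : D1, (forall z, ([set x] `|` [set z | (x < z)%O && (z < y)%O]) z -> (z < c)%O) /\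
      (forall z, [set y] z -> (c < z)%O).
    apply: fill_strict.
    - by apply: countable_setU => //; exact: countable1.
    - exact: countable1.
    - by exists x; left.
    - by move=> u v [->|/andP[_ h]] -> .
  have xc : (x < c)%O by apply: cx; left.
  have cy' : (c < y)%O by exact: cy.
  suff : (c < c)%O by rewrite ltxx.
  by apply: cx; right; rewrite /= xc cy'.
- by move=> C /bounded[c cP]; exists c => x /cP/ltW.
- move=> C C' cC cC' CC'.
  have [[x [Cx C'x]]|nCC'] := pselect (exists x, C x /\ C' x).
    by exists x; split=> [y Cy|y C'y]; exact: CC'.
  have [C0|/set0P C0] := eqVneq C set0.
    by exists (phi (fun=> 0%N)); split=> // y; rewrite C0.
  have [c [c1 c2]] : exists c : D1, (forall x, C x -> (x < c)%O) /\ (forall y, C' y -> (c < y)%O).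
    apply: fill_strict => // x y Cx C'y; rewrite lt_neqAle CC' // andbT.
    by apply/eqP => e; apply: nCC'; exists x; split=> //; rewrite e.
  by exists c; split=> [x /c1/ltW|y /c2/ltW].
- exact: fill_strict.
Qed.

Theorem ultrapower_D1_D2 :
  exists (d1 : Order.disp_t) (D1 : orderType d1) (d2 : Order.disp_t) (D2 : orderType d2)
    (phi : (nat -> nat) -> D2),
  [/\ forall h g, Phi h -> Phi g -> (ule h g <-> (phi h <= phi g)%O),
      forall z, exists2 h, Phi h & phi h = z, is_D1 W D1 & is_D2 D1 D2].
Proof.
have [d1 [D1 [psi [psiP psi_surj DP]]]] := ultrapower_D1.
have [d2 [D2 [phi [phiP phi_surj]]]] : exists (d : Order.disp_t) (D : orderType d) (phi : (nat -> nat) -> D),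
    (forall x y, Phi x -> Phi y -> (ule x y <-> (phi x <= phi y)%O)) /\
    (forall z : D, exists2 x, Phi x & phi x = z).
  apply: preorder_quotient Phi0.
  - by move=> h _; apply: ule_all.
  - by move=> h g e _ _ _; exact: ule_trans.
  - move=> h g _ _; have [hg|gh] := ultra_total h g; [by left|right].
    by apply: filterS gh => k /= /ltnW.
exists d1, D1, d2, D2, phi; split=> //.
have /choice[lift liftP] z : exists h, Phi h /\ phi h = z.
  by have [h] := phi_surj z; exists h.
have phi_lt h g : Phi h -> Phi g -> (phi h < phi g)%O <-> U [set k | h k < g k].
  move=> Ph Pg; rewrite ltNge; split.
    move=> /negP lt; have [/phiP h1|//] := ultra_total g h.
    by case: lt; apply: h1.
  by move=> lt; apply/negP => /phiP gh; exact: ule_lt (gh Pg Ph) lt.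
have phi_eq h g : Phi h -> Phi g -> U [set k | h k = g k] -> phi h = phi g.
  move=> Ph Pg e; apply/eqP; rewrite eq_le; apply/andP.
  by split; apply/phiP => //; apply: filterS e => k /= ->.
have PhiD h n : Phi h -> Phi (fun k => h k + n).
  move=> Ph; elim: n => [|n /PhiS].
    by rewrite (_ : (fun k => _) = h) //; apply: funext => k; rewrite addn0.
  by rewrite (_ : (fun k => _.+1) = (fun k => h k + n.+1)) //; apply: funext => k; rewrite addnS.
have succP h : Phi h -> direct_succ (phi h) (phi (fun k => (h k).+1)).
  move=> Ph; split; first by apply/phi_lt => //; [exact: PhiS|apply: filterS filterT => k _ /=].
  move=> [z]; have [g Pg <-] := phi_surj z; move=> /andP[/phi_lt h1 /phi_lt h2].
  apply: (@filter_not_empty _ U _).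
  apply: filterS2 (h1 Ph Pg) (h2 Pg (PhiS Ph)) => k /= a b.
  by have := leq_trans b a; rewrite ltnn.
have close h g : Phi h -> Phi g -> (finitely_close (phi h) (phi g) <-> ule1 h g /\ ule1 g h).
  move=> Ph Pg; wlog hg : h g Ph Pg / ule h g.
    move=> main; have [|/(filterS (fun k => @ltnW _ _)) gh] := ultra_total h g; first exact: main.
    by split=> [/finitely_close_sym/(main _ _ Pg Ph gh)[]|[h1 h2]] //; apply/finitely_close_sym/main.
  split=> [fc|[_ [n gh]]].
    split; first by exists 0; apply: filterS hg => k /=; rewrite addn0.
    apply: contrapT => /farP hgfar.
    (* If [g] were far from [h], the functions [h + n] would give infinitely many elements of the
       finite interval. *)
    apply: (finite_no_injection fc (f := fun n => phi (fun k => h k + n))) => [n /=|].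
      apply/orP; left; apply/andP; split; apply/phiP => //; try exact: PhiD.
        by apply: ule_all => k; exact: leq_addr.
    have inj n m : n < m -> (phi (fun k => h k + n)) <> (phi (fun k => h k + m)).
      move=> nm e; have : ule (fun k => h k + m) (fun k => h k + n).
        by apply/phiP; rewrite ?e ?lexx //; exact: PhiD.
      by move=> /ule_lt; apply; apply: filterS filterT => k _ /=; rewrite ltn_add2l.
    by move=> n m e; case: (ltngtP n m) => // /inj; [move/(_ e)|move/(_ (esym e))].
  apply: sub_finite_set (finite_image (fun j => phi (fun k => h k + j)) (finite_II n.+1)) => z.
  have [e Pe <-] := phi_surj z => /= /orP[] /andP[/phiP h1 /phiP h2].
    have [j jn ej] : exists2 j, j <= n & U [set k | e k = h k + j].
      by apply: ule_between (h1 Ph Pe) (ule_trans (h2 Pe Pg) gh).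
    exists j; first by rewrite /= ltnS.
    by apply: phi_eq; [exact: PhiD| |apply: filterS ej => k /= ->].
  exists 0 => //; apply: phi_eq; [exact: PhiD|done|].
  apply: filterS3 hg (h1 Pg Pe) (h2 Pe Ph) => k /= a b c.
  by rewrite addn0; apply/eqP; rewrite eqn_leq c (leq_trans a b).
split.
- by exists (phi (fun=> 0)) => z; have [h Ph <-] := phi_surj z; apply/phiP => //; apply: ule_all.
- move=> z; have [h Ph <-] := phi_surj z.
  by exists (phi (fun k => (h k).+1)); have [] := succP h Ph.
- by move=> z; have [h Ph <-] := phi_surj z; exists (phi (fun k => (h k).+1)); exact: succP.
(* Applying [.-1] and then [.+1] restores [h] unless [h] vanishes on a set of [U], and then [phi h]
   is the minimum. *)
- move=> z; have [h Ph <-] := phi_surj z => nmin.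
  exists (phi (fun k => (h k).-1)); have := succP _ (PhiP Ph).
  rewrite (phi_eq (fun k => (h k).-1.+1) h) //; first exact/PhiS/PhiP.
  have [h0|] := ultra_total h (fun=> 0); last by apply: filterS => k /= /prednK.
  case: nmin => y; have [g Pg <-] := phi_surj y; apply/phiP => //.
  by apply: filterS h0 => k /=; rewrite leqn0 => /eqP->.
- have psi_phi h g : Phi h -> Phi g -> phi h = phi g -> psi h = psi g.
    move=> Ph Pg e; have [h1 h2] : ule h g /\ ule g h by split; apply/phiP; rewrite ?e.
    apply/eqP; rewrite eq_le; apply/andP.
    by split; apply/psiP => //; exists 0;
      [apply: filterS h1|apply: filterS h2] => k /=; rewrite addn0.
  apply: (order_isomorphic_quotient (phi := fun z => psi (lift z)) (phi (fun=> 0))).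
  + move=> x y _ _; have [Px ex] := liftP x; have [Py ey] := liftP y.
    rewrite /ole -{1}ex -{1}ey => /phiP h; apply/psiP => //; exists 0.
    by apply: filterS (h Px Py) => k /=; rewrite addn0.
  + move=> x y _ _; have [Px ex] := liftP x; have [Py ey] := liftP y.
    move=> /psiP-/(_ Px Py)[n xy].
    (* The hypothesis only bounds [x] by [y + n], so [y] is replaced by [y + n], which lies in the
       same class. *)
    exists x, (phi (fun k => lift y k + n)); split=> //.
      have [Pz ez] := liftP (phi (fun k => lift y k + n)).
      rewrite (psi_phi _ _ Pz (PhiD _ n Py) ez); apply/eqP; rewrite eq_le; apply/andP.
      split; apply/psiP => //; try exact: PhiD; [exists n|exists 0]; apply: ule_all => // k.
      by rewrite addn0 leq_addr.
    by rewrite /ole -ex; apply/phiP => //; exact: PhiD.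
  + move=> x y _ _; have [Px ex] := liftP x; have [Py ey] := liftP y.
    rewrite -{1}ex -{1}ey close //; split=> [[h1 h2]|e].
      by apply/eqP; rewrite eq_le; apply/andP; split; apply/psiP.
    by split; apply/psiP; rewrite ?e.
  + move=> z; have [h Ph <-] := psi_surj z; exists (phi h) => //.
    by have [Pz ez] := liftP (phi h); exact: psi_phi ez.
Qed.

End Ultrapower.

(** * Forests *)

(** [anc k p] is the node [p] steps from the leaf [k] towards the root, meaningful for
    [p <= depth k]. Nodes have no further structure: lines meet where these values agree, and a tree
    is recognised by its root [anc k (depth k)]. *)
Record forest (N : Type) := Forest {
  leaf : set nat;
  depth : nat -> nat;
  anc : nat -> nat -> N }.

Section ForestTheory.
Variable N : Type.
Implicit Types (T : forest N) (x y : N).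

Definition at_height T x k p := [/\ leaf T k, p <= depth T k & anc T k p = x].

Definition in_forest T x := exists k p, at_height T x k p.

(** [x] is the parent of [y]. For large [n] the witnessing leaf [k >= n] keeps both out of the
    finitely many creatures in which zoos related by [zeqs] may differ. *)
Definition child T n x y :=
  exists k p, [/\ leaf T k, n <= k, p < depth T k, anc T k p = y & anc T k p.+1 = x].

(** [anc_convex] combines the separation of incomparable nodes with the increasing order of the
    creatures. [anc_branch] says that the norms tend to infinity, each of the [M] children being
    given as a leaf and a height; [anc_bounded] is the finiteness of creatures. *)
Record is_forest T : Prop := IsForest {
  anc_inj : forall x k p q, at_height T x k p -> at_height T x k q -> p = q;
  anc_up : forall x k p k' p', at_height T x k p -> at_height T x k' p' ->
    p < depth T k -> p' < depth T k' /\ anc T k p.+1 = anc T k' p'.+1;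
  anc_leaf : forall k k' p, leaf T k -> at_height T (anc T k 0) k' p -> k' = k;
  anc_convex : forall x a b c p q, leaf T b -> a <= b -> b <= c ->
    at_height T x a p -> at_height T x c q -> exists r, at_height T x b r;
  anc_branch : forall M, exists n, forall k p, leaf T k -> n <= k -> p < depth T k ->
    exists e : nat -> nat * nat, forall i, i < M ->
      [/\ leaf T (e i).1, (e i).2 < depth T (e i).1,
          anc T (e i).1 (e i).2.+1 = anc T k p.+1
        & forall j, j < M -> anc T (e i).1 (e i).2 = anc T (e j).1 (e j).2 -> i = j];
  anc_bounded : forall x, exists b, forall k p, at_height T x k p -> k <= b;
  leaf_unbounded : forall n, exists2 k, leaf T k & n <= k }.

Section OneForest.
Variables (T : forest N) (FT : is_forest T).

Lemma anc_upD x k p k' p' m : at_height T x k p -> at_height T x k' p' ->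
  p + m <= depth T k -> p' + m <= depth T k' /\ anc T k (p + m) = anc T k' (p' + m).
Proof.
move=> xk xk'; elim: m => [|m IH] hm.
  by case: xk xk' => _ _ <- [_ ? ?]; rewrite !addn0.
have [h e] := IH (leq_trans (leq_add (leqnn p) (leqnSn m)) hm).
rewrite !addnS; apply: (anc_up FT (x := anc T k (p + m))).
- by case: xk => ? _ _; split=> //; lia.
- by case: xk' => ? _ _; split=> //; rewrite e.
- lia.
Qed.

Lemma anc_depth x k p k' p' : at_height T x k p -> at_height T x k' p' ->
  depth T k + p' = depth T k' + p.
Proof.
move=> xk xk'; have [_ pk _] := xk; have [_ pk' _] := xk'.
have [|h1 _] := anc_upD (m := depth T k - p) xk xk'; first lia.
have [|h2 _] := anc_upD (m := depth T k' - p') xk' xk; first lia.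
lia.
Qed.

Lemma same_root x k p k' p' : at_height T x k p -> at_height T x k' p' ->
  anc T k (depth T k) = anc T k' (depth T k').
Proof.
move=> xk xk'; have := anc_depth xk xk'; have [_ pk _] := xk; have [_ pk' _] := xk' => e.
have [|_] := anc_upD (m := depth T k - p) xk xk'; first lia.
rewrite subnKC // => ->.
by rewrite (_ : p' + _ = depth T k') //; lia.
Qed.

(** Every tree has a last leaf, so leaves beyond the last one of the tree of [n] avoid that tree;
    the induction excludes one small leaf at a time. *)
Lemma same_tree_large n : exists m, forall k k', leaf T k -> leaf T k' -> m <= k ->
  anc T k (depth T k) = anc T k' (depth T k') -> n <= k'.
Proof.
elim: n => [|n [m mP]]; first by exists 0.
have [b bP] := anc_bounded FT (anc T n (depth T n)).
exists (maxn m b.+1) => k k' lk lk'; rewrite geq_max => /andP[mk bk] e.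
have := mP _ _ lk lk' mk e; rewrite leq_eqVlt => /orP[/eqP nk|//].
have : k <= b by apply: (bP k (depth T k)); split; rewrite // e nk.
by rewrite leqNgt bk.
Qed.

(** The least height at which an ancestor of [a] also lies on the line of [b] is the [p.+1] of the
    statement. The heights [p] and [q] may differ, since the lines need not have the same length. *)
Lemma meetP a b : leaf T a -> leaf T b -> a <> b ->
  anc T a (depth T a) <> anc T b (depth T b) \/
  exists p q, [/\ p < depth T a, q < depth T b, anc T a p <> anc T b q
     & anc T a p.+1 = anc T b q.+1].
Proof.
move=> la lb ab.
have [e|] := pselect (anc T a (depth T a) = anc T b (depth T b)); last by left.
right.
have : exists p, `[< exists q, at_height T (anc T a p) b q >] && (p <= depth T a).
  by exists (depth T a); rewrite leqnn andbT; apply/asboolP; exists (depth T b).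
move=> /ex_minnP[p /andP[/asboolP[q [_ qb e1]] pa] pmin].
case: p => [|p] in e1 pa pmin *.
  by case: ab; apply/esym/(anc_leaf FT la (k' := b) (p := q)); split.
case: q => [|q] in e1 qb *.
  case: ab; apply: (anc_leaf FT lb (p := p.+1)); split=> //.
exists p, q; split=> // e2; suff /pmin : `[< exists q, at_height T (anc T a p) b q >] && (p <= depth T a).
  by rewrite ltnn.
rewrite (ltnW pa) andbT; apply/asboolP; exists q; split=> //; exact: ltnW.
Qed.

End OneForest.
End ForestTheory.

(** * Height functions of fronts *)

Lemma nminP (A : set nat) a : A a -> A (nmin A) /\ forall b, A b -> nmin A <= b.
Proof.
move=> Aa; have /ex_minnP[m /asboolP Am mP] : exists n, `[< A n >] by exists a; apply/asboolP.
rewrite /nmin; case: xgetP => [x _ [Ax xP]|/(_ m)[]] //.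
by split=> // b Ab; apply: mP; apply/asboolP.
Qed.

Section Coherent.
Variable N : Type.
Implicit Types (S T : forest N) (h : nat -> nat).

Definition eventually_on T (P : set nat) :=
  exists n, forall k, leaf T k -> n <= k -> P k.

(** [S] belongs to the smaller zoo. The last clause reflects the disjointness demanded by [zleq]:
    what lies beneath the old roots is new, so it belongs to no front of [T]. *)
Definition refines_from n S T := forall k, leaf S k -> n <= k ->
  [/\ leaf T k, depth T k <= depth S k,
      forall p, p <= depth T k -> anc S k p = anc T k p
    & forall p, depth T k < p -> p <= depth S k -> ~ in_forest T (anc S k p)].

(* [h k] is the height above the leaf [k] of the node on the branch of [k] of
   a front, the nodes of that front being the [anc T k (h k)]. *)
Definition coherent T n h := forall k, leaf T k -> n <= k ->
  h k <= depth T k /\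
  forall k' p, n <= k' -> at_height T (anc T k (h k)) k' p -> p = h k'.

Lemma coherent_weaken T m n h : m <= n -> coherent T m h -> coherent T n h.
Proof.
move=> mn ch k lk nk; have [hk hP] := ch k lk (leq_trans mn nk); split=> // k' p nk'.
exact: hP (leq_trans mn nk').
Qed.

Lemma refines_in_forest n S T k p : refines_from n S T -> leaf S k -> n <= k ->
  p <= depth S k -> in_forest T (anc S k p) -> at_height T (anc S k p) k p.
Proof.
move=> R lk nk pk Tp; have [lk' _ e out] := R k lk nk.
have [pT|Tlt] := leqP p (depth T k); last by case: (out p).
by split=> //; rewrite e.
Qed.

(** A node of [T] found on a line of [S] is not among the new ones, so it sits at the same height on
    the same line in [T]. *)
Lemma coherent_refines m n S T h : refines_from m S T -> coherent T n h ->
  coherent S (maxn m n) h.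
Proof.
move=> R ch k lk; rewrite geq_max => /andP[mk nk].
have [lk' dk e _] := R k lk mk; have [hk hP] := ch k lk' nk.
split=> [|k' p]; first exact: leq_trans hk dk.
rewrite geq_max => /andP[mk' nk'] [lk'' pk' epk'].
apply: hP => //; rewrite -e // -epk'; apply: refines_in_forest R _ _ _ _ => //.
by rewrite epk' e //; exists k, (h k).
Qed.

(** If the node one step nearer to the leaf also lies on the line of [k'], so does its parent, whose
    height there is [h k']. Where [h k = 0] the front stays at the leaf. *)
Lemma coherent_pred T n h : is_forest T -> coherent T n h -> coherent T n (fun k => (h k).-1).
Proof.
move=> FT ch k lk nk; have [hk hP] := ch k lk nk; split; first lia.
move=> k' p nk' kp; case e : (h k) => [|q] in kp hP hk *.
  have kk : k' = k by apply: anc_leaf lk kp.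
  by rewrite kk e /=; apply: (anc_inj FT) kp _; rewrite kk; split.
have [|pk' ek'] := anc_up FT (x := anc T k q) (k := k) (p := q) _ kp hk.
  by split=> //; exact: ltnW.
by rewrite -(hP k' p.+1) //; case: kp.
Qed.

Lemma coherent_depth T : is_forest T -> coherent T 0 (depth T).
Proof.
move=> FT k lk _; split=> // k' p _ kp.
have kk : at_height T (anc T k (depth T k)) k (depth T k) by split.
by have := anc_depth FT kk kp; lia.
Qed.

End Coherent.

(** * Generic sequences of forests and closure of the height functions *)

Section GenericForests.
Variables (N : Type) (d : Order.disp_t) (W : orderType d).

(** Two colours suffice for nodes and four for pairs: the former mark membership in a front, the
    latter record two properties of pairs at once when the front of a growth function is built. *)
Record generic_forests (T : W -> forest N) : Prop := GenericForests {
  gf_forest : forall i, is_forest (T i);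
  gf_refines : forall i j : W, (i < j)%O -> exists n, refines_from n (T j) (T i);
  gf_unary : forall (i : W) (c : N -> bool), exists2 j : W, (i < j)%O & exists n,
    forall x y y', in_forest (T i) x -> child (T j) n x y -> child (T j) n x y' -> c y = c y';
  gf_binary : forall (i : W) (c : set N -> bool * bool), exists2 j : W, (i < j)%O & exists n,
    forall x y y' z z', in_forest (T i) x -> child (T j) n x y -> child (T j) n x y' ->
      child (T j) n x z -> child (T j) n x z' -> y <> y' -> z <> z' ->
      c [set y; y'] = c [set z; z'];
  gf_branch : forall (i : W) (A : set nat), exists j : W,
    eventually_on (T j) A \/ eventually_on (T j) (~` A);
  gf_strong : forall f : nat -> nat, {homo f : m n / m <= n} -> exists (i : W) n,
    forall a b, leaf (T i) a -> leaf (T i) b -> n <= a -> a < b ->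
      anc (T i) a (depth (T i) a) <> anc (T i) b (depth (T i) b) -> f a <= b;
  gf_root : forall i : W, exists2 j : W, (i <= j)%O &
    eventually_on (T j) [set k | depth (T i) k < depth (T j) k] }.

Variable T : W -> forest N.
Hypotheses (GT : generic_forests T) (W1 : is_omega1 W).
Variable U : set_system nat.
Hypothesis UE : forall P : set nat, U P <-> exists i : W, eventually_on (T i) P.

Let FT i : is_forest (T i) := gf_forest GT i.

Lemma refines_le (i j : W) : (i <= j)%O -> exists n, refines_from n (T j) (T i).
Proof.
rewrite le_eqVlt => /orP[/eqP->|]; last exact: gf_refines.
by exists 0 => k lk _; split=> // p /ltn_geF -> .
Qed.

Lemma eventually_le (i j : W) P : (i <= j)%O -> eventually_on (T i) P -> eventually_on (T j) P.
Proof.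
move=> /refines_le[m R] [n nP]; exists (maxn m n) => k lk; rewrite geq_max => /andP[mk nk].
by have [lk' _ _ _] := R k lk mk; exact: nP.
Qed.

Lemma eventuallyI i P Q : eventually_on (T i) P -> eventually_on (T i) Q ->
  eventually_on (T i) (P `&` Q).
Proof.
move=> [m mP] [n nQ]; exists (maxn m n) => k lk; rewrite geq_max => /andP[mk nk].
by split; [exact: mP|exact: nQ].
Qed.

Lemma omega1_inhabited : exists i : W, True.
Proof.
have [_ nc _] := W1; apply: contrapT => no; apply: nc.
by rewrite (_ : setT = set0) //; apply/seteqP; split=> // i _; case: no; exists i.
Qed.

Lemma generic_ultrafilter : UltraFilter U.
Proof.
have [i0 _] := omega1_inhabited.
have PU : ProperFilter U.
  split.
    move=> /UE[i [n nP]]; have [k lk nk] := leaf_unbounded (FT i) n.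
    exact: nP nk.
  split.
  - by apply/UE; exists i0, 0.
  - move=> P Q /UE[i Pi] /UE[j Qj]; apply/UE; exists (Order.max i j).
    by apply: eventuallyI; [apply: eventually_le Pi|apply: eventually_le Qj];
      rewrite le_max lexx ?orbT.
  - by move=> P Q PQ /UE[i [n nP]]; apply/UE; exists i, n => k lk nk; exact/PQ/nP.
split=> // G PG UG; apply/seteqP; split=> // A GA.
have [j [Aj|nAj]] := gf_branch GT i0 A; first by apply/UE; exists j.
have : U (~` A) by apply/UE; exists j.
move=> /UG GnA; case: (@filter_not_empty _ G _).
by rewrite -(setICr A); exact: filterI.
Qed.

Let UU : UltraFilter U := generic_ultrafilter.
#[local] Existing Instance UU.

Definition front_height : set (nat -> nat) :=
  [set h | exists (i : W) n, coherent (T i) n h].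

Lemma coherent_le (i j : W) n h : (i <= j)%O -> coherent (T i) n h ->
  exists m, coherent (T j) m h.
Proof. by move=> /refines_le[m R] /(coherent_refines R) ?; exists (maxn m n). Qed.

Lemma front_height0 : front_height (fun=> 0).
Proof.
have [i _] := omega1_inhabited; exists i, 0 => k lk _; split=> // k' p _ kp.
have kk : k' = k by apply: anc_leaf (FT i) _ _ _ lk kp.
by apply: (anc_inj (FT i)) kp _; rewrite kk; split.
Qed.

Lemma front_height_pred h : front_height h -> front_height (fun k => (h k).-1).
Proof. by move=> [i [n ch]]; exists i, n; exact: coherent_pred. Qed.

(** The parents of the nodes of a front form a front only if the children of each node are all in
    the old front or all outside it; colouring nodes by membership arranges this. Before that,
    [gf_root] supplies a zoo in which almost every node of the front has a parent. *)
Lemma front_height_succ h : front_height h -> front_height (fun k => (h k).+1).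
Proof.
move=> [i0 [n0 ch0]]; have [i i0i [n1 rP]] := gf_root GT i0.
have [n2 R2] := refines_le i0i.
have [n3 ch3] := coherent_le i0i ch0.
pose n := maxn n0 (maxn n1 (maxn n2 n3)).
have ch : coherent (T i) n h by apply: coherent_weaken ch3; rewrite /n; lia.
have hlt k : leaf (T i) k -> n <= k -> h k < depth (T i) k.
  move=> lk nk; have /= h1 := rP k lk; have [lk' _ _ _] := R2 k lk ltac:(lia).
  by have [h2 _] := ch0 k lk' ltac:(lia); have := h1 ltac:(lia); lia.
pose F x := exists k, [/\ leaf (T i) k, n <= k & anc (T i) k (h k) = x].
have [j ij [m hom]] := gf_unary GT i (fun x => `[< F x >]).
have [m' R] := gf_refines GT ij.
exists j, (maxn n (maxn m m')) => k lk nk.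
have [lki dk ek _] := R k lk ltac:(lia).
have hk := hlt k lki ltac:(lia).
split; first by lia.
move=> k' p nk' kp; have [lk' pk' ep] := kp.
have [lki' dk' ek' _] := R k' lk' ltac:(lia).
(* A leaf lies only on its own line, at height 0, hence never at height [(h k).+1]. *)
case: p => [|p] in kp pk' ep *.
  have kh : at_height (T j) (anc (T j) k' 0) k (h k).+1 by rewrite ep; split=> //; lia.
  have kk : at_height (T j) (anc (T j) k' 0) k 0.
    by rewrite (anc_leaf (FT j) lk' kh); split.
  by have := anc_inj (FT j) kh kk.
have F1 : F (anc (T j) k (h k)) by exists k; rewrite ek ?lki; [split=> //; lia|lia].
have F2 : F (anc (T j) k' p).
  apply/asboolP; rewrite (hom (anc (T j) k (h k).+1) _ (anc (T j) k (h k))) ?asboolE //.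
  - by exists k, (h k).+1; split=> //; rewrite ek.
  - by exists k', p; split=> //; lia.
  - by exists k, (h k); split=> //; lia.
have [k2 [lk2 nk2 e2]] := F2.
have kp' : at_height (T i) (anc (T j) k' p) k' p.
  apply: refines_in_forest R _ _ _ _ => //; [lia|lia|].
  by exists k2, (h k2); split=> //; have [] := ch k2 lk2 nk2.
have [_ /(_ k' p)] := ch k2 lk2 nk2; rewrite e2 => -> //; lia.
Qed.

(** Each use of [gf_root] lengthens almost all lines. After infinitely many uses, beginning with a
    zoo that carries all the [h n], the roots of a zoo refining all those obtained form a front far
    from every [h n]. *)
Lemma front_height_unbounded (h : nat -> nat -> nat) : (forall n, front_height (h n)) ->
  exists2 e, front_height e & forall n, far U (h n) e.
Proof.
move=> /choice[i iP]; have [i' i'P] := omega1_bounded W1 i.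
have /choice[nxt nxtP] j : exists j' : W, (j <= j')%O /\
    eventually_on (T j') [set k | depth (T j) k < depth (T j') k].
  by have [j' ? ?] := gf_root GT j; exists j'.
have step m : (i' <= iter m nxt i')%O /\
    eventually_on (T (iter m nxt i')) [set k | depth (T i') k + m <= depth (T (iter m nxt i')) k].
  elim: m => [|m [i'm IH]]; first by split=> //; exists 0 => k _ _ /=; rewrite addn0.
  have [le ev] := nxtP (iter m nxt i'); split; first exact: le_trans le.
  have [n nP] := eventuallyI (eventually_le le IH) ev.
  by exists n => k lk nk; have [/= h1 h2] := nP k lk nk; rewrite addnS; exact: leq_ltn_trans h2.
have [l lP] := omega1_bounded W1 (fun m => iter m nxt i').
exists (depth (T l)); first by exists l, 0; exact: coherent_depth.
move=> n m; apply/UE; exists l.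
have [i'm ev] := step m; have [n0 ch] := iP n.
have [n1 ch1] := coherent_le (i'P n) ch.
have ev1 : eventually_on (T i') [set k | h n k <= depth (T i') k].
  by exists n1 => k lk nk; have [] := ch1 k lk nk.
have [n2 R] := refines_le (lP m).
have ev2 : eventually_on (T l) [set k | depth (T (iter m nxt i')) k <= depth (T l) k].
  by exists n2 => k lk nk; have [] := R k lk nk.
have i'l : (i' <= l)%O by exact: lP 0.
have [n3 nP] := eventuallyI (eventuallyI (eventually_le i'l ev1) (eventually_le (lP m) ev)) ev2.
exists n3 => k lk nk; have [[/= h1 h2] h3] := nP k lk nk.
by apply: leq_trans (leq_trans _ h2) h3; rewrite leq_add2r.
Qed.

Lemma eventually_all_leq n (P : nat -> set nat) : (forall a, a <= n -> U (P a)) ->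
  U [set k | forall a, a <= n -> P a k].
Proof.
elim: n => [|n IH] UP.
  by apply: filterS (UP 0 (leqnn 0)) => k P0 a; rewrite leqn0 => /eqP->.
have U1 := IH (fun a an => UP a (leqW an)).
apply: filterS2 U1 (UP n.+1 (leqnn _)) => k P1 P2 a.
by rewrite leq_eqVlt => /orP[/eqP->//|]; rewrite ltnS; exact: P1.
Qed.

(* On the trees with least leaf [m], the front of height [e] is the one lying [q]
   levels closer to the leaves than the closest to the leaves of the fronts
   [g 0, ..., g q]; here [q] tends to infinity with [m]. *)
Lemma front_height_fill (h g : nat -> nat -> nat) :
  (forall n, front_height (h n)) -> (forall n, front_height (g n)) ->
  (forall n m, far U (h n) (g m)) ->
  exists2 e, front_height e & forall n, far U (h n) e /\ far U e (g n).
Proof.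
move=> hP gP hg.
(* [g (mn n)] is least among [g 0, ..., g n] modulo [U]. *)
have /choice[mn mnP] n : exists m, forall a, a <= n -> ule U (g m) (g a).
  elim: n => [|n [m mP]].
    by exists 0 => a; rewrite leqn0 => /eqP->; exact: ule_all.
  have [lt|lt] := ultra_total UU (g m) (g n.+1).
    by exists m => a; rewrite leq_eqVlt => /orP[/eqP->//|]; exact: mP.
  have lt' : ule U (g n.+1) (g m) by apply: filterS lt => k /ltnW.
  exists n.+1 => a; rewrite leq_eqVlt => /orP[/eqP->//|]; first exact: ule_all.
  by rewrite ltnS => /mP; exact: ule_trans lt'.
pose g' n := g (mn n).
(* With a gap of at least [2n] below [g' n], subtracting [n] leaves at least [n] on either side. *)
pose good n := [set k | forall a, a <= n -> h a k + n.*2 <= g' n k /\ g' n k <= g a k].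
have /choice[i iP] n : exists i : W, (exists m, coherent (T i) m (g' n)) /\ eventually_on (T i) (good n).
  have [i1 ch] := gP (mn n).
  have /UE[i2 ev] : U (good n).
    apply: (@eventually_all_leq n (fun a => [set k | h a k + n.*2 <= g' n k /\ g' n k <= g a k])).
    by move=> a an; apply: filterI; [exact: hg|exact: mnP].
  exists (Order.max i1 i2); split; last by apply: eventually_le ev; rewrite le_max lexx orbT.
  by have [m cm] := ch; apply: coherent_le cm; rewrite le_max lexx.
have [l lP] := omega1_bounded W1 i.
have /choice[M MP] n : exists m, coherent (T l) m (g' n) /\
    forall k, leaf (T l) k -> m <= k -> good n k.
  have [[m0 c0] ev] := iP n; have [m1 c1] := coherent_le (lP n) c0.
  have [m2 e2] := eventually_le (lP n) ev; exists (maxn m1 m2).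
  split; first by apply: coherent_weaken c1; exact: leq_maxl.
  by move=> k lk; rewrite geq_max => /andP[_ ?]; exact: e2.
(* [Q m] is the largest [q <= m] with [M q <= m], so that stage [q] is usable on a tree with least
   leaf [m]; it tends to infinity with [m]. *)
have /choice[Q QP] m : exists q, M 0 <= m -> M q <= m /\ forall n, n <= m -> M n <= m -> n <= q.
  have [h0|_] := boolP (M 0 <= m); last by exists 0.
  have ex : exists q, (q <= m) && (M q <= m) by exists 0.
  have [q /andP[q1 q2] qm] := ex_maxnP ex (fun q => fun h => proj1 (andP h)).
  by exists q => _; split=> // n n1 n2; apply: qm; rewrite n1.
pose mates k := [set k' | leaf (T l) k' /\ anc (T l) k (depth (T l) k) = anc (T l) k' (depth (T l) k')].
(* The stage depends on the tree and not on the leaf, so [e] inherits coherence from [g' q]. *)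
pose mu k := nmin (mates k).
have muP k : leaf (T l) k -> leaf (T l) (mu k) /\ mu k <= k.
  by move=> lk; have [|[? _] h2] := @nminP (mates k) k; rewrite /mates //= /mu; split=> //; exact: h2.
have mu_large n : eventually_on (T l) [set k | n <= mu k].
  have [m mP] := same_tree_large (FT l) n; exists m => k lk mk.
  have [|[l1 e1] _] := @nminP (mates k) k; first by [].
  exact: mP e1.
have [n0 n0P] := mu_large (M 0).
pose e k := g' (Q (mu k)) k - Q (mu k).
have egood k : leaf (T l) k -> n0 <= k -> good (Q (mu k)) k.
  move=> lk nk; have [_ le] := muP k lk; have [Mq _] := QP (mu k) (n0P k lk nk).
  by apply: (MP _).2 => //; exact: leq_trans le.
have qe k : leaf (T l) k -> n0 <= k -> e k + Q (mu k) = g' (Q (mu k)) k.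
  by move=> lk nk; have [h1 _] := egood k lk nk 0 (leq0n _); rewrite subnK //; lia.
exists e.
  exists l, n0 => k lk nk.
  have [_ le] := muP k lk; have [Mq _] := QP (mu k) (n0P k lk nk).
  have [gk gcoh] := (MP _).1 k lk (leq_trans Mq le).
  split; first by apply: leq_trans gk; exact: leq_subr.
  move=> k' p nk' kp; have [lk' pk' ek'] := kp.
  have kk : at_height (T l) (anc (T l) k (e k)) k (e k).
    by split=> //; apply: leq_trans gk; exact: leq_subr.
  have mumu : mu k = mu k' by rewrite /mu /mates (same_root (FT l) kk kp).
  have [|h1 h2] := anc_upD (FT l) (m := Q (mu k)) kk kp; first by rewrite qe.
  rewrite qe // in h2.
  have e1 : p + Q (mu k) = g' (Q (mu k)) k'.
    apply: gcoh; last by rewrite h2; split.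
    by have [_ le'] := muP k' lk'; apply: leq_trans le'; rewrite -mumu.
  by rewrite /e -mumu -e1 addnK.
move=> a; split=> c; apply/UE; exists l.
- have [n1 n1P] := mu_large (maxn (maxn a c) (M (maxn a c))).
  exists (maxn n0 n1) => k lk; rewrite geq_max => /andP[nk n1k] /=.
  have := n1P k lk n1k; rewrite /= geq_max => /andP[m1 m2].
  have [_ /(_ _ m1 m2)] := QP (mu k) (n0P k lk nk); rewrite geq_max => /andP[aq cq].
  by have [h1 _] := egood k lk nk a aq; have := qe k lk nk; lia.
- have [n1 n1P] := mu_large (maxn (maxn a c) (M (maxn a c))).
  exists (maxn n0 n1) => k lk; rewrite geq_max => /andP[nk n1k] /=.
  have := n1P k lk n1k; rewrite /= geq_max => /andP[m1 m2].
  have [_ /(_ _ m1 m2)] := QP (mu k) (n0P k lk nk); rewrite geq_max => /andP[aq cq].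
  by have [_ h1] := egood k lk nk a aq; have := qe k lk nk; lia.
Qed.

End GenericForests.

(** * Growth functions and fronts *)

Lemma sorted_reindexing (M : nat) (a : nat -> nat) :
  (forall i j, i < M -> j < M -> a i = a j -> i = j) ->
  exists sigma : nat -> nat, (forall i, i < M -> sigma i < M) /\
    forall i j, i < j -> j < M -> a (sigma i) < a (sigma j).
Proof.
move=> ainj; pose s := sort (relpre a leq) (iota 0 M).
have sM : size s = M by rewrite size_sort size_iota.
have s_sub i : i < M -> nth 0 s i < M.
  move=> iM; have : nth 0 s i \in iota 0 M by rewrite -(mem_sort (relpre a leq)) mem_nth ?sM.
  by rewrite mem_iota.
exists (nth 0 s); split=> // i j ij jM.
have iM := ltn_trans ij jM.
have srt : sorted (relpre a leq) s by apply: sort_sorted => x y; exact: leq_total.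
have tr : transitive (relpre a leq) by move=> y x z; exact: leq_trans.
have /= := sorted_ltn_nth tr 0 srt; move=> /(_ i j); rewrite !inE sM => /(_ iM jM ij) le.
rewrite ltn_neqAle le andbT; apply/eqP => /ainj-/(_ (s_sub _ iM) (s_sub _ jM))/eqP.
have us : uniq s by rewrite sort_uniq iota_uniq.
by rewrite nth_uniq ?sM //; lia.
Qed.

Section OneForest.
Variables (N : Type) (T : forest N) (FT : is_forest T).
Implicit Types (x y : N) (h f : nat -> nat).

(** The leaves above a node form an interval among all leaves, and siblings share no leaf; one pair
    [a < a'] therefore decides the order of the two intervals. *)
Lemma siblings_separated x y y' a a' p p' s t q r :
  at_height T y a p -> p < depth T a -> anc T a p.+1 = x ->
  at_height T y' a' p' -> p' < depth T a' -> anc T a' p'.+1 = x ->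
  y <> y' -> a < a' -> at_height T y s q -> at_height T y' t r -> s < t.
Proof.
move=> ya pa pax ya' pa' pax' yy aa' ys yt.
have disj u m m' : at_height T y u m -> at_height T y' u m' -> False.
  move=> yu yu'.
  have [lm e1] := anc_up FT ya yu pa; have [lm' e2] := anc_up FT ya' yu' pa'.
  have [lu _ em] := yu; have [_ _ em'] := yu'.
  have h1 : at_height T x u m.+1 by split=> //; rewrite -e1.
  have h2 : at_height T x u m'.+1 by split=> //; rewrite -e2.
  have [mm] := anc_inj FT h1 h2.
  by apply: yy; rewrite -em -em' mm.
have [la _ _] := ya; have [la' _ _] := ya'; have [ls _ _] := ys; have [lt _ _] := yt.
rewrite ltnNge; apply/negP => ts.
have [sa|sa] := leqP s a'; last first.
  have [m ym] := anc_convex FT la' (ltnW aa') (ltnW sa) ya ys.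
  exact: disj ym ya'.
have [m ym] := anc_convex FT ls ts sa yt ya'.
exact: disj ys ym.
Qed.

Definition represents n h f := coherent T n h /\
  forall a b, leaf T a -> leaf T b -> n <= a -> a < b ->
    (anc T a (h a) = anc T b (h b) -> b <= f a) /\
    (anc T a (h a) <> anc T b (h b) -> f a <= b).

Lemma represents_weaken m n h f : m <= n -> represents m h f -> represents n h f.
Proof.
move=> mn [ch hf]; split; first exact: coherent_weaken ch.
by move=> a b la lb na; apply: hf => //; exact: leq_trans na.
Qed.

(** Let [f k] be the last leaf of the blocks of the front that contain a leaf up to [k], and at
    least [k + 1]. If the block of some [a' <= a] reached beyond [b], convexity would put both [a]
    and [b] in it. *)
Lemma coherent_represents n h : coherent T n h ->
  exists2 f, growth f & represents n h f.
Proof.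
move=> ch.
have /choice[mx mxP] a : exists m, leaf T a -> n <= a ->
    (at_height T (anc T a (h a)) m (h m)) /\
    forall b, leaf T b -> n <= b -> anc T b (h b) = anc T a (h a) -> b <= m.
  have [[la na]|no] := pselect (leaf T a /\ n <= a); last by exists 0 => la na; case: no.
  pose P b := `[< at_height T (anc T a (h a)) b (h b) >].
  have exP : exists b, P b by exists a; apply/asboolP; split=> //; have [] := ch a la na.
  have [B BP] := anc_bounded FT (anc T a (h a)).
  have PB b : P b -> b <= B by move=> /asboolP/BP.
  have [m /asboolP Pm mP] := ex_maxnP exP PB; exists m => _ _; split=> // b lb nb e.
  by apply: mP; apply/asboolP; split=> //; have [] := ch b lb nb.
pose ok a := `[< leaf T a /\ n <= a >].
pose f k := maxn k.+1 (\max_(a < k.+1 | ok a) mx a).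
have mx_f a k : ok a -> a <= k -> mx a <= f k.
  move=> oka; rewrite -ltnS => ak; apply: leq_trans (leq_maxr _ _).
  exact: (@leq_bigmax_cond _ (fun i : 'I_k.+1 => ok i) (fun i => mx i) (Ordinal ak)).
have f_le k b : k < b -> (forall a, ok a -> a <= k -> mx a <= b) -> f k <= b.
  move=> kb mb; rewrite geq_max kb; apply/bigmax_leqP => -[a ak] /= oka.
  exact: mb.
have f_gt k : k < f k by exact: leq_maxl.
exists f.
  split=> // k m km; apply: f_le; first exact: leq_ltn_trans (f_gt m).
  by move=> a oka ak; apply: mx_f => //; exact: leq_trans km.
split=> // a b la lb na ab.
have nb : n <= b by lia.
split=> [e|ne].
  have [_ mxa] := mxP a la na.
  by apply: leq_trans (mx_f a a _ (leqnn _)); [exact: mxa|exact/asboolP].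
apply: f_le => // a' /asboolP[la' na'] a'a.
rewrite leqNgt; apply/negP => bm; have [xm _] := mxP a' la' na'.
have xa' : at_height T (anc T a' (h a')) a' (h a') by split=> //; have [] := ch a' la' na'.
have [_ cha'] := ch a' la' na'.
have [ra xa] := anc_convex FT la a'a (ltnW (ltn_trans ab bm)) xa' xm.
have [rb xb] := anc_convex FT lb (leq_trans a'a (ltnW ab)) (ltnW bm) xa' xm.
case: ne; move: (xa) (xb) => [_ _ ea] [_ _ eb].
by rewrite -(cha' a ra na xa) -(cha' b rb nb xb) ea eb.
Qed.

End OneForest.

Lemma next_inP (A : set nat) n : (forall m, exists2 a, A a & m <= a) ->
  [/\ A (next_in A n), n < next_in A n & forall a, A a -> n < a -> next_in A n <= a].
Proof.
move=> unb; have [a Aa na] := unb n.+1.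
have [|[h1 h2] h3] := @nminP [set a | A a /\ n < a] a; first by [].
by split=> // b Ab nb; exact: h3.
Qed.

Section GrowthOfFronts.
Variables (N : Type) (d : Order.disp_t) (W : orderType d) (T : W -> forest N).
Hypotheses (GT : generic_forests T) (W1 : is_omega1 W).
Variable U : set_system nat.
Hypothesis UE : forall P : set nat, U P <-> exists i : W, eventually_on (T i) P.
Implicit Types (h f : nat -> nat).

Let FT i : is_forest (T i) := gf_forest GT i.
Let UU : UltraFilter U := generic_ultrafilter GT W1 UE.
#[local] Existing Instance UU.

Definition front_growth h f := exists (i : W) n, represents (T i) n h f.

Lemma U_unbounded A : U A -> forall m, exists2 a, A a & m <= a.
Proof.
move=> /UE[i [n nP]] m; have [k lk] := leaf_unbounded (FT i) (maxn n m).
by rewrite geq_max => /andP[nk mk]; exists k => //; exact: nP.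
Qed.

Lemma next_in_homo A : U A -> {homo next_in A : m n / m <= n}.
Proof.
move=> UA m n mn; have [_ _ mP] := next_inP m (U_unbounded UA).
by have [An nn _] := next_inP n (U_unbounded UA); apply: mP => //; exact: leq_ltn_trans nn.
Qed.

Lemma represents_le (i j : W) n h f : (i <= j)%O -> represents (T i) n h f ->
  exists m, represents (T j) m h f.
Proof.
move=> /(refines_le GT)[m R] [ch hf]; exists (maxn m n).
split=> [|a b la lb]; first exact: coherent_refines ch.
rewrite geq_max => /andP[ma na] ab.
have [la' _ ea _] := R a la ma; have [lb' _ eb _] := R b lb (leq_trans ma (ltnW ab)).
rewrite ea ?eb; first exact: hf.
- by have [] := ch b lb' (leq_trans na (ltnW ab)).
- by have [] := ch a la' na.
Qed.

Lemma front_growth_common h f g f' : front_growth h f -> front_growth g f' ->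
  exists (i : W) n, represents (T i) n h f /\ represents (T i) n g f'.
Proof.
move=> [i [n hf]] [j [m gf]].
have ii : (i <= Order.max i j)%O by rewrite le_max lexx.
have jj : (j <= Order.max i j)%O by rewrite le_max lexx orbT.
have [n' hf'] := represents_le ii hf; have [m' gf'] := represents_le jj gf.
exists (Order.max i j), (maxn n' m').
by split; [apply: represents_weaken hf'|apply: represents_weaken gf']; rewrite ?leq_maxl ?leq_maxr.
Qed.

Lemma U_leaves (i : W) n : U [set k | leaf (T i) k /\ n <= k].
Proof. by apply/UE; exists i, n. Qed.

(** With [a] the next point of [A] after [k], [b] the last leaf of the block of [a] for [h], and [c]
    the next point of [A] after [b], one has [f k <= f b <= c]. Three steps lead from [k] to [a],
    from [a] to [b] or beyond by [f'], since blocks for [h] lie inside blocks for [g], and on to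
    [c]; hence the iterate 3. *)
Lemma growth_le_of_ule h f g f' : front_growth h f -> front_growth g f' ->
  growth f -> growth f' -> ule U h g -> growth_le U f f'.
Proof.
move=> hf gf [fmono fgt] [f'mono f'gt] /UE[j [m hg]].
have [i0 [n0 [hf0 gf0]]] := front_growth_common hf gf.
pose i := Order.max i0 j.
have i0i : (i0 <= i)%O by rewrite le_max lexx.
have ji : (j <= i)%O by rewrite le_max lexx orbT.
have [n1 [ch hfP]] := represents_le i0i hf0; have [n2 [cg gfP]] := represents_le i0i gf0.
have [n3 hgP] : eventually_on (T i) [set k | h k <= g k].
  by apply: (eventually_le GT ji); exists m.
pose n := maxn n1 (maxn n2 n3); pose A := [set k | leaf (T i) k /\ n <= k].
have UA : U A by exact: U_leaves.
exists A => //; pose p k := maxn (f' k) (next_in A k).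
have p_mono : {homo p : k l / k <= l}.
  by move=> k l kl; rewrite /p geq_max !leq_max f'mono //= next_in_homo ?orbT.
exists 3 => k /=.
have [[la na] ka _] := next_inP k (U_unbounded UA); set a := next_in A k in la na ka *.
have [B BP] := anc_bounded (FT i) (anc (T i) a (h a)).
have [ha _] := ch a la ltac:(lia).
pose P b := `[< at_height (T i) (anc (T i) a (h a)) b (h b) >].
have exP : exists b, P b by exists a; apply/asboolP.
have PB b : P b -> b <= B by move=> /asboolP/BP.
have [b /asboolP xb bmax] := ex_maxnP exP PB.
have ab : a <= b by apply: bmax; apply/asboolP.
have [lb hb eb] := xb.
have [[lc nc] bc _] := next_inP b (U_unbounded UA); set c := next_in A b in lc nc bc *.
have fbc : f b <= c.
  have [_] := hfP b c lb lc ltac:(lia) bc; apply=> e.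
  have : c <= b by apply: bmax; apply/asboolP; split; [|have [] := ch c lc ltac:(lia)|rewrite -e].
  by rewrite leqNgt bc.
have bpa : b <= p a.
  move: ab; rewrite leq_eqVlt => /orP[/eqP<-|ab].
    by rewrite /p leq_max (ltnW (f'gt a)).
  rewrite /p leq_max; have [-> //] := gfP a b la lb ltac:(lia) ab.
  have hga : h a <= g a by apply: hgP => //; lia.
  have xa : at_height (T i) (anc (T i) a (h a)) a (h a) by split.
  have [ga cga] := cg a la ltac:(lia).
  have [|g1 g2] := anc_upD (FT i) (m := g a - h a) xa xb; first by rewrite subnKC.
  rewrite subnKC // in g2; rewrite g2; congr anc; apply: cga; first by lia.
  by rewrite g2; split.
have apk : a <= p k by rewrite leq_max leqnn orbT.
apply: leq_trans (fmono _ _ (leq_trans (ltnW ka) ab)) _.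
apply: leq_trans fbc _; apply: (@leq_trans (p b)); first by rewrite leq_max leqnn orbT.
by apply: (p_mono); apply: leq_trans bpa _; exact: p_mono.
Qed.

(** Otherwise [g < h] on a set of [U]. Some node of the front of [h] then has [K + 2] children in
    different blocks for [g]; pick a leaf above each, in increasing order. One step of the iteration
    takes a leaf at most to the next one, so [K] steps from the first end before the last, whereas
    [f] of the first reaches the last. *)
Lemma ule_of_growth_le h f g f' : front_growth h f -> front_growth g f' ->
  growth f -> growth f' -> growth_le U f f' -> ule U h g.
Proof.
move=> hf gf [fmono fgt] [f'mono f'gt] [A UA [K fK]].
have [//|/UE[j2 ev2]] := ultra_total UU h g.
have /UE[j1 ev1] := UA.
have [i0 [n0 [hf0 gf0]]] := front_growth_common hf gf.
pose i := Order.max i0 (Order.max j1 j2).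
have i0i : (i0 <= i)%O by rewrite le_max lexx.
have j1i : (j1 <= i)%O by rewrite !le_max lexx orbT.
have j2i : (j2 <= i)%O by rewrite !le_max lexx !orbT.
have [n1 [ch hfP]] := represents_le i0i hf0; have [n2 [cg gfP]] := represents_le i0i gf0.
have [n3 nA] := eventually_le GT j1i ev1; have [n4 ngh] := eventually_le GT j2i ev2.
have [n nE] : exists n, n = maxn (maxn n1 n2) (maxn n3 n4) by eexists.
have [n5 far5] := same_tree_large (FT i) n.
have [n6 br6] := anc_branch (FT i) K.+2.
have [k lk kk] := leaf_unbounded (FT i) (maxn n (maxn n5 n6)).
have [nk n5k n6k] : [/\ n <= k, n5 <= k & n6 <= k] by split; lia.
have [hk chk] := ch k lk ltac:(lia).
have := ngh k lk ltac:(lia) => /= ghk.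
case e : (h k) => [|q] in ghk hk chk; first by [].
have [E EP] := br6 k q lk n6k hk.
pose x := anc (T i) k q.+1; pose a m := (E m).1; pose p m := (E m).2.
have xk : at_height (T i) x k q.+1 by split.
have aP m : m < K.+2 -> [/\ leaf (T i) (a m), n <= a m, h (a m) = (p m).+1, g (a m) <= p m & at_height (T i) x (a m) (p m).+1].
  move=> mK; have [la pa ea _] := EP m mK.
  have xa : at_height (T i) x (a m) (p m).+1 by split.
  have na : n <= a m by apply: far5 n5k _ => //; exact: (same_root (FT i) xk xa).
  have hpa : h (a m) = (p m).+1 by rewrite -(chk (a m) (p m).+1) //; lia.
  by split=> //; have := ngh (a m) la ltac:(lia); rewrite /= hpa.
(* Since [g] stays below the height of the common parent, a block for [g] lies above a single
   child. *)
have g_neq l m : l < K.+2 -> m < K.+2 ->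
    anc (T i) (a l) (g (a l)) = anc (T i) (a m) (g (a m)) -> l = m.
  move=> lK mK eg; have [la na ha ga xa] := aP l lK; have [lb nb hb gb xb] := aP m mK.
  have [_ _ _ inj] := EP l lK; apply: inj => //; rewrite -/(a l) -/(p l) -/(a m) -/(p m).
  have [_ pa _] := xa; have [_ pb _] := xb.
  have ya : at_height (T i) (anc (T i) (a l) (g (a l))) (a l) (g (a l)) by split=> //; lia.
  have yb : at_height (T i) (anc (T i) (a l) (g (a l))) (a m) (g (a m)) by rewrite eg; split=> //; lia.
  have [|h1 h2] := anc_upD (FT i) (m := p l - g (a l)) ya yb; first lia.
  have [|h3 h4] := anc_upD (FT i) (m := (p l).+1 - g (a l)) ya yb; first lia.
  rewrite subnKC // in h2; rewrite subnKC in h4; last by lia.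
  have xb' : at_height (T i) x (a m) (g (a m) + ((p l).+1 - g (a l))).
    by split=> //; rewrite -h4; case: xa.
  by have := anc_inj (FT i) xb xb' => e'; rewrite h2; congr anc; lia.
have a_inj l m : l < K.+2 -> m < K.+2 -> a l = a m -> l = m.
  by move=> lK mK ea; apply: g_neq => //; rewrite ea.
have [s [sK smono]] := sorted_reindexing a_inj.
pose P k := maxn (f' k) (next_in A k).
have P_mono : {homo P : k l / k <= l}.
  by move=> u v uv; rewrite /P geq_max !leq_max f'mono //= next_in_homo ?orbT.
have step m : m < K.+1 -> P (a (s m)) <= a (s m.+1).
  move=> mK; have [la na ha ga xa] := aP (s m) (sK _ (leqW mK)).
  have [lb nb hb gb xb] := aP (s m.+1) (sK m.+1 mK).
  have ab := smono m m.+1 (ltnSn m) mK.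
  rewrite geq_max; apply/andP; split.
    have [_] := gfP (a (s m)) (a (s m.+1)) la lb ltac:(lia) ab; apply => /g_neq.
    by move=> /(_ (sK _ (leqW mK)) (sK m.+1 mK)) es; rewrite es ltnn in ab.
  have [_ _] := next_inP (a (s m)) (U_unbounded UA); apply=> //.
  by apply: nA => //; lia.
have iterP m : m < K.+2 -> iter m P (a (s 0)) <= a (s m).
  elim: m => // m IH mK /=; apply: leq_trans (step m mK).
  by apply: P_mono; apply: IH; exact: leqW.
have [la na ha ga xa] := aP (s 0) (sK 0 (ltn0Sn _)).
have [lb nb hb gb xb] := aP (s K.+1) (sK K.+1 (ltnSn _)).
have ab := smono 0 K.+1 (ltn0Sn _) (ltnSn _).
have [/(_ _)h1 _] := hfP _ _ la lb ltac:(lia) ab.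
have : a (s K.+1) <= f (a (s 0)).
  by apply: h1; rewrite ha hb; case: xa => _ _ ->; case: xb.
have := leq_trans (fK (a (s 0))) (iterP K (ltnW (ltnSn _))).
by have := smono K K.+1 (ltnSn _) (ltnSn _); lia.
Qed.

(* The front of [f] consists of the short nodes nearest to the root, where a node
   is short if its leaves all lie in an interval [a, f a]. The binary colouring [c1] recognises the pairs
   of siblings inside a short node, [c2] those which [f] separates; by homogeneity
   with four siblings one of the two colours holds throughout. *)
Lemma front_growth_exists f : growth f -> exists h, front_growth h f.
Proof.
move=> [fmono fgt].
have [i0 [n0 strong]] := gf_strong GT fmono.
pose L y := [set a | exists p, at_height (T i0) y a p].
pose c1 (P : set N) := forall y y' a b, P y -> P y' -> L y a -> L y' b -> b <= f a.
pose c2 (P : set N) := forall y y' a b, P y -> P y' -> y <> y' -> L y a -> L y' b ->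
  a < b -> f a <= b.
have [j i0j [n1 hom]] := gf_binary GT i0 (fun P => (`[<c1 P>], `[<c2 P>])).
have [n2 R] := gf_refines GT i0j.
have [n3 br] := anc_branch (FT j) 4.
have [n4 far] := same_tree_large (FT j) (maxn (maxn n0 n1) (maxn n2 n3)).
have [n nE] : exists n, n = maxn (maxn (maxn n0 n1) (maxn n2 n3)) n4 by eexists.
pose short x := forall a b p q, at_height (T j) x a p -> at_height (T j) x b q ->
  n <= a -> n <= b -> b <= f a.
have short0 k : leaf (T j) k -> short (anc (T j) k 0).
  move=> lk a b p q ka kb _ _.
  by rewrite (anc_leaf (FT j) lk ka) (anc_leaf (FT j) lk kb) ltnW.
have short_down k p q : leaf (T j) k -> p <= q -> q <= depth (T j) k ->
    short (anc (T j) k q) -> short (anc (T j) k p).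
  move=> lk pq qk sq a b u v xa xb na nb.
  have xk : at_height (T j) (anc (T j) k p) k p by split=> //; exact: leq_trans qk.
  have [|ha ea] := anc_upD (FT j) (m := q - p) xk xa; first by rewrite subnKC.
  have [|hb eb] := anc_upD (FT j) (m := q - p) xk xb; first by rewrite subnKC.
  have [la _ _] := xa; have [lb _ _] := xb.
  by apply: (sq a b (u + (q - p)) (v + (q - p))) => //; split; rewrite // -?ea -?eb subnKC.
have /choice[h hP] k : exists p, leaf (T j) k ->
    [/\ p <= depth (T j) k, short (anc (T j) k p)
       & forall q, q <= depth (T j) k -> short (anc (T j) k q) -> q <= p].
  have [lk|no] := pselect (leaf (T j) k); last by exists 0.
  pose P p := `[< short (anc (T j) k p) >] && (p <= depth (T j) k).
  have exP : exists p, P p by exists 0; rewrite /P leq0n andbT; apply/asboolP/short0.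
  have [p /andP[/asboolP sp pk] pmax] := ex_maxnP exP (fun q (h : P q) => proj2 (andP h)).
  by exists p => _; split=> // q qk sq; apply: pmax; rewrite /P qk andbT; apply/asboolP.
(* Shortness passes from a node to those nearer to the leaves, so the same node is the last short
   one on every line through it. *)
have hcoh : coherent (T j) n h.
  move=> k lk nk; have [hk sk hmax] := hP k lk; split=> // k' p nk' xk'.
  have [lk' pk' ep] := xk'; have [hk' sk' hmax'] := hP k' lk'.
  have ph : p <= h k' by apply: hmax'; rewrite // ep.
  apply/eqP; rewrite eqn_leq ph leqNgt; apply/negP => lt.
  have xk : at_height (T j) (anc (T j) k (h k)) k (h k) by split.
  have [lt' e'] := anc_up (FT j) xk' xk (leq_trans lt hk').
  have := hmax (h k).+1 lt'; rewrite ltnn => /(_ _)h1; suff : false by [].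
  by apply: h1; rewrite -e'; apply: short_down lt hk' sk'.
exists h, j, n; split=> // a b la lb na ab.
have nb : n <= b by lia.
have [hka ska hmaxa] := hP a la; have [hkb skb hmaxb] := hP b lb.
split=> [e|ne].
  by apply: (ska a b (h a) (h b)) => //; split=> //; rewrite e.
have [lai dai eai _] := R a la ltac:(lia); have [lbi dbi ebi _] := R b lb ltac:(lia).
have rtP : anc (T i0) a (depth (T i0) a) <> anc (T i0) b (depth (T i0) b) -> f a <= b.
  by apply: strong => //; lia.
(* Leaves of different trees are handled by strength; otherwise the lines meet at a node [x], which
   is not short. *)
have [r|[p [q [pa qb yab xab]]]] := meetP (FT j) la lb (fun e => @elimT _ _ (negP) (negbT (ltn_eqF ab)) (introT eqP e)).
  apply: rtP => e; apply: r.
  apply: (same_root (FT j) (x := anc (T i0) a (depth (T i0) a))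
    (p := depth (T i0) a) (p' := depth (T i0) b)); split=> //; first exact: eai.
  by rewrite ebi.
pose x := anc (T j) a p.+1; pose ya := anc (T j) a p; pose yb := anc (T j) b q.
have xa : at_height (T j) x a p.+1 by split.
have xb : at_height (T j) x b q.+1 by split.
have xns : ~ short x.
  move=> sx; have pha : p < h a by apply: hmaxa.
  have qhb : q < h b by apply: hmaxb => //; rewrite -xab.
  have [|h1 h2] := anc_upD (FT j) (m := h a - p.+1) xa xb; first by rewrite subnKC.
  rewrite subnKC // in h2.
  have [_ cha] := hcoh a la na; apply: ne; rewrite h2; congr anc.
  by apply: cha => //; rewrite h2; split.
(* If the lines meet beneath the old roots, the leaves are in different trees of [T i0] and strength
   applies again; homogeneity only concerns a meeting node that belongs to [T i0]. *)
have [pd|pd] := ltnP p (depth (T i0) a); last first.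
  apply: rtP => e.
  have ra : at_height (T j) (anc (T i0) a (depth (T i0) a)) a (depth (T i0) a).
    by split=> //; exact: eai.
  have rb : at_height (T j) (anc (T i0) a (depth (T i0) a)) b (depth (T i0) b).
    by split=> //; rewrite ebi.
  have [|h1 h2] := anc_upD (FT j) (m := p - depth (T i0) a) ra rb; first by rewrite subnKC // ltnW.
  have [|h3 h4] := anc_upD (FT j) (m := p.+1 - depth (T i0) a) ra rb; first by rewrite subnKC // leqW.
  rewrite subnKC // in h2; rewrite subnKC in h4; last exact: leqW.
  have xb' : at_height (T j) x b (depth (T i0) b + (p.+1 - depth (T i0) a)) by split=> //; rewrite -h4.
  have := anc_inj (FT j) xb xb' => eq; apply: yab; rewrite h2; congr anc; lia.
have xi : in_forest (T i0) x by exists a, p.+1; split=> //; rewrite -eai.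
have xna k r : at_height (T j) x k r -> n <= k -> exists r',
    [/\ r = r'.+1, at_height (T j) (anc (T j) k r') k r', child (T j) n1 x (anc (T j) k r')
       & L (anc (T j) k r') k].
  move=> xk nk; case: r => [|r] in xk *.
    have ea : a = k by have [lk _ ek] := xk; apply: (anc_leaf (FT j) lk (p := p.+1)); split=> //; rewrite ek.
    by have := anc_inj (FT j) xa (q := 0); rewrite ea => /(_ xk).
  have [lk rk ek] := xk; exists r; split=> //; first by split=> //; exact: ltnW.
    by exists k, r; split=> //; lia.
  have xk0 := refines_in_forest (p := r.+1) R lk ltac:(lia) rk; rewrite ek in xk0.
  have [lki rki eki] := xk0 xi; exists r; split=> //; first exact: ltnW.
  by have [_ _ -> //] := R k lk ltac:(lia); exact: ltnW.
have [_ [[<-] _ cha Lya]] := xna a p.+1 xa na.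
have [_ [[<-] _ chb Lyb]] := xna b q.+1 xb nb.
rewrite -/ya in cha Lya; rewrite -/yb in chb Lyb.
have hom1 y y' z z' : child (T j) n1 x y -> child (T j) n1 x y' -> child (T j) n1 x z ->
    child (T j) n1 x z' -> y <> y' -> z <> z' ->
    (c1 [set y; y'] -> c1 [set z; z']) /\ (c2 [set y; y'] -> c2 [set z; z']).
  move=> cy cy' cz cz' yy zz; have := hom x y y' z z' xi cy cy' cz cz' yy zz => -[e1 e2].
  by split=> ?; apply/asboolP; rewrite -?e1 -?e2; apply/asboolP.
(* One pair of siblings with [c1] would give [c1] for all pairs and make [x] short. *)
have nc1 y y' : child (T j) n1 x y -> child (T j) n1 x y' -> y <> y' -> ~ c1 [set y; y'].
  move=> cy cy' yy c1y; apply: xns => u v r s xu xv nu nv.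
  have [r' [_ _ cu Lu]] := xna u r xu nu; have [s' [_ _ cv Lv]] := xna v s xv nv.
  set zu := anc (T j) u r' in cu Lu; set zv := anc (T j) v s' in cv Lv.
  have [zz|zz] := pselect (zu = zv); last first.
    by have [/(_ c1y)h1 _] := hom1 _ _ _ _ cy cy' cu cv yy zz; apply: (h1 zu zv); [left|right| |].
  (* Both leaves may lie above the same child; [c1] of a pair covers this case once a second child
     is at hand. *)
  have [z cz zuz] : exists2 z, child (T j) n1 x z & zu <> z.
    have [e|] := pselect (zu = ya); last by exists ya.
    by exists yb => //; rewrite e.
  have [/(_ c1y)h1 _] := hom1 _ _ _ _ cy cy' cu cz yy zuz.
  by apply: (h1 zu zu) => //; [left|left|rewrite zz].
have [E EP] := br a p la ltac:(lia) pa.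
pose al m := (E m).1; pose y m := anc (T j) (al m) (E m).2.
have alP m : m < 4 -> [/\ n1 <= al m /\ n2 <= al m, leaf (T j) (al m), at_height (T j) (y m) (al m) (E m).2,
    (E m).2 < depth (T j) (al m) & anc (T j) (al m) (E m).2.+1 = x].
  move=> m4; have [lm pm em _] := EP m m4.
  have xm : at_height (T j) x (al m) (E m).2.+1 by split.
  have : maxn (maxn n0 n1) (maxn n2 n3) <= al m.
    by apply: (far a) => //; [lia|exact: (same_root (FT j) xa xm)].
  by rewrite !geq_max => /andP[/andP[_ ->] /andP[-> _]]; split=> //; split=> //; exact: ltnW.
have chP m : m < 4 -> child (T j) n1 x (y m).
  by move=> /alP[[? ?] ? ? ? ?]; exists (al m), (E m).2.
have alT m : m < 4 -> [/\ at_height (T i0) (y m) (al m) (E m).2,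
    (E m).2 < depth (T i0) (al m) & anc (T i0) (al m) (E m).2.+1 = x].
  move=> /alP[[_ n2m] lm ym dm xm]; have [lmi _ em _] := R (al m) lm n2m.
  have := refines_in_forest R lm n2m dm; rewrite xm => /(_ xi)[_ d' e'].
  by split=> //; split=> //; [exact: ltnW|rewrite -em //; exact: ltnW].
have y_inj l m : l < 4 -> m < 4 -> y l = y m -> l = m.
  by move=> l4 m4 e; have [_ _ _] := EP l l4; apply.
have al_inj l m : l < 4 -> m < 4 -> al l = al m -> l = m.
  move=> l4 m4 e; apply: y_inj => //; rewrite /y.
  have [_ ll _ dl xl] := alP l l4; have [_ lm _ dm xm] := alP m m4.
  have h1 : at_height (T j) x (al l) (E l).2.+1 by split.
  have h2 : at_height (T j) x (al l) (E m).2.+1 by rewrite e; split.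
  by have [->] := anc_inj (FT j) h1 h2; rewrite e.
have [s [s4 smono]] := sorted_reindexing al_inj.
have sep l m : l < m -> m < 4 -> forall u v, L (y (s l)) u -> L (y (s m)) v -> u < v.
  move=> lm m4 u v [pu yu] [pv yv].
  have [h1 d1 x1] := alT (s l) (s4 l (ltn_trans lm m4)).
  have [h2 d2 x2] := alT (s m) (s4 m m4).
  apply: (siblings_separated (FT i0) h1 d1 x1 h2 d2 x2 _ (smono l m lm m4) yu yv).
  move=> /(y_inj _ _ (s4 l (ltn_trans lm m4)) (s4 m m4)) e.
  by have := smono l m lm m4; rewrite e ltnn.
have y_neq l m : l < m -> m < 4 -> y (s l) <> y (s m).
  move=> lm m4 /(y_inj _ _ (s4 l (ltn_trans lm m4)) (s4 m m4)) e.
  by have := smono l m lm m4; rewrite e ltnn.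
(* Failure of [c1] for the two middle children gives [u] and [v] with [f u < v]. Leaves [w] of the
   first child and [t] of the last satisfy [w < u] and [v < t], so [f w <= f u < v < t]: the outer
   pair has [c2]. This is why four children are taken. *)
have [u [v [Lu Lv fuv]]] : exists u v,
    [/\ (L (y (s 1)) `|` L (y (s 2))) u, (L (y (s 1)) `|` L (y (s 2))) v & f u < v].
  apply: contrapT => no; apply: (nc1 (y (s 1)) (y (s 2))); [exact/chP/s4|exact/chP/s4|exact: y_neq|].
  move=> z z' u v Pz Pz' Lu Lv; rewrite leqNgt; apply/negP => lt; apply: no; exists u, v.
  by split=> //; [case: Pz Lu => ->|case: Pz' Lv => ->]; [left|right|left|right].
have c2y : c2 [set y (s 0); y (s 3)].
  move=> z z' w t [->|->] [->|->] zz Lw Lt wt //.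
    have wu : w < u by case: Lu; apply: sep Lw.
    have vt : v < t by case: Lv => Lv; apply: sep Lv Lt.
    by apply: leq_trans (fmono _ _ (ltnW wu)) (ltnW (ltn_trans fuv vt)).
  by have := sep 0 3 isT isT _ _ Lt Lw; lia.
have [_ /(_ c2y)c2ab] := hom1 _ _ _ _ (chP _ (s4 0 isT)) (chP _ (s4 3 isT)) cha chb (y_neq 0 3 isT isT) yab.
by apply: (c2ab ya yb) => //; [left|right].
Qed.

End GrowthOfFronts.

(** * Finite trees and creatures *)

Lemma finite_maximal T (A : set T) (R : T -> T -> Prop) :
  finite_set A -> A !=set0 -> (forall x, ~ R x x) ->
  (forall x y z, R x y -> R y z -> R x z) ->
  exists2 x, A x & forall y, A y -> ~ R x y.
Proof.
elim/Pchoice: T => T in A R *; move=> /finite_seqP[s ->] + irr tr.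
elim: s => [|a s IH]; first by move=> [x].
move=> _; have [[x xs]|no] := pselect ([set` s] !=set0); last first.
  exists a => /=; first exact: mem_head.
  move=> y; rewrite inE => /orP[/eqP->|ys]; first exact: irr.
  by case: no; exists y.
have [m ms mmax] := IH (ex_intro _ x xs).
have [ma|nma] := pselect (R m a).
  exists a => /=; first exact: mem_head.
  move=> y; rewrite inE => /orP[/eqP->|ys ay]; first exact: irr.
  exact: mmax ys (tr _ _ _ ma ay).
exists m => /=; first by rewrite inE ms orbT.
by move=> y; rewrite inE => /orP[/eqP->//|/mmax].
Qed.

Lemma card_enum T (x0 : T) (A : set T) m M : A #= `I_m -> M <= m ->
  exists nu : nat -> T, forall i, i < M -> A (nu i) /\ forall j, j < M -> nu i = nu j -> i = j.
Proof.
move=> /card_bijP[f [g _ gK]] Mm.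
exists (fun i => if pselect (`I_m i) is left h then set_val (g (SigSub (mem_set h))) else x0).
move=> i iM; case: pselect => [im|]; last by rewrite /= (leq_trans iM Mm).
split=> [|j jM]; first exact: set_valP.
case: pselect => [jm|]; last by rewrite /= (leq_trans jM Mm).
by move=> /val_inj/(can_inj gK)/(congr1 val).
Qed.

Lemma nmaxP (A : set nat) a B : A a -> (forall b, A b -> b <= B) ->
  A (nmax A) /\ forall b, A b -> b <= nmax A.
Proof.
move=> Aa AB; have exA : exists n, `[< A n >] by exists a; apply/asboolP.
have [m /asboolP Am mP] := ex_maxnP exA (fun b h => AB b (asboolW h)).
rewrite /nmax; case: xgetP => [x _ [Ax xP]|/(_ m)[]] //.
by split=> // b Ab; apply: mP; apply/asboolP.
Qed.

Lemma finite_nat_bounded (A : set nat) : finite_set A -> exists B, forall a, A a -> a <= B.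
Proof.
move=> /finite_seqP[s ->]; exists (\max_(i <- s) i) => a /= sa.
exact: (@leq_bigmax_seq _ s xpredT id a sa isT).
Qed.

Section FiniteTrees.
Variables (V : Type) (T : poset V).
Hypothesis TT : is_tree T.
Implicit Types x y z : node V.

Lemma tree_finite : finite_set (nodes T). Proof. by case: TT => -[]. Qed.

Lemma ple_nodes x y : ple T x y -> nodes T x /\ nodes T y.
Proof. by case: TT => -[h1 h2 h3 h4 h5] _ _; exact: h2. Qed.

Lemma ple_refl x : nodes T x -> ple T x x.
Proof. by case: TT => -[h1 h2 h3 h4 h5] _ _; exact: h3. Qed.

Lemma ple_anti x y : ple T x y -> ple T y x -> x = y.
Proof. by case: TT => -[h1 h2 h3 h4 h5] _ _; exact: h4. Qed.

Lemma ple_trans x y z : ple T x y -> ple T y z -> ple T x z.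
Proof. by case: TT => -[h1 h2 h3 h4 h5] _ _; exact: h5. Qed.


Lemma ple_total x y z : ple T x z -> ple T y z -> ple T x y \/ ple T y x.
Proof. by case: TT => _ _; exact. Qed.

Lemma plt_trans x y z : plt T x y -> plt T y z -> plt T x z.
Proof.
move=> [xy nxy] [yz nyz]; split; first exact: ple_trans yz.
by move=> e; apply: nxy; apply: ple_anti xy _; rewrite e.
Qed.

Lemma plt_ple_trans x y z : plt T x y -> ple T y z -> plt T x z.
Proof.
move=> [xy nxy] yz; split; first exact: ple_trans yz.
by move=> e; apply: nxy; apply: ple_anti xy _; rewrite e.
Qed.

Lemma succ_parent_unique x y z : succ T y x -> succ T z x -> y = z.
Proof.
move=> [[yx nyx] ny] [[zx nzx] nz].
have [yz|zy] := ple_total yx zx.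
  by apply: contrapT => ne; apply: ny; exists z.
by apply: contrapT => ne; apply: nz; exists y; split=> //; split=> // e; apply: ne.
Qed.

Lemma plt_succ x y : plt T x y -> exists2 z, succ T x z & ple T z y.
Proof.
move=> xy; have [_ Ty] := ple_nodes xy.1.
have [||u w|u v w|z [xz zy] zmin] :=
    @finite_maximal _ [set z | plt T x z /\ ple T z y] (fun u v => plt T v u).
- by apply: sub_finite_set tree_finite => z [_ /ple_nodes[]].
- by exists y; split=> //; exact: ple_refl.
- by case: w.
- by move=> vu wv; exact: plt_trans vu.
exists z => //; split=> // -[w [xw wz]]; apply: (zmin w) (wz).
by split=> //; exact: ple_trans (wz).1 zy.
Qed.

Lemma ext_above x : nodes T x -> exists2 e, ext T e & ple T x e.
Proof.
move=> Tx; have [||u w|u v w|e xe emax] :=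
    @finite_maximal _ [set z | ple T x z] (plt T).
- by apply: sub_finite_set tree_finite => z /ple_nodes[].
- by exists x; exact: ple_refl.
- by case: w.
- exact: plt_trans.
exists e => //; split=> [|[y ey]]; first by have [] := ple_nodes xe.
by apply: (emax y) (ey); exact: ple_trans xe (ey).1.
Qed.

Lemma ext_ple x y : ext T x -> ple T x y -> x = y.
Proof. by move=> [_ nx] xy; apply: contrapT => ne; apply: nx; exists y. Qed.

End FiniteTrees.

(** * The forest of a zoo *)

Section ZooForest.
Variable V : Type.
Implicit Types (s t : zoo V) (x y z : node V).

Definition is_parent s x y := exists n, succ (s n) y x.

(** A node without a parent is its own parent, so beyond the depth the ancestors of a leaf stay at
    the root. *)
Definition parent s x : node V :=
  if pselect (exists y, is_parent s x y) is left h then sval (cid h) else x.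

Definition ancestor s k p := iter p (parent s) (inl k).

Definition forest_of s : forest (node V) :=
  Forest (zext s) (fun k => nmin [set p | ~ exists y, is_parent s (ancestor s k p) y])
    (ancestor s).

Section OneZoo.
Variable s : zoo V.

Lemma zoo_is_creature n : is_creature (s n).
Proof. by have [] := zoo_creature (zooP s) n. Qed.

Lemma zoo_tree n : is_tree (s n).
Proof. by case: (zoo_is_creature n). Qed.

Lemma zoo_index n m x : nodes (s n) x -> nodes (s m) x -> n = m.
Proof.
move=> xn xm; apply: contrapT => /eqP nm.
have /trivIsetP/(_ n m I I nm) e := zoo_disjoint (zooP s).
by have : (nodes (s n) `&` nodes (s m)) x by []; rewrite e.
Qed.

Lemma zoo_leaf_exists n x : nodes (s n) x -> exists2 k, extN (s n) k & ple (s n) x (inl k).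
Proof.
move=> xn; have [e ee xe] := ext_above (zoo_tree n) xn.
have [_ sub _ _] := zoo_is_creature n; have [k _ ke] := sub _ ee.
by exists k; rewrite /extN /= ke.
Qed.

Lemma zoo_leaf_finite n : exists B, forall k, extN (s n) k -> k <= B.
Proof.
have fin : finite_set ((fun x : node V => if x is inl k then k else 0) @` nodes (s n)).
  exact/finite_image/tree_finite/zoo_tree.
have [B BP] := finite_nat_bounded fin; exists B => k [kn _]; apply: BP.
by exists (inl k).
Qed.

Lemma zoo_nonempty n : exists k, extN (s n) k.
Proof.
have [_ [r [rn _]] _] := zoo_tree n.
by have [k] := zoo_leaf_exists rn; exists k.
Qed.

Lemma zoo_leaf_ltS n a b : extN (s n) a -> extN (s n.+1) b -> a < b.
Proof.
move=> an bn; have [B BP] := zoo_leaf_finite n.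
have [_ maxP] := nmaxP an BP; have [_ minP] := nminP bn.
apply: leq_ltn_trans (maxP _ an) (leq_trans _ (minP _ bn)).
exact: zoo_increasing (zooP s) n.
Qed.

Lemma zoo_leaf_lt n m a b : n < m -> extN (s n) a -> extN (s m) b -> a < b.
Proof.
move=> /subnKC <-; elim: (m - n.+1) b => [|j IH] b an bm.
  by rewrite addn0 in bm; exact: zoo_leaf_ltS bm.
have [c cm] := zoo_nonempty (n.+1 + j).
by apply: ltn_trans (IH c an cm) (zoo_leaf_ltS cm _); rewrite addnS in bm.
Qed.

Lemma is_parentE n x y : nodes (s n) x -> is_parent s x y -> succ (s n) y x.
Proof.
move=> xn [m yx]; have [_ xm] := ple_nodes (zoo_tree m) yx.1.1.
by rewrite (zoo_index xn xm).
Qed.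

Lemma is_parent_unique x y z : is_parent s x y -> is_parent s x z -> y = z.
Proof.
move=> [n xy] [m xz].
have [_ xn] := ple_nodes (zoo_tree n) xy.1.1; have [_ xm] := ple_nodes (zoo_tree m) xz.1.1.
by rewrite -(zoo_index xn xm) in xz; exact: (succ_parent_unique (zoo_tree n) xy xz).
Qed.

Lemma parentE x y : is_parent s x y -> parent s x = y.
Proof.
move=> xy; rewrite /parent; case: pselect => [h|[]]; last by exists y.
by case: cid => z /= xz; exact: is_parent_unique xz xy.
Qed.

Section OneLeaf.
Variables (n k : nat).
Hypothesis kn : extN (s n) k.

Let TT := zoo_tree n.

Lemma ancestor_ple p : ple (s n) (ancestor s k p) (inl k).
Proof.
elim: p => [|p IH]; first by apply: (ple_refl TT); have [] := kn.
rewrite /ancestor /= -/(ancestor s k p) /parent; case: pselect => // h.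
case: cid => y /= py; have [pn _] := ple_nodes TT IH.
by have [[yp _] _] := is_parentE pn py; exact: (ple_trans TT yp IH).
Qed.

Lemma ancestor_node p : nodes (s n) (ancestor s k p).
Proof. by have [] := ple_nodes TT (ancestor_ple p). Qed.

Let d := depth (forest_of s) k.

Lemma depth_exists : exists p, ~ exists y, is_parent s (ancestor s k p) y.
Proof.
apply: contrapT => no.
have up p : plt (s n) (ancestor s k p.+1) (ancestor s k p).
  have [y py] : exists y, is_parent s (ancestor s k p) y.
    by apply: contrapT => h; apply: no; exists p.
  have [] := is_parentE (ancestor_node p) py.
  by rewrite /ancestor /= -/(ancestor s k p) (parentE py).
have ups p q : p < q -> plt (s n) (ancestor s k q) (ancestor s k p).
  elim: q => // q IH; rewrite ltnS leq_eqVlt => /orP[/eqP->//|/IH].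
  exact: (plt_trans TT).
apply: (finite_no_injection (tree_finite TT) ancestor_node) => p q e.
by case: (ltngtP p q) => // /ups[_ ne]; rewrite e in ne.
Qed.

Lemma depth_no_parent : ~ exists y, is_parent s (ancestor s k d) y.
Proof. by have [p pP] := depth_exists; exact: (@nminP [set p | ~ exists y, is_parent s (ancestor s k p) y] p pP).1. Qed.

Lemma ancestor_succ p : p < d -> succ (s n) (ancestor s k p.+1) (ancestor s k p).
Proof.
move=> pd; have [y py] : exists y, is_parent s (ancestor s k p) y.
  apply: contrapT => no; have [_ /(_ p no)] := @nminP [set p | ~ exists y, is_parent s (ancestor s k p) y] p no.
  by rewrite leqNgt pd.
by rewrite /ancestor /= -/(ancestor s k p) (parentE py); exact: is_parentE (ancestor_node p) py.
Qed.

Lemma ancestor_plt p q : p < q -> q <= d -> plt (s n) (ancestor s k q) (ancestor s k p).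
Proof.
elim: q => // q IH; rewrite ltnS leq_eqVlt => /orP[/eqP->|pq] qd.
  by have [] := ancestor_succ qd.
by apply: (plt_trans TT _ (IH pq (ltnW qd))); have [] := ancestor_succ qd.
Qed.

(** A maximal counterexample is not the leaf, and its successor towards the leaf is an ancestor of
    [k], whose parent it must be. *)
Lemma ple_ancestor x : ple (s n) x (inl k) -> exists2 p, p <= d & ancestor s k p = x.
Proof.
move=> xk; apply: contrapT => nx.
pose bad := [set y | ple (s n) y (inl k) /\ ~ exists2 p, p <= d & ancestor s k p = y].
have [||u w|u v w|y [yk ny] ymax] := @finite_maximal _ bad (plt (s n)).
- by apply: sub_finite_set (tree_finite TT) => z [/(ple_nodes TT)[]].
- by exists x.
- by case: w.
- exact: (plt_trans TT).
have yk' : plt (s n) y (inl k) by split=> // e; apply: ny; exists 0.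
have [z yz zk] := plt_succ TT yk'.
have [p pd pz] : exists2 p, p <= d & ancestor s k p = z.
  by apply: contrapT => nz; apply: (ymax z) (yz.1).
have pd' : p < d.
  rewrite ltn_neqAle pd andbT; apply/eqP => e; apply: depth_no_parent.
  by exists y, n; rewrite -e pz.
apply: ny; exists p.+1 => //; have := ancestor_succ pd'; rewrite pz => h.
exact: (succ_parent_unique TT h yz).
Qed.

Lemma ancestor_root : is_root (s n) (ancestor s k d).
Proof.
have [_ [r [rn rP]] _] := TT.
have [p pd pr] := ple_ancestor (rP _ kn.1).
suff e : p = d by rewrite -e pr.
apply/eqP; rewrite eqn_leq pd leqNgt; apply/negP => lt.
have [h1 h2] := ancestor_plt lt (leqnn _); apply: h2.
by apply: (ple_anti TT h1); rewrite pr; apply: rP; exact: ancestor_node.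
Qed.

Lemma at_heightP x : (exists p, at_height (forest_of s) x k p) <-> ple (s n) x (inl k).
Proof.
split=> [[p [_ _ <-]]|/ple_ancestor[p pd px]]; first exact: ancestor_ple.
by exists p; split=> //; exists n.
Qed.

End OneLeaf.

Lemma at_height_index x k p : at_height (forest_of s) x k p ->
  exists n, [/\ extN (s n) k, ple (s n) x (inl k) & nodes (s n) x].
Proof.
move=> xk; have [[n _ kn] _ _] := xk; exists n; split=> //.
  by apply/(at_heightP kn); exists p.
by case: xk => _ _ <-; exact: ancestor_node.
Qed.

Lemma ancestor_inner n k p : extN (s n) k -> p < depth (forest_of s) k ->
  inner (s n) (ancestor s k p.+1).
Proof.
move=> kn pd; split; first exact: ancestor_node.
by move=> [_]; apply; exists (ancestor s k p); have [] := ancestor_succ kn pd.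
Qed.

Lemma zoo_leaf_of n k : nodes (s n) (inl k) -> extN (s n) k.
Proof.
move=> kn; apply: contrapT => nk.
have [_ _ int0 _] := zoo_is_creature n.
suff : (inner (s n) `&` range inl) (inl k) by rewrite int0.
by split=> //; exists k.
Qed.

Lemma extN_cone n x k : ple (s n) x (inl k) -> extN (cone (s n) x) k.
Proof.
move=> xk; have [_ kn] := ple_nodes (zoo_tree n) xk.
split=> [|[y [[ky _ _] ne]]]; first by split.
by apply: ne; apply: (ext_ple _ ky); exact: zoo_leaf_of.
Qed.

Lemma cone_bounded n x : exists B, forall k, extN (cone (s n) x) k -> k <= B.
Proof.
have [B BP] := zoo_leaf_finite n; exists B => k [[kn _] _].
exact/BP/zoo_leaf_of.
Qed.

Lemma cone_separated n x y a b :
  nmax (extN (cone (s n) x)) < nmin (extN (cone (s n) y)) ->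
  ple (s n) x (inl a) -> ple (s n) y (inl b) -> a < b.
Proof.
move=> xy /extN_cone xa /extN_cone yb; have [B BP] := cone_bounded n x.
have [_ h1] := nmaxP xa BP; have [_ h2] := nminP yb.
by apply: leq_ltn_trans (h1 _ xa) (leq_trans xy _); exact: h2.
Qed.

Lemma forest_of_zoo : is_forest (forest_of s).
Proof.
have inj x k p q : at_height (forest_of s) x k p -> at_height (forest_of s) x k q -> p = q.
  move=> [[n _ kn] pd ep] [_ qd eq].
  case: (ltngtP p q) => // lt.
    by have [_ []] := ancestor_plt kn lt qd; rewrite [LHS]eq -ep.
  by have [_ []] := ancestor_plt kn lt pd; rewrite [LHS]ep -eq.
split=> //.
- move=> x k p k' p' xk xk' pd.
  have [n [kn _ xn]] := at_height_index xk; have [m [km _ xm]] := at_height_index xk'.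
  have [_ _ ep] := xk; have [_ pd' ep'] := xk'.
  have epp : ancestor s k p = ancestor s k' p' by rewrite [LHS]ep -ep'.
  split; last exact: (congr1 (parent s) epp).
  rewrite ltn_neqAle pd' andbT; apply/eqP => e; apply: (depth_no_parent km).
  exists (ancestor s k p.+1), n; have := ancestor_succ kn pd.
  by rewrite epp e.
- move=> k k' p [n _ kn] xk'; have [m [km xk xm]] := at_height_index xk'.
  have nm := zoo_index kn.1 xm; rewrite -nm in xk.
  by have [] := ext_ple kn xk.
(* [b] lies in the creature of [a] and [c] because creatures are increasing. If [x] were not beneath
   [b], the two would be incomparable, [b] being maximal, and separation would put [b] before [a] or
   after [c]. *)
- move=> x a b c p q [m _ bm] ab bc xa xc.
  have [n [an pxa xn]] := at_height_index xa; have [n' [cn pxc xn']] := at_height_index xc.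
  have e := zoo_index xn xn'; rewrite -{n' xn'}e in cn pxc.
  have mn : m = n.
    case: (ltngtP m n) => // lt; first by have := zoo_leaf_lt lt bm an; rewrite ltnNge ab.
    by have := zoo_leaf_lt lt cn bm; rewrite ltnNge bc.
  rewrite mn in bm; apply/(at_heightP bm); apply: contrapT => nxb.
  have [_ _ _ sep] := zoo_is_creature n.
  have bb := ple_refl (zoo_tree n) bm.1.
  case: (sep x (inl b) xn bm.1 nxb) => [bx|lt|lt].
  + by apply: nxb; rewrite -(ext_ple bm bx).
  + by have := cone_separated lt pxc bb; rewrite ltnNge bc.
  + by have := cone_separated lt bb pxa; rewrite ltnNge ab.
- move=> M; have [N0 normP] := zoo_norm_cvg (zooP s) M.
  have [k0 k0N] := zoo_nonempty N0; exists k0 => k p [n _ kn] k0k pd.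
  have Nn : N0 <= n.
    by rewrite leqNgt; apply/negP => lt; have := zoo_leaf_lt lt kn k0N; rewrite ltnNge k0k.
  set x := ancestor s k p.+1; have xi : inner (s n) x := ancestor_inner kn pd.
  have [m cm] : finite_set (succ (s n) x).
    by apply: sub_finite_set (tree_finite (zoo_tree n)) => y [[/(ple_nodes (zoo_tree n))[]]].
  have Mm : M <= m.
    apply: leq_trans (normP n Nn) _.
    have Pm : [set k | exists2 x, inner (s n) x & succ (s n) x #= `I_k] m by exists x.
    exact: (nminP Pm).2 _ Pm.
  have [nu nuP] := card_enum (inl 0) cm Mm.
  have /choice[e eP] i : exists u : nat * nat, i < M ->
      [/\ zext s u.1, u.2 < depth (forest_of s) u.1, ancestor s u.1 u.2.+1 = x & ancestor s u.1 u.2 = nu i].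
    have [iM|no] := boolP (i < M); last by exists (0, 0).
    have [nui _] := nuP i iM; have [_ nun] := ple_nodes (zoo_tree n) nui.1.1.
    have [l ln nul] := zoo_leaf_exists nun.
    have [q qd eq] := ple_ancestor ln nul.
    have ql : q < depth (forest_of s) l.
      rewrite ltn_neqAle qd andbT; apply/eqP => eqd; apply: (depth_no_parent ln).
      by exists x, n; rewrite -eqd eq.
    exists (l, q) => _; split=> //; first by exists n.
    by rewrite [LHS](_ : _ = parent s (ancestor s l q)) // eq; apply: parentE; exists n.
  exists e => i iM; have [e1 e2 e3 e4] := eP i iM; split=> // j jM.
  by have [_ _ _ /= ->] := eP j jM; rewrite /= e4; apply: (nuP i iM).2.
- move=> x; have [[k [p xk]]|no] := pselect (in_forest (forest_of s) x); last first.
    by exists 0 => k p xk; case: no; exists k, p.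
  have [n [_ _ xn]] := at_height_index xk; have [B BP] := zoo_leaf_finite n.
  exists B => l q xl; have [m [lm _ xm]] := at_height_index xl; apply: BP.
  by rewrite (zoo_index xn xm).
- elim=> [|n [k [m _ km] nk]].
    by have [k k0] := zoo_nonempty 0; exists k => //; exists 0.
  have [l lm] := zoo_nonempty m.+1; exists l; first by exists m.+1.
  exact: leq_ltn_trans nk (zoo_leaf_lt (ltnSn m) km lm).
Qed.

End OneZoo.
End ZooForest.

(** * Refinements and branches of zoos read off their forests *)

Section ZooRelations.
Variable V : Type.
Implicit Types (s t : zoo V) (x y z : node V).

Lemma in_forest_znodes s x : in_forest (forest_of s) x <-> znodes s x.
Proof.
split=> [[k [p xk]]|[n _ xn]].
  by have [n [_ _ xn]] := at_height_index xk; exists n.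
have [k kn xk] := zoo_leaf_exists xn.
by have [p xp] := (at_heightP kn x).2 xk; exists k, p.
Qed.

Lemma child_succ s m x y : child (forest_of s) m x y ->
  exists n, [/\ succ (s n) x y, inner (s n) x & nodes (s n) x].
Proof.
move=> [k [p [[n _ kn] _ pd <- <-]]]; exists n; split.
- exact: ancestor_succ.
- exact: ancestor_inner.
- exact: ancestor_node.
Qed.

(** Let [y] be the last node of [T] at or beneath [x]. Its successor in [T] towards the leaf is a
    direct successor in [S] as well, so it cannot jump over [x]. *)
Lemma subtree_down T S x k : is_tree S -> is_tree T -> subtree T S ->
  nodes T (inl k) -> ple S x (inl k) -> nodes T x.
Proof.
move=> TS TT [sub eT [r [rS rP] rT] sT] kT xk.
have pleT u v : ple T u v <-> [/\ ple S u v, nodes T u & nodes T v].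
  by have -> : ple T u v = ple (induced S (nodes T)) u v by rewrite -eT.
have [_ kS] := ple_nodes TS xk; have [xS _] := ple_nodes TS xk.
have [||u w|u v w|y [yT yx] ymax] :=
    @finite_maximal _ [set y | nodes T y /\ ple S y x] (plt S).
- by apply: sub_finite_set (tree_finite TS) => y [/sub].
- by exists r; split=> //; exact: rP.
- by case: w.
- exact: (plt_trans TS).
have [->//|nyx] := pselect (x = y).
have yx' : plt S y x by split=> // e; apply: nyx.
have yS : inner S y by split; [exact: sub|move=> [_]; apply; exists x].
have yk : plt T y (inl k).
  have [h1 h2] := plt_ple_trans TS yx' xk.
  by split=> //; apply/pleT.
have [z yz /pleT[zk zT _]] := plt_succ TT yk.
have [_ /(_ _ yz)[yz' nyz]] := sT y yT yS.
have [xz|zx] := ple_total TS xk zk; last by case: (ymax z).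
have [-> //|nxz] := pselect (x = z).
by case: nyz; exists x.
Qed.

(** A leaf [k] of [t] lies in some [S' k0], which keeps the line of [k] in [s k0], so the ancestors
    agree up to the old root. An ancestor beyond it is either an inner node of the recipe, foreign
    to [s] by disjointness, or a node of some [S' k1] strictly beneath the root of [s k0]; the
    latter forces [k1 = k0] and is impossible. *)
Lemma zleq_refines t s : zleq t s -> refines_from 0 (forest_of t) (forest_of s).
Proof.
move=> [R [recR [S' [subS _ nodesE coneE _]]] disj] k [n _ kn] _.
have inlR m j : ~ inner (R m) (inl j).
  move=> h; have [_ _ e _] := recipe_creature recR m.
  suff : (inner (R m) `&` range inl) (inl j) by rewrite e.
  by split=> //; exists j.
have extR m j : extN (R m) j -> (\bigcup_n extN (R n)) j by exists m.
have [k0 k0n kS'] : exists2 k0, extN (R n) k0 & nodes (S' k0) (inl k).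
  by have := kn.1; rewrite nodesE => -[/inlR//|[k0 k0n kS']]; exists k0.
have pleS' j m x y : extN (R m) j -> nodes (S' j) x -> ple (t m) x y <-> ple (S' j) x y.
  move=> jm xj; have e := coneE m j x jm xj.
  have [cS' _] := subS j (extR m j jm); have TS' : is_tree (S' j) by case: cS'.
  split=> h.
    have : nodes (cone (t m) x) y by split=> //; have [] := ple_nodes (zoo_tree t m) h.
    by rewrite e => -[].
  have : nodes (cone (S' j) x) y by split=> //; have [] := ple_nodes TS' h.
  by rewrite -e => -[].
have pleS j x y : (\bigcup_n extN (R n)) j ->
    ple (S' j) x y <-> [/\ ple (s j) x y, nodes (S' j) x & nodes (S' j) y].
  move=> /subS[_ [_ eT _ _]].
  by have -> : ple (S' j) x y = ple (induced (s j) (nodes (S' j))) x y by rewrite -eT.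
have [cS' subk0] := subS k0 (extR n k0 k0n); have TS' : is_tree (S' k0) by case: cS'.
have subn j x : (\bigcup_n extN (R n)) j -> nodes (S' j) x -> nodes (s j) x.
  by move=> /subS[_ [sub _ _ _]]; exact: sub.
have ks : extN (s k0) k by apply: zoo_leaf_of; exact: subn (extR _ _ k0n) kS'.
have down x : ple (s k0) x (inl k) -> nodes (S' k0) x.
  exact: subtree_down (zoo_tree s k0) TS' subk0 kS'.
have par p : p < depth (forest_of s) k -> is_parent t (ancestor s k p) (ancestor s k p.+1).
  move=> pd; have [[h1 h2] h3] := ancestor_succ ks pd.
  have yS := down _ (ancestor_ple ks p.+1); have xS := down _ (ancestor_ple ks p).
  exists n; split.
    by split=> //; apply/(pleS' k0) => //; apply/(pleS _ _ _ (extR _ _ k0n)).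
  move=> [z [[/(pleS' k0 n _ _ k0n yS) yz nyz] [zx nzx]]].
  have /(pleS _ _ _ (extR _ _ k0n))[yz' _ zS] := yz.
  apply: h3; exists z; split; first by [].
  by move: zx => /(pleS' k0 n _ _ k0n zS)/(pleS _ _ _ (extR _ _ k0n))[].
have ancE p : p <= depth (forest_of s) k -> ancestor t k p = ancestor s k p.
  elim: p => // p IH pd; rewrite [LHS](_ : _ = parent t (ancestor t k p)) //.
  by rewrite IH ?(ltnW pd) // (parentE (par p pd)).
have dd : depth (forest_of s) k <= depth (forest_of t) k.
  rewrite leqNgt; apply/negP => lt; apply: (depth_no_parent kn).
  exists (ancestor s k (depth (forest_of t) k).+1).
  by rewrite ancE ?(ltnW lt) //; exact: par.
split=> //; first by exists k0.
move=> p dp pd /in_forest_znodes[m _ zm].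
set z := anc (forest_of t) k p in zm.
have rtE : ancestor t k (depth (forest_of s) k) = ancestor s k (depth (forest_of s) k) by exact: ancE.
have [rS rP] := ancestor_root ks.
have [zr nzr] := ancestor_plt kn dp pd.
rewrite rtE in zr nzr.
have := ancestor_node kn p; rewrite nodesE => -[zR|[k1 k1n zS]].
  suff : (\bigcup_n inner (R n) `&` zinner s) z by rewrite disj.
  split; first by exists n.
  exists m => //; split=> // ze.
  have [_ sub _ _] := zoo_is_creature s m; have [j _ jz] := sub _ ze.
  by apply: (inlR n j); rewrite jz.
have /(pleS _ _ _ (extR _ _ k1n))[zr' _ rS'] := (pleS' k1 n _ _ k1n zS).1 zr.
have e : k1 = k0 by apply: zoo_index rS; exact: subn (extR _ _ k1n) rS'.
rewrite e in zr' zS.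
apply: nzr; apply: (ple_anti (zoo_tree s k0) zr'); apply: rP.
by apply: subn (extR _ _ k0n) zS.
Qed.

Definition forest_tail_eq m (T S : forest (node V)) := forall k, m <= k ->
  (leaf T k <-> leaf S k) /\
  (leaf T k -> depth T k = depth S k /\ forall p, anc T k p = anc S k p).

Lemma same_creature_forest s t n m k : s n = t m -> extN (s n) k ->
  depth (forest_of s) k = depth (forest_of t) k /\ forall p, ancestor s k p = ancestor t k p.
Proof.
move=> e kn; have km : extN (t m) k by rewrite -e.
have parE x y : nodes (s n) x -> is_parent s x y <-> is_parent t x y.
  move=> xn; split=> [/(is_parentE xn)|] h; first by exists m; rewrite -e.
  by exists n; rewrite e; apply: is_parentE h; rewrite -e.
have ancE p : ancestor s k p = ancestor t k p.
  elim: p => // p IH; have pn := ancestor_node kn p.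
  rewrite [LHS](_ : _ = parent s (ancestor s k p)) // [RHS](_ : _ = parent t (ancestor t k p)) // -IH.
  have [[y py]|no] := pselect (exists y, is_parent s (ancestor s k p) y).
    by rewrite (parentE py) (parentE ((parE _ _ pn).1 py)).
  rewrite /parent; case: pselect => // _; case: pselect => // h.
  by case: no; have [y /(parE _ _ pn) py] := h; exists y.
split=> //; congr nmin; apply/seteqP; split=> p /= np [y py]; apply: np; exists y.
  by apply/parE; [exact: ancestor_node|rewrite ancE].
by rewrite -ancE; apply/parE => //; exact: ancestor_node.
Qed.

(** Indices of creatures shift under [zeqs], leaves do not; any leaf of the first common creature
    serves as the bound. *)
Lemma zeqs_forest s t : zeqs s t -> exists m, forest_tail_eq m (forest_of s) (forest_of t).
Proof.
move=> [n0 [k0 e]]; have [m mn] := zoo_nonempty s n0; exists m => k mk.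
have mk0 : extN (t k0) m by have := e 0; rewrite !addn0 => <-.
have idx n : extN (s n) k -> exists2 j, s n = t j & extN (t j) k.
  move=> kn; have n0n : n0 <= n.
    by rewrite leqNgt; apply/negP => lt; have := zoo_leaf_lt lt kn mn; rewrite ltnNge mk.
  by exists (k0 + (n - n0)); rewrite -?e subnKC.
have idx' n : extN (t n) k -> exists j, extN (s j) k.
  move=> kn; have n0n : k0 <= n.
    by rewrite leqNgt; apply/negP => lt; have := zoo_leaf_lt lt kn mk0; rewrite ltnNge mk.
  by exists (n0 + (n - k0)); rewrite e subnKC.
split; first split.
- by move=> [n _ /idx[j _ kj]]; exists j.
- by move=> [n _ /idx'[j kj]]; exists j.
- by move=> [n _ kn]; have [j ej kj] := idx n kn; exact: same_creature_forest ej kn.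
Qed.

Lemma zleqs_refines t s : zleqs t s -> exists n, refines_from n (forest_of t) (forest_of s).
Proof.
move=> [t' /zeqs_forest[m tt'] /zleq_refines R]; exists m => k lk mk.
have [lE eqs] := tt' k mk; have lk' := lE.2 lk; have [dE aE] := eqs lk'.
have [h1 h2 h3 h4] := R k lk' isT.
rewrite -dE; split=> // [p pd|p dp pd]; first by rewrite -aE; exact: h3.
by rewrite -aE; exact: h4.
Qed.

Lemma forest_tail_child m t t' x y : forest_tail_eq m (forest_of t') (forest_of t) ->
  child (forest_of t) m x y -> child (forest_of t') m x y.
Proof.
move=> e [k [p [lk mk pd py px]]]; have [lE eqs] := e k mk.
have lk' := lE.2 lk; have [dE aE] := eqs lk'.
by exists k, p; split; rewrite ?dE ?aE.
Qed.

Definition line s k : set (node V) := [set x | exists p, at_height (forest_of s) x k p].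

Lemma lineE s n k x : extN (s n) k -> line s k x <-> ple (s n) x (inl k).
Proof. by move=> kn; exact: (at_heightP kn x). Qed.

(** The last node of a branch has a leaf above it, and the line of that leaf is a chain containing
    the branch. *)
Lemma zbranchP s b : zbranch s b <-> exists2 k, zext s k & b = line s k.
Proof.
have chain n k : extN (s n) k -> is_chain (s n) (line s k).
  move=> kn; split=> [x /(lineE _ kn)/(ple_nodes (zoo_tree s n))[] //|x y].
  by move=> /(lineE _ kn) xk /(lineE _ kn) yk; exact: (ple_total (zoo_tree s n) xk yk).
split=> [[n [[bn bch] bmax]]|[k [n _ kn] ->]]; last first.
  exists n; split; first exact: chain.
  move=> b' [b'n b'ch] sub; apply/seteqP; split=> // x b'x; apply/(lineE _ kn).
  have kl : b' (inl k) by apply: sub; apply/(lineE _ kn); apply: (ple_refl (zoo_tree s n)); case: kn.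
  have [//|kx] := b'ch _ _ b'x kl.
  by rewrite -(ext_ple kn kx); apply: (ple_refl (zoo_tree s n)); case: kn.
have TT := zoo_tree s n.
have b0 : b !=set0.
  apply/set0P/eqP => e; have [_ [r [rn _]] _] := TT.
  have : [set r] = b.
    apply: bmax; last by rewrite e.
    by split=> [_ ->//|_ _ -> ->]; left; exact: ple_refl.
  by rewrite e => /seteqP[/(_ r)] h _; exact: h.
have [||u w|u v w|m bm mmax] := @finite_maximal _ b (plt (s n)).
- exact: sub_finite_set (tree_finite TT).
- by [].
- by case: w.
- exact: (plt_trans TT).
have [k kn mk] := zoo_leaf_exists (bn _ bm); exists k; first by exists n.
apply/esym/bmax; first exact: chain.
move=> x bx; apply/(lineE _ kn); have [xm|mx] := bch _ _ bx bm.
  exact: (ple_trans TT xm).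
have [<-//|nmx] := pselect (m = x).
by case: (mmax x bx).
Qed.

Lemma line_inj s k k' : zext s k -> zext s k' -> line s k = line s k' -> k = k'.
Proof.
move=> [n _ kn] [m _ km] e.
have : line s k (inl k) by apply/(lineE _ kn); apply: (ple_refl (zoo_tree s n)); case: kn.
rewrite e => /(lineE _ km) kk'; have [kn' _] := ple_nodes (zoo_tree s m) kk'.
by have [->] := ext_ple (zoo_leaf_of kn') kk'.
Qed.

(** Branches correspond to leaves, and a set of leaves is finite exactly when it is bounded; this
    turns clauses about all but finitely many branches into clauses about large leaves. *)
Lemma almost_all_branches s (P : set (node V) -> Prop) :
  finite_set [set b | zbranch s b /\ ~ P b] <->
  eventually_on (forest_of s) [set k | P (line s k)].
Proof.
split=> [fin|[n nP]].
  have fin' : finite_set [set k | zext s k /\ ~ P (line s k)].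
    have e : line s @` [set k | zext s k /\ ~ P (line s k)] #= [set k | zext s k /\ ~ P (line s k)].
      by apply: inj_card_eq => k k' /set_mem[lk _] /set_mem[lk' _]; exact: line_inj.
    rewrite -(eq_finite_set e); apply: sub_finite_set fin => _ [k [lk nPk] <-].
    by split=> //; apply/zbranchP; exists k.
  have [B BP] := finite_nat_bounded fin'; exists B.+1 => k lk Bk.
  by apply: contrapT => nP; have := BP k (conj lk nP); rewrite leqNgt Bk.
apply: sub_finite_set (finite_image (line s) (finite_II n)) => b [/zbranchP[k lk ->] nPk].
by exists k => //=; rewrite ltnNge; apply/negP => nk; apply/nPk/nP.
Qed.

Lemma zroot_line s k : zext s k -> zroot s `&` line s k = [set ancestor s k (depth (forest_of s) k)].
Proof.
move=> [n _ kn]; have [rn rP] := ancestor_root kn; have TT := zoo_tree s n.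
apply/seteqP; split=> [x [[m [xm xP]] /(lineE _ kn) xk]|_ ->].
  have [xn _] := ple_nodes TT xk; have e := zoo_index xm xn; rewrite e in xP.
  by apply: (ple_anti TT); [exact: xP|exact: rP].
split; first by exists n; split.
by exists (depth (forest_of s) k); split=> //; exists n.
Qed.

End ZooRelations.

(** * Sufficiently generic sequences *)

Section SufficientlyGeneric.
Variables (V : Type) (d : Order.disp_t) (W : orderType d) (s : W -> zoo V).
Hypothesis gen : sufficiently_generic s.
Implicit Types (F G : set (node V)) (x y z : node V) (i j : W) (h : nat -> nat).

Let T i := forest_of (s i).

Lemma zoo_generic_forests : generic_forests T.
Proof.
have refi i j : (i < j)%O -> exists n, refines_from n (T j) (T i).
  by move=> ij; exact/zleqs_refines/(generic_decreasing gen ij).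
split=> //.
- by move=> i; exact: forest_of_zoo.
- move=> i c; have [j ij [t' [/zeqs_forest[m e] _ hom]]] :=
    generic_homogeneous gen i (UnaryColoring c).
  exists j => //; exists m => x y y' /in_forest_znodes xi /(forest_tail_child e) cy.
  move=> /(forest_tail_child e) cy'.
  have [n [sy xn xN]] := child_succ cy; have [n' [sy' _ xN']] := child_succ cy'.
  by rewrite (zoo_index xN' xN) in sy'; exact: (hom n x).
- move=> i c; have [j ij [t' [/zeqs_forest[m e] _ hom]]] :=
    generic_homogeneous gen i (BinaryColoring c).
  exists j => //; exists m => x y y' z z' /in_forest_znodes xi.
  move=> /(forest_tail_child e)/child_succ[n [cy xn xN]].
  move=> /(forest_tail_child e)/child_succ[n1 [cy' _ /(zoo_index xN) e1]].
  move=> /(forest_tail_child e)/child_succ[n2 [cz _ /(zoo_index xN) e2]].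
  move=> /(forest_tail_child e)/child_succ[n3 [cz' _ /(zoo_index xN) e3]].
  rewrite -{}e1 -{}e2 -{}e3 in cy' cz cz' => yy zz.
  by apply: (hom n x) => //; [exists y, y'|exists z, z'].
- move=> i A; have [j ij [t' [/zeqs_forest[m e] _ hom]]] :=
    generic_homogeneous gen i (BranchColoring V (fun k => `[<A k>])).
  exists j; have [[k0 k0t Ak0]|no] := pselect (exists2 k, zext t' k & A k).
    left; exists m => k lk mk; have lk' := (e k mk).1.2 lk.
    by have := hom _ _ k0t lk' => e'; apply/asboolP; rewrite -e'; apply/asboolP.
  right; exists m => k lk mk Ak; have lk' := (e k mk).1.2 lk.
  by apply: no; exists k.
- move=> f fmono; have [i [N fN]] := generic_strong gen f.
  have [m mN] := zoo_nonempty (s i) N; exists i, m => a b [na _ an] [nb _ bn] ma ab ne.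
  have Nn : N <= na.
    by rewrite leqNgt; apply/negP => lt; have := zoo_leaf_lt lt an mN; rewrite ltnNge ma.
  have nn : na < nb.
    case: (ltngtP na nb) => // [lt|e].
      by have := zoo_leaf_lt lt bn an; lia.
    case: ne; rewrite -e in bn.
    have [r1 r1P] := ancestor_root an; have [r2 r2P] := ancestor_root bn.
    by apply: (ple_anti (zoo_tree (s i) na)); [exact: r1P|exact: r2P].
  have [B BP] := zoo_leaf_finite (s i) na.
  have [_ maxP] := nmaxP an BP.
  apply: leq_trans (fmono _ _ (maxP _ an)) (leq_trans (fN na Nn) _).
  have [c cn] := zoo_nonempty (s i) na.+1; have [_ minP] := nminP cn.
  case: (ltngtP na.+1 nb) => [lt|lt|e].
  + by apply: leq_trans (minP _ cn) (ltnW (zoo_leaf_lt lt cn bn)).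
  + by move: nn lt; lia.
  + by apply: minP; rewrite e.
- move=> i; have [j ij /almost_all_branches[n nP]] := generic_root gen i.
  exists j => //.
  have [m R] : exists m, refines_from m (T j) (T i).
    move: ij; rewrite le_eqVlt => /orP[/eqP->|]; last exact: refi.
    by exists 0 => k lk _; split=> // p /ltn_geF -> .
  exists (maxn n m) => k lk; rewrite geq_max => /andP[nk mk].
  have [lki dk ek _] := R k lk mk.
  suff : depth (T i) k < depth (T j) k by [].
  (* With equal depths the new root on the line of [k] would be the old one, which [front_lt]
     excludes. *)
  rewrite ltn_neqAle dk andbT; apply/eqP => e.
  have [x [y [ex ey _ ne]]] := nP k lk nk; apply: ne.
  have [n1 _ kn1] := lki; have [n2 _ kn2] := lk.
  have xy : ancestor (s j) k (depth (T j) k) = ancestor (s i) k (depth (T i) k).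
    by rewrite -e; exact: ek.
  have : [set y] y by [].
  rewrite -ey (zroot_line lk) => ->.
  suff : [set x] (ancestor (s j) k (depth (T j) k)) by [].
  rewrite -ex; split; first split.
  + by rewrite xy; exists n1; exact: ancestor_root.
  + by exists n2 => //; exact: ancestor_node.
  + by exists (depth (T j) k).
Qed.

Hypothesis W1 : is_omega1 W.
Variable U : set_system nat.
Hypothesis UE : forall P : set nat, U P <-> exists i : W, eventually_on (T i) P.

Let GT := zoo_generic_forests.
Let UU : UltraFilter U := generic_ultrafilter GT W1 UE.
#[local] Existing Instance UU.

Definition has_height i F h := eventually_on (T i)
  [set k | h k <= depth (T i) k /\ forall p, p <= depth (T i) k -> (F (anc (T i) k p) <-> p = h k)].

Lemma frontP i F : front (s i) F <-> F `<=` znodes (s i) /\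
  eventually_on (T i) [set k | exists x, F `&` line (s i) k = [set x]].
Proof.
have e := almost_all_branches (s i) (fun b => exists x, F `&` b = [set x]).
by split=> -[sub h]; split=> //; exact/e.
Qed.

Lemma has_height_line i F h k : leaf (T i) k -> h k <= depth (T i) k ->
  (forall p, p <= depth (T i) k -> (F (anc (T i) k p) <-> p = h k)) ->
  F `&` line (s i) k = [set anc (T i) k (h k)].
Proof.
move=> lk hk hP; apply/seteqP; split=> [x [Fx [p [_ pd ep]]]|_ ->].
  by rewrite -ep in Fx *; congr (anc _ _ _); exact/hP.
by split; [exact/hP|exists (h k)].
Qed.

Lemma has_height_front i F h : F `<=` znodes (s i) -> has_height i F h -> front (s i) F.
Proof.
move=> sub [n nP]; apply/frontP; split=> //; exists n => k lk nk.
by have [h1 h2] := nP k lk nk; exists (anc (T i) k (h k)); exact: has_height_line.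
Qed.

Lemma front_has_height i F : front (s i) F -> exists h, has_height i F h.
Proof.
move=> /frontP[sub [n nP]].
have /choice[h hP] k : exists p, leaf (T i) k -> n <= k -> p <= depth (T i) k /\
    forall q, q <= depth (T i) k -> (F (anc (T i) k q) <-> q = p).
  have [[lk nk]|no] := pselect (leaf (T i) k /\ n <= k); last by exists 0 => lk nk; case: no.
  have [x e] := nP k lk nk; have : [set x] x by [].
  rewrite -e => -[Fx [p [_ pd px]]]; exists p => _ _; split=> // q qd; split=> [Fq|->].
    have : (F `&` line (s i) k) (anc (T i) k q) by split=> //; exists q.
    rewrite e => qx; have xq : at_height (T i) x k q by split.
    have xp : at_height (T i) x k p by split.
    exact: (anc_inj (gf_forest GT i) xq xp).
  by rewrite px.
by exists h, n => k lk nk; exact: hP.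
Qed.

Lemma has_height_le i j F h : (i <= j)%O -> F `<=` znodes (s i) ->
  has_height i F h -> has_height j F h.
Proof.
move=> /(refines_le GT)[m R] sub [n nP]; exists (maxn m n) => k lk.
rewrite geq_max => /andP[mk nk]; have [lki dk ek _] := R k lk mk.
have [h1 h2] := nP k lki nk; split; first exact: leq_trans h1 dk.
move=> p pd; split=> [Fp|->]; last by rewrite ek //; apply/h2.
have /in_forest_znodes xi := sub _ Fp.
have [_ pi _] := refines_in_forest R lk mk pd xi.
by apply/h2 => //; rewrite -ek.
Qed.

Lemma has_height_unique i F h h' : has_height i F h -> has_height i F h' ->
  U [set k | h k = h' k].
Proof.
move=> H H'; apply/UE; exists i; have [n nP] := eventuallyI H H'; exists n => k lk nk.
by have [[h1 h2] [h3 h4]] := nP k lk nk; apply/h4 => //; apply/h2.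
Qed.

Lemma has_height_setI i F h : has_height i (F `&` znodes (s i)) h <-> has_height i F h.
Proof.
suff e k : leaf (T i) k -> forall p, p <= depth (T i) k ->
    ((F `&` znodes (s i)) (anc (T i) k p) <-> F (anc (T i) k p)).
  by split=> -[n nP]; exists n => k lk nk; have [h1 h2] := nP k lk nk; split=> // p pd;
    rewrite -h2 //; have := e k lk p pd; tauto.
move=> lk p pd; split=> [[]//|Fp]; split=> //; apply/in_forest_znodes.
by exists k, p; split.
Qed.

Lemma has_height_coherent i F h : has_height i F h -> front_height T h.
Proof.
move=> [n nP]; exists i, n => k lk nk; have [h1 h2] := nP k lk nk; split=> // k' p nk' [lk' pd ep].
have [h3 h4] := nP k' lk' nk'; apply/h4 => //.
by rewrite ep; apply/h2.
Qed.

Definition height_of F h := exists i, F `<=` znodes (s i) /\ has_height i F h.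

Lemma seq_front_height F : seq_front s F -> exists h, front_height T h /\ height_of F h.
Proof.
move=> [i Fi]; have [h hF] := front_has_height Fi; exists h.
by split; [exact: has_height_coherent hF|exists i; split=> //; case: Fi].
Qed.

Lemma front_height_front h : front_height T h -> exists2 F, seq_front s F & height_of F h.
Proof.
move=> [i [n ch]]; pose F x := exists k, [/\ leaf (T i) k, n <= k & anc (T i) k (h k) = x].
have sub : F `<=` znodes (s i).
  move=> _ [k [lk nk <-]]; apply/in_forest_znodes; exists k, (h k); split=> //.
  by have [] := ch k lk nk.
have hF : has_height i F h.
  exists n => k lk nk; have [h1 _] := ch k lk nk; split=> // p pd; split=> [[k' [lk' nk' e]]|->].
    by have [_] := ch k' lk' nk'; apply=> //; rewrite e.
  by exists k.
by exists F; [exists i; exact: has_height_front hF|exists i].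
Qed.

Lemma height_of_front F h : height_of F h -> exists i,
  [/\ front (s i) F, F `<=` znodes (s i) & has_height i F h].
Proof. by move=> [i [sub hF]]; exists i; split=> //; exact: has_height_front hF. Qed.

(** The relations on fronts quantify over the zoos in which [F] is a front, so the height function
    read off there has to agree modulo [U] with the one already chosen. *)
Lemma height_of_at i i1 F h : height_of F h -> front (s i1) F -> (i1 <= i)%O ->
  exists2 h1, has_height i (F `&` znodes (s i)) h1 & U [set k | h1 k = h k].
Proof.
move=> [i0 [sub hF]] F1 i1i; have [h1 h1F] := front_has_height F1; have [sub1 _] := F1.
exists h1; first by apply/has_height_setI; exact: (has_height_le i1i sub1 h1F).
have l1 : (i1 <= Order.max i0 i1)%O by rewrite le_max lexx orbT.
have l0 : (i0 <= Order.max i0 i1)%O by rewrite le_max lexx.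
exact: (has_height_unique (has_height_le l1 sub1 h1F) (has_height_le l0 sub hF)).
Qed.

Lemma height_of_common F G h g P : height_of F h -> height_of G g -> U P ->
  exists i1 i2 i, [/\ front (s i1) F /\ front (s i2) G, (i1 <= i)%O, (i2 <= i)%O,
    has_height i (F `&` znodes (s i)) h /\ has_height i (G `&` znodes (s i)) g
    & eventually_on (T i) P].
Proof.
move=> /height_of_front[i1 [F1 sub1 hF]] /height_of_front[i2 [G2 sub2 gG]] /UE[j ev].
pose i := Order.max (Order.max i1 i2) j.
have l1 : (i1 <= i)%O by rewrite !le_max lexx.
have l2 : (i2 <= i)%O by rewrite !le_max lexx orbT.
have l3 : (j <= i)%O by rewrite !le_max lexx orbT.
exists i1, i2, i; split=> //; last exact: (eventually_le GT l3).
by split; apply/has_height_setI; [exact: (has_height_le l1 sub1 hF)|exact: (has_height_le l2 sub2 gG)].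
Qed.

Lemma seq_front_le_height F G h g : height_of F h -> height_of G g ->
  (seq_front_le s F G <-> ule U h g).
Proof.
move=> hF gG; split=> [[i1 [i2 [i [[F1 G2] i1i i2i /almost_all_branches[n nP]]]]]|hg].
  have [h1 h1F eh] := height_of_at hF F1 i1i; have [g1 g1G eg] := height_of_at gG G2 i2i.
  have [n1 n1P] := h1F; have [n2 n2P] := g1G.
  have h1g1 : ule U h1 g1.
    apply/UE; exists i, (maxn n (maxn n1 n2)) => k lk; rewrite !geq_max => /andP[nk /andP[n1k n2k]] /=.
    have [h1k h1P] := n1P k lk n1k; have [g1k g1P] := n2P k lk n2k.
    have [x [y [ex ey yx]]] := nP k lk nk.
    rewrite (has_height_line lk h1k h1P) in ex; rewrite (has_height_line lk g1k g1P) in ey.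
    have ex' : anc (T i) k (h1 k) = x by have : [set x] x by []; rewrite -ex => ->.
    have ey' : anc (T i) k (g1 k) = y by have : [set y] y by []; rewrite -ey => ->.
    rewrite leqNgt; apply/negP => lt; have [m _ km] := lk.
    have [xy nxy] := ancestor_plt km lt h1k.
    have [m' yx'] := yx; have xm := ancestor_node km (h1 k).
    have [_ xm'] := ple_nodes (zoo_tree (s i) m') yx'.
    have e : m' = m by apply: zoo_index xm' _; rewrite -ex'.
    rewrite e -ex' -ey' in yx'.
    by apply: nxy; exact: (ple_anti (zoo_tree (s i) m) xy).
  by apply: filterS3 h1g1 eh eg => k /= a <- <-.
have [i1 [i2 [i [FG l1 l2 [h1F g1G] hgi]]]] := height_of_common hF gG hg.
exists i1, i2, i; split=> //; apply/almost_all_branches.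
have [n nP] := eventuallyI (eventuallyI h1F g1G) hgi; exists n => k lk nk.
have [[[h1 h2] [h3 h4]] h5] := nP k lk nk.
exists (anc (T i) k (h k)), (anc (T i) k (g k)); split; try exact: has_height_line.
have [m _ km] := lk; exists m; move: h5 => /=; rewrite leq_eqVlt => /orP[/eqP->|lt].
  by apply: (ple_refl (zoo_tree (s i) m)); exact: ancestor_node.
by have [] := ancestor_plt km lt h3.
Qed.

(** The leaves above a node are bounded, so the lines of large leaves avoid a finite symmetric
    difference. Conversely, if the heights agree from [n] on, the difference lies on the lines of
    leaves below [n], which are finitely many and finite. *)
Lemma seq_front_eq_height F G h g : height_of F h -> height_of G g ->
  (seq_front_eq s F G <-> U [set k | h k = g k]).
Proof.
move=> hF gG; split=> [[i1 [i2 [i [[F1 G2] i1i i2i fin]]]]|hg].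
  have [h1 h1F eh] := height_of_at hF F1 i1i; have [g1 g1G eg] := height_of_at gG G2 i2i.
  set F' := F `&` _ in fin h1F; set G' := G `&` _ in fin g1G.
  have [n1 n1P] := h1F; have [n2 n2P] := g1G.
  have /choice[b bP] x := anc_bounded (gf_forest GT i) x.
  have [B BP] := finite_nat_bounded (finite_image b fin).
  have e : U [set k | h1 k = g1 k].
    apply/UE; exists i, (maxn B.+1 (maxn n1 n2)) => k lk; rewrite !geq_max => /andP[Bk /andP[n1k n2k]] /=.
    have [h1k h1P] := n1P k lk n1k; have [g1k g1P] := n2P k lk n2k.
    apply/g1P => //; apply: contrapT => nG.
    have Fh : F' (anc (T i) k (h1 k)) by apply/h1P.
    have : k <= B.
      apply: leq_trans (bP (anc (T i) k (h1 k)) k (h1 k) _) _; first by split.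
      by apply: BP; exists (anc (T i) k (h1 k)) => //; left.
    by rewrite leqNgt Bk.
  by apply: filterS3 e eh eg => k /= a <- <-.
have [i1 [i2 [i [FG l1 l2 [h1F g1G] hgi]]]] := height_of_common hF gG hg.
exists i1, i2, i; split=> //.
have [n nP] := eventuallyI (eventuallyI h1F g1G) hgi.
have fin : finite_set (\bigcup_(k in `I_n) (anc (T i) k @` `I_(depth (T i) k).+1)).
  by apply: bigcup_finite => [|k _]; [exact: finite_II|apply: finite_image; exact: finite_II].
apply: sub_finite_set fin => x.
have small : znodes (s i) x -> (forall k p, leaf (T i) k -> n <= k -> p <= depth (T i) k -> anc (T i) k p <> x) ->
    (\bigcup_(k in `I_n) (anc (T i) k @` `I_(depth (T i) k).+1)) x.
  move=> /in_forest_znodes[k [p [lk pd px]]] no; exists k => /=.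
    by rewrite ltnNge; apply/negP => nk; apply: (no k p).
  by exists p => //=; rewrite ltnS.
have same k p : leaf (T i) k -> n <= k -> p <= depth (T i) k ->
    ((F `&` znodes (s i)) (anc (T i) k p) <-> (G `&` znodes (s i)) (anc (T i) k p)).
  move=> lk nk pd; have [[[h1 h2] [h3 h4]] /= h5] := nP k lk nk.
  by split=> [/(h2 _ pd) e|/(h4 _ pd) e]; [apply/h4|apply/h2]; rewrite ?e ?h5.
by move=> [[Fx nGx]|[Gx nFx]]; (apply: small; first by [case: Fx|case: Gx]) => k p lk nk pd e;
  [apply: nGx|apply: nFx]; rewrite -e; apply/(same k p); rewrite // e.
Qed.

End SufficientlyGeneric.

(** * Clones *)

Definition unary_op (f : nat -> nat) : operation := Op (fun x : 'I_1 -> nat => f (x ord0)).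

Section GrowthHull.
Variables (k : nat) (g : ('I_k.+1 -> nat) -> nat).

Definition box_max n := \max_(x : {ffun 'I_k.+1 -> 'I_n.+1}) g (fun i => x i).
(** The least growth function bounding [g] on every box; clones above [C_id] that contain the
    successor do not distinguish [g] from it. *)
Definition growth_hull n := maxn n.+1 (box_max n).

Lemma box_max_attained n : exists2 x : 'I_k.+1 -> nat, (forall i, x i <= n) & g x = box_max n.
Proof.
have [|x e] := @bigop.eq_bigmax {ffun 'I_k.+1 -> 'I_n.+1} (fun x => g (fun i => x i)).
  by apply/card_gt0P; exists [ffun=> ord0].
by exists (fun i => nat_of_ord (x i)) => // i; rewrite -ltnS.
Qed.

Lemma growth_hull_ge n x : (forall i, x i <= n) -> g x <= growth_hull n.
Proof.
move=> xn; apply: leq_trans (leq_maxr _ _).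
have -> : x = (fun i => [ffun i => inord (x i) : 'I_n.+1] i).
  by apply: funext => i; rewrite ffunE inordK // ltnS.
exact: (leq_bigmax [ffun i => inord (x i) : 'I_n.+1]).
Qed.

Lemma growth_hull_le n b : n < b -> (forall x, (forall i, x i <= n) -> g x <= b) ->
  growth_hull n <= b.
Proof.
move=> nb gb; rewrite geq_max nb; apply/bigmax_leqP => x _.
by apply: gb => i; rewrite -ltnS.
Qed.

Lemma growth_hull_growth : growth growth_hull.
Proof.
split=> [m n mn|n]; last exact: leq_maxl.
apply: growth_hull_le => [|x xm]; first exact: leq_ltn_trans mn (leq_maxl _ _).
by apply: growth_hull_ge => i; exact: leq_trans mn.
Qed.

End GrowthHull.

Lemma growth_hull_unary f : growth f -> growth_hull (fun x : 'I_1 -> nat => f (x ord0)) = f.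
Proof.
move=> [fmono fgt]; apply: funext => n; apply/eqP; rewrite eqn_leq; apply/andP; split.
  by apply: growth_hull_le => // x xn; exact: fmono.
exact: (@growth_hull_ge 0 (fun x => f (x ord0)) n (fun=> n)).
Qed.

Section Clones.
Variables (C : set operation).
Hypotheses (CC : is_clone C) (Cid : C_id `<=` C).

(** [F] returns the minimum of [g] and an extra argument, so it is in [C_id]; feeding it [f] as that
    argument returns [g]. *)
Lemma clone_down k (f g : ('I_k.+1 -> nat) -> nat) : C (Op f) ->
  (forall x, g x <= f x) -> C (Op g).
Proof.
move=> Cf gf.
pose F (y : 'I_k.+2 -> nat) := minn (g (fun i => y (lift ord0 i))) (y ord0).
have CF : C (Op F).
  apply: Cid; exists k.+1, F; split=> // y; apply: leq_trans (geq_minr _ _) _.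
  exact: leq_bigmax.
pose G (i : 'I_k.+2) := if unlift ord0 i is Some j then (fun x : 'I_k.+1 -> nat => x j) else f.
have CG i : C (Op (G i)).
  by rewrite /G; case: unliftP => [j _|_] //; exact: CC.1.
have := CC.2 _ _ F G CF CG; congr (C (Op _)); apply: funext => x.
rewrite /F /G unlift_none (_ : (fun i => _) = x); first exact/minn_idPl.
by apply: funext => i; rewrite liftK.
Qed.

Lemma clone_unary_comp f g : C (unary_op f) -> C (unary_op g) -> C (unary_op (f \o g)).
Proof.
by move=> Cf Cg; exact: (CC.2 _ _ (fun x => f (x ord0)) (fun=> fun x => g (x ord0)) Cf (fun=> Cg)).
Qed.

Lemma clone_max k (f g : ('I_k.+1 -> nat) -> nat) : C (Op f) -> C (Op g) ->
  C (Op (fun x => maxn (f x) (g x))).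
Proof.
move=> Cf Cg.
have CM : C (Op (fun y : 'I_2 -> nat => maxn (y ord0) (y ord_max))).
  apply: Cid; exists 1, (fun y : 'I_2 -> nat => maxn (y ord0) (y ord_max)).
  by split=> // y; rewrite geq_max !leq_bigmax.
pose G (i : 'I_2) := if i == ord0 then f else g.
have CG i : C (Op (G i)) by rewrite /G; case: ifP.
exact: (CC.2 _ _ _ G CM CG).
Qed.

Hypothesis CS : C (unary_op succn).

(** The maximum over a box is attained at a point with coordinates at most [n], so these coordinates
    are functions in [C_id]. In the other direction [g x] is bounded by the hull at the maximum of
    the arguments, and [clone_down] applies. *)
Lemma clone_growth_hull k (g : ('I_k.+1 -> nat) -> nat) :
  C (Op g) <-> C (unary_op (growth_hull g)).
Proof.
split=> [Cg|Ch].
  apply: clone_max => //.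
  have /choice[x xP] n : exists x : 'I_k.+1 -> nat, (forall i, x i <= n) /\ g x = box_max g n.
    by have [x] := box_max_attained g n; exists x.
  pose G i (y : 'I_1 -> nat) := x (y ord0) i.
  have CG i : C (Op (G i)).
    apply: Cid; exists 0, (G i); split=> // y; apply: leq_trans ((xP _).1 i) _.
    exact: leq_bigmax.
  have := CC.2 _ _ _ G Cg CG; congr (C (Op _)); apply: funext => y.
  by rewrite -(xP _).2.
have CM : C (Op (fun x : 'I_k.+1 -> nat => \max_i x i)).
  by apply: Cid; exists k, (fun x : 'I_k.+1 -> nat => \max_i x i).
have Chm := CC.2 _ _ _ (fun=> fun x : 'I_k.+1 -> nat => \max_i x i) Ch (fun=> CM).
apply: clone_down Chm _ => x; apply: growth_hull_ge => i; exact: leq_bigmax.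
Qed.

End Clones.

Lemma iter_homo (p : nat -> nat) k : {homo p : m n / m <= n} -> {homo iter k p : m n / m <= n}.
Proof. by move=> pm; elim: k => //= k IH m n /IH/pm. Qed.

Lemma iter_le (p q : nat -> nat) k n : {homo q : m n / m <= n} -> (forall m, p m <= q m) ->
  iter k p n <= iter k q n.
Proof. by move=> qm pq; elim: k => //= k IH; apply: leq_trans (pq _) _; exact: qm. Qed.

(** * Clones above the clone of a filter and cuts of growth functions *)

Section CloneInterval.
Variables (U : set_system nat) (FU : Filter U).
Hypothesis Uunb : forall A, U A -> forall m, exists2 a, A a & m <= a.
Variables (d : Order.disp_t) (D : orderType d) (phi : (nat -> nat) -> D).
Hypothesis phiP : forall f g, growth f -> growth g -> (growth_le U f g <-> (phi f <= phi g)%O).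
Hypothesis phi_surj : forall z, exists2 f, growth f & phi f = z.

Lemma next_in_growth A : U A -> growth (next_in A).
Proof.
move=> UA; split=> [m n mn|n]; last by have [] := next_inP n (Uunb UA).
have [_ _ mP] := next_inP m (Uunb UA); have [An nn _] := next_inP n (Uunb UA).
by apply: mP => //; exact: leq_ltn_trans nn.
Qed.

Lemma growth_step_homo A p : U A -> growth p ->
  {homo (fun m => maxn (p m) (next_in A m)) : m n / m <= n}.
Proof.
move=> UA [pm _] m n mn; have [nm _] := next_in_growth UA.
by rewrite geq_max !leq_max pm //= nm // orbT.
Qed.

Lemma growth_le_pointwise f g : (forall n, f n <= g n) -> growth_le U f g.
Proof.
by move=> fg; exists setT; [exact: filterT|exists 1 => n /=; rewrite leq_max fg].
Qed.

Lemma growth_le_next_in A g : U A -> growth_le U (next_in A) g.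
Proof. by move=> UA; exists A => //; exists 1 => n /=; rewrite leq_maxr. Qed.

(** [next_in] grows when the set shrinks, so both bounds may be iterated over the intersection of
    [A] and [B], which takes [k + l] steps. *)
Lemma growth_le_comp f g p : growth f -> growth p ->
  growth_le U f p -> growth_le U g p -> growth_le U (f \o g) p.
Proof.
move=> gf gp [A UA [k fk]] [B UB [l gl]].
have UAB : U (A `&` B) by exact: filterI.
exists (A `&` B) => //; exists (k + l) => n /=; rewrite iterD.
have sub X : U X -> A `&` B `<=` X -> forall m, next_in X m <= next_in (A `&` B) m.
  move=> UX sX m; have [_ _ mP] := next_inP m (Uunb UX).
  by have [/sX] := next_inP m (Uunb UAB); move=> Xn mn _; exact: mP.
have le X : U X -> A `&` B `<=` X -> forall m,
    maxn (p m) (next_in X m) <= maxn (p m) (next_in (A `&` B) m).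
  by move=> UX sX m; rewrite geq_max !leq_max leqnn /= (sub X) ?orbT.
have Qm := growth_step_homo UAB gp.
apply: leq_trans (fk _) _; apply: leq_trans (iter_le _ _ Qm (le A UA _)) _; first by move=> x [].
have Qk := @iter_homo _ k Qm; apply: Qk; apply: leq_trans (gl n) _.
by apply: (iter_le _ _ Qm (le B UB _)) => x [].
Qed.

Lemma growth_comp f g : growth f -> growth g -> growth (f \o g).
Proof.
move=> [fm fgt] [gm ggt]; split=> [m n mn|n]; first exact/fm/gm.
exact: ltn_trans (ggt n) (fgt _).
Qed.

Definition clone_cut (C : set operation) : set D :=
  [set z | exists f, [/\ growth f, C (unary_op f) & phi f = z]].

Lemma clones_aboveP C : clones_above (filter_clone U) C <->
  [/\ is_clone C, C_id `<=` C & forall A, U A -> C (unary_op (next_in A))].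
Proof.
split=> [[CC sub]|[CC Cid Cn]].
  have gsub : C_id `|` [set F | exists2 A, U A & F = unary_op (next_in A)] `<=` C.
    by apply: subset_trans sub; exact: sub_gen_smallest.
  by split=> // [F CF|A UA]; apply: gsub; [left|right; exists A].
split=> //; apply: smallest_sub => //.
by move=> F [/Cid//|[A UA ->]]; exact: Cn.
Qed.

Lemma clone_succ C : clones_above (filter_clone U) C -> C (unary_op succn).
Proof.
move=> /clones_aboveP[CC Cid /(_ _ (@filterT _ _ FU)) Cn].
apply: (clone_down CC Cid Cn) => x.
by have [] := next_inP (x ord0) (Uunb filterT).
Qed.

Lemma clone_growth_le C f g : clones_above (filter_clone U) C -> growth g ->
  growth_le U f g -> C (unary_op g) -> C (unary_op f).
Proof.
move=> /clones_aboveP[CC Cid Cn] gg [A UA [k fk]] Cg.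
have Cp : C (unary_op (fun m => maxn (g m) (next_in A m))).
  by apply: (clone_max CC Cid Cg); exact: Cn.
have Ck : C (unary_op (iter k (fun m => maxn (g m) (next_in A m)))).
  elim: k {fk} => [|k IH]; first exact: CC.1 0 ord0.
  exact: (clone_unary_comp CC Cp IH).
by apply: (clone_down CC Cid Ck) => x; exact: fk.
Qed.

Lemma clone_cut_subset C C' : clones_above (filter_clone U) C ->
  clones_above (filter_clone U) C' -> (C `<=` C' <-> clone_cut C `<=` clone_cut C').
Proof.
move=> aC aC'; split=> [sub z [f [gf Cf fz]]|sub [k g] Cg].
  by exists f; split=> //; exact: sub.
have [CC Cid _] := (clones_aboveP C).1 aC; have [CC' Cid' _] := (clones_aboveP C').1 aC'.
have gg := growth_hull_growth g.
have Ch := (clone_growth_hull CC Cid (clone_succ aC) g).1 Cg.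
apply/(clone_growth_hull CC' Cid' (clone_succ aC') g).
have [f [gf Cf fg]] : clone_cut C' (phi (growth_hull g)).
  by apply: sub; exists (growth_hull g).
by apply: (clone_growth_le aC' gf _ Cf); apply/phiP; rewrite ?fg.
Qed.

Lemma clone_cut_dedekind C : clones_above (filter_clone U) C -> dedekind D (clone_cut C).
Proof.
move=> aC; have [CC Cid Cn] := (clones_aboveP C).1 aC; split.
  exists (phi (next_in setT)), (next_in setT); split=> //.
    by apply: next_in_growth; exact: filterT.
  by apply: Cn; exact: filterT.
move=> x y [f [gf Cf fy]] xy; have [g gg gx] := phi_surj x.
exists g; split=> //; apply: (clone_growth_le aC gf _ Cf).
by apply/phiP => //; rewrite fy gx.
Qed.

(** The clone consists of the operations whose hull falls into the cut. Cuts are closed under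
    composition, since the larger of two growth functions bounds the composition for [growth_le]. *)
Lemma dedekind_clone (X : set D) : dedekind D X ->
  exists2 C, clones_above (filter_clone U) C & clone_cut C = X.
Proof.
move=> [[z0 Xz0] Xdown].
pose in_cut f := growth f /\ X (phi f).
have cut_le f g : growth f -> in_cut g -> growth_le U f g -> in_cut f.
  by move=> gf [gg Xg] fg; split=> //; apply: Xdown Xg _; exact/phiP.
have cut_comp f g : in_cut f -> in_cut g -> in_cut (f \o g).
  move=> cf cg; have [gf _] := cf; have [gg _] := cg; have gfg := growth_comp gf gg.
  have [/phiP fg|/phiP gf'] := orP (le_total (phi f) (phi g)).
    by apply: (cut_le _ g) => //; apply: growth_le_comp => //; [exact: fg|exact: growth_le_pointwise].
  by apply: (cut_le _ f) => //; apply: growth_le_comp => //; [exact: growth_le_pointwise|exact: gf'].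
(* Composition serves as an upper bound in place of the maximum, growth functions being above the
   identity. *)
have cut_max m (f : nat -> nat -> nat) : (forall i, i <= m -> in_cut (f i)) ->
    exists2 q, in_cut q & forall i, i <= m -> forall n, f i n <= q n.
  elim: m => [|m IH] cf.
    by exists (f 0); [exact: cf|move=> i; rewrite leqn0 => /eqP->].
  have [q cq qP] := IH (fun i im => cf i (leqW im)).
  exists (f m.+1 \o q); first by apply: cut_comp => //; exact: cf.
  move=> i; rewrite leq_eqVlt => /orP[/eqP-> n|im n] /=.
    by have [[fm _] _] := cf m.+1 (leqnn _); apply: fm; have [[_ qgt] _] := cq; exact: ltnW.
  by apply: leq_trans (qP i im n) _; have [[_ fgt] _] := cf m.+1 (leqnn _); exact: ltnW.
have [f0 gf0 f0z] := phi_surj z0; have cf0 : in_cut f0 by split; rewrite ?f0z.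
have C_small k (g : ('I_k.+1 -> nat) -> nat) : (forall x, g x <= \max_i x i) -> in_cut (growth_hull g).
  move=> gm; apply: (cut_le _ f0) => //; first exact: growth_hull_growth.
  apply: growth_le_pointwise => n; have [_ f0gt] := gf0; apply: growth_hull_le => // x xn.
  by apply: leq_trans (gm x) (ltnW (leq_ltn_trans _ (f0gt n))); apply/bigmax_leqP.
pose C : set operation := [set F | in_cut (growth_hull (projT2 F))].
have aC : clones_above (filter_clone U) C.
  apply/clones_aboveP; split; first split.
  - move=> k i; apply: C_small => x; exact: leq_bigmax.
  - move=> m k f g Cf Cg.
    have [q cq qP] := @cut_max m (fun i => growth_hull (g (inord i))) (fun i _ => Cg _).
    apply: (cut_le _ (growth_hull f \o q)); first exact: growth_hull_growth.
      exact: cut_comp.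
    apply: growth_le_pointwise => n; have [[_ qgt] _] := cq.
    have [hm hgt] := growth_hull_growth f.
    apply: growth_hull_le => [|x xn]; first exact: ltn_trans (qgt n) (hgt _).
    apply: growth_hull_ge => i; have := qP i (ltn_ord i : i <= m) n; rewrite inord_val.
    by apply: leq_trans; exact: growth_hull_ge.
  - by move=> _ [k [f [-> fm]]]; exact: C_small.
  (* [next_in A] lies under every growth function for [growth_le], hence in every nonempty cut. *)
  - move=> A UA; have gA := next_in_growth UA.
    rewrite /C /= growth_hull_unary //; apply: (cut_le _ f0) => //.
    exact: growth_le_next_in.
exists C => //; apply/seteqP; split=> [z [f [gf Cf <-]]|z Xz].
  by move: Cf; rewrite /C /= growth_hull_unary // => -[].
have [f gf fz] := phi_surj z; exists f; split=> //.
by rewrite /C /= growth_hull_unary //; split; rewrite ?fz.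
Qed.

Lemma clone_interval : order_isomorphic
  (clones_above (filter_clone U)) (@subset operation) (dedekind D) (@subset D).
Proof.
exists clone_cut; last exact: clone_cut_subset.
split.
- exact: clone_cut_dedekind.
- move=> C C' /set_mem aC /set_mem aC' e; apply/seteqP.
  by split; apply/clone_cut_subset => //; rewrite e.
- by move=> X /dedekind_clone[C aC <-]; exists C.
Qed.

End CloneInterval.

(** The sets containing almost all leaves of one zoo already form a filter containing the
    generators; conversely such a set contains [zext (s i)] intersected with a cofinite set. *)
Lemma generated_filterP (V : Type) (d : Order.disp_t) (W : orderType d) (s : W -> zoo V) :
  is_omega1 W -> sufficiently_generic s -> forall P,
  generated_filter s P <-> exists i, eventually_on (forest_of (s i)) P.
Proof.
move=> W1 gen P; pose U0 : set_system nat := fun P => exists i, eventually_on (forest_of (s i)) P.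
have UU0 : UltraFilter U0.
  by apply: (generic_ultrafilter (zoo_generic_forests gen) W1) => Q.
split=> [|[i [n nP]] X [FX gX]].
  apply: (@smallest_sub _ (@Filter nat) _ U0) => // A [[i ->]|[n _ nA]].
    by exists i, 0.
  have [i _] := omega1_inhabited W1; exists i, n => k _ nk; exact: nA.
have X1 : X (zext (s i)) by apply: gX; left; exists i.
have X2 : X [set k | n <= k] by apply: gX; right; exists n.
by apply: filterS2 X1 X2 => k; exact: nP.
Qed.

Lemma order_iso_le d (D : orderType d) d' (D' : orderType d') (psi : D -> D') T (A : set T)
    (r : T -> T -> Prop) (phi : T -> D) : order_iso psi ->
  (forall x y, A x -> A y -> (r x y <-> (phi x <= phi y)%O)) ->
  (forall z, exists2 x, A x & phi x = z) ->
  (forall x y, A x -> A y -> (r x y <-> (psi (phi x) <= psi (phi y))%O)) /\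
  (forall z, exists2 x, A x & psi (phi x) = z).
Proof.
move=> [psi_le psi_surj] phiP surj; split=> [x y Ax Ay|z].
  by rewrite psi_le; exact: phiP.
by have [y <-] := psi_surj z; have [x Ax <-] := surj y; exists x.
Qed.

Theorem mainTheorem3 (V : Type) (d : Order.disp_t) (W : orderType d)
    (s : W -> zoo V) (U : set_system nat) :
  CH -> is_omega1 W -> sufficiently_generic s -> U = generated_filter s ->
  UltraFilter U /\
  (exists (d1 : Order.disp_t) (D1 : orderType d1)
          (d2 : Order.disp_t) (D2 : orderType d2),
     is_D1 W D1 /\ is_D2 D1 D2) /\
  (forall (d1 : Order.disp_t) (D1 : orderType d1)
          (d2 : Order.disp_t) (D2 : orderType d2),
     is_D1 W D1 -> is_D2 D1 D2 ->
     [/\ order_isomorphic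
           (quotient (seq_front s) (seq_front_eq s))
           (quotient_le (seq_front_le s))
           [set: D2]%classic (@ole _ D2),
         order_isomorphic
           (quotient growth (growth_eq U)) (quotient_le (growth_le U))
           [set: D2]%classic (@ole _ D2)
       & order_isomorphic
           (clones_above (filter_clone U)) (@subset operation)
           (dedekind D2) (@subset D2)]).
Proof.
move=> ch W1 gen UE0.
pose T i := forest_of (s i); have GT : generic_forests T := zoo_generic_forests gen.
have UE P : U P <-> exists i, eventually_on (T i) P by rewrite UE0; exact: generated_filterP.
have UU : UltraFilter U := generic_ultrafilter GT W1 UE.
(* This concrete pair of orders settles existence, and uniqueness transports [phi0] to the given
   orders. *)
have [d1 [D1 [d2 [D2 [phi0 [phi0P phi0_surj D1P D2P]]]]]] :=
  ultrapower_D1_D2 UU (front_height0 GT W1) (front_height_succ GT)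
    (front_height_pred GT) (front_height_fill GT W1 UE) (front_height_unbounded GT W1 UE) ch W1.
split=> //; split; first by exists d1, D1, d2, D2.
move=> d1' D1' d2' D2' D1P' D2P'.
have [psi1 iso1] := D1_unique W1 D1P D1P'.
have [psi iso] := D2_unique D2P D2P' iso1.
pose phi h := psi (phi0 h).
have [phiP phi_surj] :
    (forall h g, front_height T h -> front_height T g -> (ule U h g <-> (phi h <= phi g)%O)) /\
    (forall z, exists2 h, front_height T h & phi h = z).
  exact: order_iso_le iso phi0P phi0_surj.
have phiE h g : front_height T h -> front_height T g -> (U [set k | h k = g k] <-> phi h = phi g).
  move=> Hh Hg; split=> e.
    apply/eqP; rewrite eq_le; apply/andP.
    by split; apply/phiP => //; apply: filterS e => k /= ->.
  have [h1 h2] : ule U h g /\ ule U g h by split; apply/phiP => //; rewrite e.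
  by apply: filterS2 h1 h2 => k /= a b; apply/eqP; rewrite eqn_leq a.
(* The value chosen for a set that is not a front, and likewise below for a function that is not a
   growth function, is arbitrary. *)
have /choice[hgt hgtP] F : exists h, seq_front s F -> front_height T h /\ height_of s F h.
  have [Fs|no] := pselect (seq_front s F); last by exists id => Fs; case: no.
  by have [h hF] := seq_front_height gen Fs; exists h.
have /choice[ght ghtP] f : exists h, growth f -> front_growth T h f.
  have [gf|no] := pselect (growth f); last by exists id => gf; case: no.
  by have [h hf] := front_growth_exists GT gf; exists h.
have ght_height f : growth f -> front_height T (ght f).
  by move=> /ghtP[i [n [ch' _]]]; exists i, n.
have growthP f g : growth f -> growth g -> (growth_le U f g <-> (phi (ght f) <= phi (ght g))%O).
  move=> gf gg; split=> [fg|/(phiP _ _ (ght_height f gf) (ght_height g gg)) h].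
    apply/phiP; [exact: ght_height|exact: ght_height|].
    exact: (ule_of_growth_le GT W1 UE (ghtP f gf) (ghtP g gg) gf gg fg).
  exact: (growth_le_of_ule GT UE (ghtP f gf) (ghtP g gg) gf gg h).
have growth_surj z : exists2 f, growth f & phi (ght f) = z.
  have [h [i [n cohh]] <-] := phi_surj z.
  (* Both [h] and [ght f] are height functions for [f]; comparing [f] with itself in both directions
     identifies them modulo [U]. *)
  have [f gf hf] := coherent_represents (gf_forest GT i) cohh.
  have fh : front_growth T h f by exists i, n.
  have Hh : front_height T h by exists i, n.
  have ff : growth_le U f f by apply: growth_le_pointwise.
  exists f => //; apply/eqP; rewrite eq_le; apply/andP.
  split; apply/phiP => //; try exact: ght_height.
    exact: (ule_of_growth_le GT W1 UE (ghtP f gf) fh gf gf ff).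
  exact: (ule_of_growth_le GT W1 UE fh (ghtP f gf) gf gf ff).
split.
- apply: (order_isomorphic_quotient (phi := fun F => phi (hgt F)) set0).
  + move=> F G Fs Gs; have [HF hF] := hgtP F Fs; have [HG hG] := hgtP G Gs.
    by move=> /(seq_front_le_height gen W1 UE hF hG)/phiP; apply.
  + move=> F G Fs Gs; have [HF hF] := hgtP F Fs; have [HG hG] := hgtP G Gs.
    move=> /(phiP _ _ HF HG) h; exists F, G; split=> //.
    exact/(seq_front_le_height gen W1 UE hF hG).
  + move=> F G Fs Gs; have [HF hF] := hgtP F Fs; have [HG hG] := hgtP G Gs.
    by rewrite -phiE //; exact: (seq_front_eq_height gen W1 UE hF hG).
  + move=> z; have [h Hh <-] := phi_surj z.
    have [F Fs hF] := front_height_front Hh; exists F => //.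
    have [HF hF'] := hgtP F Fs; apply/phiE => //.
    (* [h] and [hgt F] are both height functions of [F], so reflexivity makes them equal modulo
       [U]. *)
    have Fle : seq_front_eq s F F.
      have [i Fi] := Fs; exists i, i, i; split=> //.
      by rewrite /front_eq setYK; exact: finite_set0.
    exact: (seq_front_eq_height gen W1 UE hF' hF).1.
- apply: (order_isomorphic_quotient (phi := fun f => phi (ght f)) id) => //.
  + by move=> f g gf gg /growthP; apply.
  + by move=> f g gf gg /growthP-/(_ gf gg) fg; exists f, g.
  + move=> f g gf gg; rewrite /growth_eq !growthP //; split=> [[h1 h2]|->]; last by rewrite lexx.
    by apply/eqP; rewrite eq_le h1.
- exact: (clone_interval (phi := fun f => phi (ght f)) _ (U_unbounded GT UE) growthP growth_surj).
Qed.
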